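(* Let $\mathcal{H}$ be a unitarily invariant space on $\mathbb{B}_d$ such that the polynomials are multipliers of $\mathcal{H}$. Then the $\operatorname{Mult}(\mathcal{H})$-Henkin measures form a band; that is, if $\mu,\nu\in M(\partial\mathbb{B}_d)$ are such that $\mu$ is $\operatorname{Mult}(\mathcal{H})$-Henkin and $\nu\ll\mu$, then $\nu$ is $\operatorname{Mult}(\mathcal{H})$-Henkin.
   Context: A unitarily invariant space on the open unit ball $\mathbb{B}_d\subset\mathbb{C}^d$ ($d<\infty$) is a reproducing kernel Hilbert space $\mathcal{H}$ on $\mathbb{B}_d$ with kernel $K(z,w)=\sum_{n=0}^\infty a_n\langle z,w\rangle^n$, $a_0=1$, $a_n>0$ for all $n\in\mathbb{N}$. $\operatorname{Mult}(\mathcal{H})$ is the multiplier algebra, identified with the algebra of multiplication operators $M_\varphi$ in $B(\mathcal{H})$, with the operator norm and the weak-$*$ topology it has as the dual of $B(\mathcal{H})_*/\operatorname{Mult}(\mathcal{H})_\perp$. $A(\mathcal{H})$ is the norm closure of $\mathbb{C}[z_1,\ldots,z_d]$ in $\operatorname{Mult}(\mathcal{H})$; its elements extend uniquely to continuous functions on $\overline{\mathbb{B}_d}$. $M(\partial\mathbb{B}_d)$ is the space of complex regular Borel measures on $\partial\mathbb{B}_d$. For complex measures, $\nu\ll\mu$ means $\nu\ll|\mu|$. A measure $\mu\in M(\partial\mathbb{B}_d)$ is $\operatorname{Mult}(\mathcal{H})$-Henkin if the functional $f\mapsto\int_{\partial\mathbb{B}_d}f\,d\mu$ on $A(\mathcal{H})$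 extends to a weak-$*$ continuous functional on $\operatorname{Mult}(\mathcal{H})$. *)

(* Defs.v *)
(* The field C is R[i] for R : realType. *)
From HB Require Import structures.
From mathcomp Require Import all_boot all_order all_algebra.
From mathcomp Require Import sesquilinear.
From mathcomp Require Import complex.
From mathcomp Require Import all_classical all_reals all_analysis.
From mathcomp Require mpoly.
Set Implicit Arguments.
Unset Strict Implicit.
Unset Printing Implicit Defensive.
Import Order.TTheory GRing.Theory Num.Theory.
Import numFieldNormedType.Exports.
Local Open Scope classical_set_scope.
Local Open Scope ring_scope.
Local Open Scope complex_scope.

HB.instance Definition _ (R : realType) :=
  PseudoPointedMetric.copy R[i] R[i]^o.
HB.instance Definition _ (R : realType) := NormedModule.copy R[i] R[i]^o.

(* The Euclidean inner product of C^d: the norm that the library puts on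
   'rV[R[i]]_d is the maximum norm. *)
Definition hdot (R : realType) (d : nat) (z w : 'rV[R[i]]_d) : R[i] :=
  \sum_(i < d) z 0 i * (w 0 i)^*%C.

Section geometry.
Variables (R : realType) (d : nat).

Definition uball : Type := {z : 'rV[R[i]]_d | hdot z z < 1}.

Definition closed_uball : set 'rV[R[i]]_d := [set z | hdot z z <= 1].

End geometry.

(* A measurableType must be inhabited, hence d.+1. *)
Definition usphere (R : realType) (d : nat) : Type :=
  {z : 'rV[R[i]]_d.+1 | hdot z z == 1}.

Section sphere.
Variables (R : realType) (d : nat).
Local Notation S := (usphere R d).

Lemma usphere_point_subproof :
  hdot (delta_mx 0 0 : 'rV[R[i]]_d.+1) (delta_mx 0 0) == 1.
Proof.
apply/eqP; rewrite /hdot (bigD1 ord0)//= !mxE !eqxx conjc1 mulr1 big1 ?addr0//.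
by move=> i i0; rewrite !mxE (negbTE i0) andbF mul0r.
Qed.

HB.instance Definition _ := Choice.on S.
HB.instance Definition _ := Topological.copy S
  (initial_topology (sval : S -> 'rV[R[i]]_d.+1)).
HB.instance Definition _ :=
  isPointed.Build S (exist _ (delta_mx 0 0) usphere_point_subproof).

(* the sphere with its Borel sigma-algebra *)
Definition bsphere := g_sigma_algebraType (@open S).
HB.instance Definition _ := Measurable.on bsphere.

End sphere.

(* The library's charges are the finite countably additive set functions; with
   values in \bar R[i] they are the complex measures. *)
Section complex_measures.
Context d (T : measurableType d) (R : realType).
Implicit Types (mu : {charge set T -> \bar R[i]}) (A : set T).

Definition chRe mu A : \bar R := (complex.Re (fine (mu A)))%:E.
Definition chIm mu A : \bar R := (complex.Im (fine (mu A)))%:E.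

Lemma cvg_complex_parts (u : nat -> R[i]) (l : R[i]) : u @ \oo --> l ->
  (fun n => complex.Re (u n)) @ \oo --> complex.Re l /\
  (fun n => complex.Im (u n)) @ \oo --> complex.Im l.
Proof.
move=> /cvgrPdist_lt ul.
have Re_le (z : R[i]) : (`|complex.Re z|%:C <= `|z|)%R := normc_ge_Re z.
have Im_le (z : R[i]) : (`|complex.Im z|%:C <= `|z|)%R.
  rewrite normc_def lecR -[leLHS]sqrtr_sqr; apply: ler_wsqrtr.
  by rewrite lerDr sqr_ge0.
have ReB (x y : R[i]) : complex.Re (x - y) = complex.Re x - complex.Re y.
  by case: x y => a b [].
have ImB (x y : R[i]) : complex.Im (x - y) = complex.Im x - complex.Im y.
  by case: x y => a b [].
split; apply/cvgrPdist_lt => e e0;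
  have /ul : (0 < e%:C)%R by rewrite ltcR.
- apply: filterS => n; rewrite -ReB -ltcR; exact: le_lt_trans.
- apply: filterS => n; rewrite -ImB -ltcR; exact: le_lt_trans.
Qed.

Section parts.
Variable mu : {charge set T -> \bar R[i]}.

Let cvg_fine (F : nat -> set T) : (forall i, measurable (F i)) ->
  trivIset setT F -> measurable (\bigcup_n F n) ->
  (fun n => \sum_(0 <= i < n) fine (mu (F i))) @ \oo -->
  fine (mu (\bigcup_n F n)).
Proof.
move=> mF tF mUF; have := @charge_semi_sigma_additive _ _ _ mu F mF tF mUF.
rewrite -(fineK (fin_num_measure mu _ mUF)).
under eq_fun do under eq_bigr do rewrite -(fineK (fin_num_measure mu _ (mF _))).
under eq_fun do rewrite sumEFin.
move=> h B /= nB.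
have nB' : nbhs (fine (mu (\bigcup_n F n)))%:E (EFin @` B).
  have : nbhs (fine (mu (\bigcup_n F n))) (fun r => (EFin @` B) r%:E).
    by apply: filterS nB => r Br; exists r.
  exact.
by have [N _ hN] := h _ nB'; exists N => // n /hN [r Br [rE]]; rewrite /= -rE.
Qed.

Let sum_parts (u : nat -> R[i]) n :
  \sum_(0 <= i < n) complex.Re (u i) = complex.Re (\sum_(0 <= i < n) u i) /\
  \sum_(0 <= i < n) complex.Im (u i) = complex.Im (\sum_(0 <= i < n) u i).
Proof.
elim: n => [|n [IHr IHi]]; first by rewrite !big_geq.
rewrite !big_nat_recr//= IHr IHi.
by case: (\sum_(0 <= i < n) u i) (u n) => a b [].
Qed.

Let chRe0 : chRe mu set0 = 0%E. Proof. by rewrite /chRe charge0. Qed.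

Let chIm0 : chIm mu set0 = 0%E. Proof. by rewrite /chIm charge0. Qed.

Let chRe_fin A : measurable A -> chRe mu A \is a fin_num. Proof. by []. Qed.

Let chIm_fin A : measurable A -> chIm mu A \is a fin_num. Proof. by []. Qed.

Let chRe_sigma : semi_sigma_additive (chRe mu).
Proof.
move=> F mF tF mUF; have [h _] := cvg_complex_parts (cvg_fine mF tF mUF).
have -> : (fun n => (\sum_(0 <= i < n) chRe mu (F i))%E) =
    EFin \o (fun n => complex.Re (\sum_(0 <= i < n) fine (mu (F i)))).
  by apply/funext => n; rewrite /chRe sumEFin/= (sum_parts _ n).1.
exact: cvg_comp h _.
Qed.

Let chIm_sigma : semi_sigma_additive (chIm mu).
Proof.
move=> F mF tF mUF; have [_ h] := cvg_complex_parts (cvg_fine mF tF mUF).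
have -> : (fun n => (\sum_(0 <= i < n) chIm mu (F i))%E) =
    EFin \o (fun n => complex.Im (\sum_(0 <= i < n) fine (mu (F i)))).
  by apply/funext => n; rewrite /chIm sumEFin/= (sum_parts _ n).2.
exact: cvg_comp h _.
Qed.

HB.instance Definition _ :=
  isCharge.Build _ T R (chRe mu) chRe0 chRe_fin chRe_sigma.
HB.instance Definition _ :=
  isCharge.Build _ T R (chIm mu) chIm0 chIm_fin chIm_sigma.

End parts.

Definition total_variation mu A : \bar R :=
  ereal_sup [set (\sum_(0 <= i <oo) (complex.Re `|fine (mu (F i))|)%:E)%E | F in
    [set F : nat -> set T | [/\ forall i, measurable (F i), trivIset setT F &
                                \bigcup_i F i = A]]].

Definition abs_continuous (nu mu : {charge set T -> \bar R[i]}) :=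
  forall A, measurable A -> total_variation mu A = 0%E -> nu A = 0%E.

(* The integral against a signed measure, through its Jordan decomposition;
   the choice of the Hahn decomposition is immaterial by
   Hahn_decomposition_uniq. *)
Definition integral_charge (nu : {charge set T -> \bar R}) (f : T -> R) : R :=
  let nuPN := projT2 (cid (projT2 (cid (Hahn_decomposition nu)))) in
  Rintegral (jordan_pos nuPN) setT f - Rintegral (jordan_neg nuPN) setT f.

Definition integral_complex mu (f : T -> R[i]) : R[i] :=
  let u x := complex.Re (f x) in
  let v x := complex.Im (f x) in
  (integral_charge (chRe mu) u - integral_charge (chIm mu) v) +i*
  (integral_charge (chRe mu) v + integral_charge (chIm mu) u).

End complex_measures.

Definition regular_measure (R : realType) (d : nat)
    (mu : {charge set bsphere R d -> \bar R[i]}) :=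
  forall A : set (usphere R d), measurable (A : set (bsphere R d)) ->
    total_variation mu A =
      ereal_inf [set total_variation mu U | U in
        [set U : set (usphere R d) | open U /\ A `<=` U]] /\
    total_variation mu A =
      ereal_sup [set total_variation mu C | C in
        [set C : set (usphere R d) | compact C /\ C `<=` A]].

(* A reproducing kernel Hilbert space on X: a Hilbert space whose elements f
   are identified with the functions rkhs_eval f on X.  The scalar products
   with rkhs_point x are the point evaluations. *)
Record rkhs (R : realType) (X : Type) := Rkhs {
  rkhs_space :> completeNormedModType R[i] ;
  rkhs_dot : {dot rkhs_space for Num.conj} ;
  rkhs_normE : forall f : rkhs_space, `|f| ^+ 2 = rkhs_dot f f ;
  rkhs_eval : {linear rkhs_space -> (X -> R[i])} ;
  rkhs_eval_inj : injective rkhs_eval ;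
  rkhs_point : X -> rkhs_space ;
  rkhs_reproducing : forall (f : rkhs_space) (x : X),
    rkhs_eval f x = rkhs_dot f (rkhs_point x) }.

Section multipliers.
Variables (R : realType) (X : Type) (H : rkhs R X).

Definition rkhs_kernel (z w : X) : R[i] := rkhs_eval H (rkhs_point H w) z.

Definition is_multiplier (phi : X -> R[i]) :=
  forall f : H, exists g : H, forall x, rkhs_eval H g x = phi x * rkhs_eval H f x.

Definition multiplier_pred : pred (X -> R[i]) :=
  fun phi => `[< is_multiplier phi >].

Lemma multiplier_submod_closed : submod_closed multiplier_pred.
Proof.
split=> [|a phi psi].
  by apply/asboolP => f; exists 0 => x; rewrite linear0 mul0r.
move=> /asboolP Mphi /asboolP Mpsi; apply/asboolP => f.
have [g gE] := Mphi f; have [h hE] := Mpsi f.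
exists (a *: g + h) => x.
by rewrite linearP/= !fctE/= gE hE mulrDl -scalerAl.
Qed.

HB.instance Definition _ := GRing.isSubmodClosed.Build R[i] (X -> R[i])
  multiplier_pred multiplier_submod_closed.

Definition Mult : Type := {phi : X -> R[i] | multiplier_pred phi}.
HB.instance Definition _ := SubChoice.on Mult.
HB.instance Definition _ := [SubChoice_isSubLmodule of Mult by <:].

End multipliers.

Section multiplier_algebra.
Variables (R : realType) (X : Type) (H : rkhs R X).

(* The multiplication operator; g is unique by rkhs_eval_inj. *)
Definition mult_op (phi : Mult H) (f : H) : H :=
  xget 0 [set g : H | forall x, rkhs_eval H g x = val phi x * rkhs_eval H f x].

Definition mult_norm (phi : Mult H) : \bar R :=
  ereal_sup [set (complex.Re `|mult_op phi f|)%:E | f in [set f : H | `|f| <= 1]].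

(* The predual B(H)_* of B(H), as the space of functionals
   T |-> \sum_n <T f_n, g_n> with (f_n) and (g_n) square summable. *)
Record predual := Predual {
  predual_l : nat -> H ;
  predual_r : nat -> H ;
  predual_l_summable : cvgn (series (fun n => `|predual_l n| ^+ 2)) ;
  predual_r_summable : cvgn (series (fun n => `|predual_r n| ^+ 2)) }.

Definition predual_eval (w : predual) (A : H -> H) : R[i] :=
  limn (series (fun n => rkhs_dot H (A (predual_l w n)) (predual_r w n))).

(* The weak-* topology of Mult(H) as the dual of B(H)_* / Mult(H)_\perp: the
   class of w pairs with phi as w does with the multiplication operator. *)
Definition weak_star : Type := sup_topology (fun w : predual =>
  Topological.class
    (initial_topology (fun phi : Mult H => predual_eval w (mult_op phi)))).
HB.instance Definition _ := Topological.on weak_star.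

Definition mult_closure (B : set (Mult H)) : set (Mult H) :=
  [set phi | forall e : R, 0 < e ->
    exists psi, B psi /\ (mult_norm (phi - psi)%R < e%:E)%E].

End multiplier_algebra.

Section henkin.
Variables (R : realType) (d : nat).
Implicit Types H : rkhs R (uball R d.+1).

Definition unitarily_invariant H :=
  exists a : nat -> R, [/\ a 0 = 1, forall n, 0 < a n &
    forall z w : uball R d.+1,
      series (fun n => (a n)%:C * hdot (sval z) (sval w) ^+ n) @ \oo -->
        rkhs_kernel H z w].

Definition poly_fun (p : mpoly.mpoly d.+1 R[i]) (z : uball R d.+1) : R[i] :=
  mpoly.meval (fun i => sval z 0 i) p.

Definition A_alg H : set (Mult H) :=
  mult_closure [set phi | exists p, val phi = poly_fun p].
Arguments A_alg H : clear implicits.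

(* Only the values of F on the closed ball matter; they are determined by phi. *)
Definition boundary_extension (phi : uball R d.+1 -> R[i])
    (F : 'rV[R[i]]_d.+1 -> R[i]) :=
  {within @closed_uball R d.+1, continuous F} /\ forall z, F (sval z) = phi z.

Definition henkin H (mu : {charge set bsphere R d -> \bar R[i]}) :=
  exists L : {scalar Mult H}, continuous (L : weak_star H -> R[i]) /\
    forall f, A_alg H f -> forall F, boundary_extension (val f) F ->
      L f = integral_complex mu (fun z => F (sval z)).

End henkin.
Arguments A_alg {R d} H _.

(* Main.v *)
(** Let tau dominate mu and nu, with densities theta and g.  For u in L^1(tau),
    call p |-> \int p u dtau tame if for every e it is bounded by
    e ||p|| + K sup_{s B} |p| with some s < 1 and some K.

    Tameness characterizes weak-* continuity.  It holds for a normal functional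
    because the kernel functions are total.  Conversely, the Fejer means of p
    are contractive and converge to p uniformly on smaller balls, so a tame
    functional is a norm limit of functionals that depend on finitely many
    coefficients; these are, up to an arbitrarily small error and with control
    of the norm, finite sums of vector functionals, by convexity in finite
    dimension, and the resulting series converges.

    The tame densities form a band.  For the supremum norm, conj(z_j) u is tame
    if u is: on the sphere conj(z_j) p differs from the polynomial obtained by
    integrating the derivative of p along rays by a tangential derivative, which
    Cauchy's estimate controls on smaller balls.  A monotone class argument then
    makes this class stable under bounded Borel multipliers.  For the multiplier
    norm, only polynomial multiples of theta are tame at once; given a bounded
    Borel v, let r be the difference between v and its best polynomial
    approximation in L^2(|theta| tau).  Then r theta is a unimodular multiple of
    a density that annihilates the polynomials, hence tame already for the
    supremum norm. *)
Require Import Defs.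
From HB Require Import structures.
From mathcomp Require Import all_boot all_order all_algebra.
From mathcomp Require Import cyclic separable cyclotomic.
From mathcomp Require Import complex polyrcf.
From mathcomp Require Import -(notations) mpoly.
From mathcomp Require Import all_classical all_reals all_analysis measurable_realfun.
From mathcomp Require Import ring lra zify.
Set Implicit Arguments.
Unset Strict Implicit.
Unset Printing Implicit Defensive.
Import Order.TTheory GRing.Theory Num.Theory.
Import numFieldNormedType.Exports.
Local Open Scope classical_set_scope.
Local Open Scope ring_scope.
Local Open Scope complex_scope.

(** Tameness is an inequality on polynomials, so it survives limits of densities in $L^1(\tau)$, and
    the weak-* topology is met only in its characterization. The obstacle that shapes the band
    argument is that the polynomial $q$ correcting $\bar z_j p$ is bounded in supremum norm only;
    its multiplier norm is out of reach. Nonholomorphic factors are therefore handled for the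
    supremum norm alone, and the result is transferred in the one direction that is available: the
    multiplier norm dominates the supremum norm, so tameness for the latter is the stronger
    property. Working in $L^2(|\theta|\tau)$ is what makes the transfer possible: orthogonality of
    the residual $r$ to the polynomials says exactly that $\bar r|\theta|$ annihilates them, and
    annihilators are tame for any norm. The best approximation need not be a polynomial; only its
    product with $\theta$ is needed, and this is an $L^1(\tau)$ limit of polynomial multiples of
    $\theta$. No constant is sharp: most factors 2 come from estimating real and imaginary parts
    separately. *)

Section cabs.
Variable R : realType.
Implicit Types x y : R[i].

(** The norm of [R[i]] takes its values in [R[i]]; taking the real part moves all estimates to the
    ordered field [R], where [lra] and [nra] apply. *)
Definition cabs x : R := complex.Re `|x|.

Lemma cabsE x : `|x| = (cabs x)%:C.
Proof. by rewrite /cabs normc_def. Qed.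

Lemma cabsP x (M : R) : (cabs x <= M) = (`|x| <= M%:C).
Proof. by rewrite cabsE lecR. Qed.

Lemma cabs_sqrt x : cabs x = Num.sqrt (complex.Re x ^+ 2 + complex.Im x ^+ 2).
Proof. by rewrite /cabs normc_def. Qed.

Lemma cabs_ge0 x : 0 <= cabs x.
Proof. by rewrite cabs_sqrt sqrtr_ge0. Qed.

Lemma cabs_sqr x : cabs x ^+ 2 = complex.Re x ^+ 2 + complex.Im x ^+ 2.
Proof. by rewrite cabs_sqrt sqr_sqrtr ?addr_ge0 ?sqr_ge0. Qed.

Lemma cabs_mulJ x : (cabs x ^+ 2)%:C = x * x^*%C.
Proof. by rewrite -sqr_normc cabsE rmorphXn. Qed.

Lemma cabs0 : cabs 0 = 0. Proof. by rewrite /cabs normr0. Qed.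

Lemma cabs1 : cabs 1 = 1. Proof. by rewrite /cabs normr1. Qed.

Lemma cabs_eq0 x : (cabs x == 0) = (x == 0).
Proof. by rewrite -[RHS]normr_eq0 cabsE -(inj_eq (@complexI R)). Qed.

Lemma cabs_real (r : R) : cabs r%:C = `|r|.
Proof. by rewrite cabs_sqrt /= expr0n addr0 sqrtr_sqr. Qed.

Lemma cabsM x y : cabs (x * y) = cabs x * cabs y.
Proof. by apply: complexI; rewrite rmorphM/= -!cabsE normrM. Qed.

Lemma cabsN x : cabs (- x) = cabs x. Proof. by rewrite /cabs normrN. Qed.

Lemma cabsJ x : cabs x^*%C = cabs x. Proof. by rewrite /cabs normcJ. Qed.

Lemma cabsX x k : cabs (x ^+ k) = cabs x ^+ k.
Proof. by apply: complexI; rewrite rmorphXn/= -!cabsE normrX. Qed.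

Lemma cabsV x : cabs x^-1 = (cabs x)^-1.
Proof.
have [->|x0] := eqVneq x 0; first by rewrite invr0 cabs0 invr0.
apply: (mulfI (_ : cabs x != 0)); first by rewrite cabs_eq0.
by rewrite -cabsM !divff ?cabs_eq0// cabs1.
Qed.

Lemma cabsD x y : cabs (x + y) <= cabs x + cabs y.
Proof. by rewrite cabsP rmorphD/= -!cabsE ler_normD. Qed.

Lemma cabsB x y : cabs (x - y) <= cabs x + cabs y.
Proof. by rewrite -(cabsN y); exact: cabsD. Qed.

Lemma cabsC x y : cabs (x - y) = cabs (y - x).
Proof. by rewrite -cabsN opprB. Qed.

Lemma cabs_sum (I : Type) (r : seq I) (P : pred I) (F : I -> R[i]) :
  cabs (\sum_(i <- r | P i) F i) <= \sum_(i <- r | P i) cabs (F i).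
Proof.
elim/big_ind2: _ => //; first by rewrite cabs0.
by move=> a b c d' ab cd; apply: (le_trans (cabsD _ _)); apply: lerD.
Qed.

Lemma cabs_nat k : cabs k%:R = k%:R.
Proof.
have -> : (k%:R : R[i]) = (k%:R)%:C by rewrite rmorph_nat.
by rewrite cabs_real ger0_norm.
Qed.

Lemma Re_le_cabs x : `|complex.Re x| <= cabs x.
Proof. by rewrite cabs_sqrt -[leLHS]sqrtr_sqr ler_wsqrtr// lerDl sqr_ge0. Qed.

Lemma Im_le_cabs x : `|complex.Im x| <= cabs x.
Proof. by rewrite cabs_sqrt -[leLHS]sqrtr_sqr ler_wsqrtr// lerDr sqr_ge0. Qed.

Lemma cabs_le_ReIm x : cabs x <= `|complex.Re x| + `|complex.Im x|.
Proof.
rewrite -(@ler_pXn2r _ 2) ?nnegrE ?cabs_ge0 ?addr_ge0// cabs_sqr sqrrD.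
rewrite !real_normK ?num_real// lerD2r lerDl.
by rewrite mulrn_wge0// mulr_ge0.
Qed.

Lemma cReD x y : complex.Re (x + y) = complex.Re x + complex.Re y.
Proof. by case: x y => a b []. Qed.
Lemma cImD x y : complex.Im (x + y) = complex.Im x + complex.Im y.
Proof. by case: x y => a b []. Qed.
Lemma cReN x : complex.Re (- x) = - complex.Re x. Proof. by case: x. Qed.
Lemma cImN x : complex.Im (- x) = - complex.Im x. Proof. by case: x. Qed.
Lemma cReM x y : complex.Re (x * y) =
  complex.Re x * complex.Re y - complex.Im x * complex.Im y.
Proof. by case: x y => a b []. Qed.
Lemma cImM x y : complex.Im (x * y) =
  complex.Re x * complex.Im y + complex.Im x * complex.Re y.
Proof. by case: x y => a b [] c d /=; rewrite addrC. Qed.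
Lemma cReJ x : complex.Re x^*%C = complex.Re x. Proof. by case: x. Qed.
Lemma cImJ x : complex.Im x^*%C = - complex.Im x. Proof. by case: x. Qed.

Lemma cRe_sum (I : Type) (r : seq I) (P : pred I) (F : I -> R[i]) :
  complex.Re (\sum_(i <- r | P i) F i) = \sum_(i <- r | P i) complex.Re (F i).
Proof. by apply: (big_morph _ cReD). Qed.

Lemma cIm_sum (I : Type) (r : seq I) (P : pred I) (F : I -> R[i]) :
  complex.Im (\sum_(i <- r | P i) F i) = \sum_(i <- r | P i) complex.Im (F i).
Proof. by apply: (big_morph _ cImD). Qed.

End cabs.

(** * Complex polynomials in one variable: Cauchy estimate and mean value inequality *)

Section univariate.
Variable R : realType.
Local Notation C := R[i].

Lemma prim_root_exists (n : nat) : (0 < n)%N ->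
  {z : C | n.-primitive_root z}.
Proof.
pose p : {poly C} := 'X^n - 1; have [r Dp] := closed_field_poly_normal p => n_gt0.
apply/sigW; rewrite (monicP _) ?monicXnsubC // scale1r in Dp.
have rn1 : all n.-unity_root r by apply/allP=> z; rewrite -root_prod_XsubC -Dp.
have sz_r : (n < (size r).+1)%N.
  by rewrite -(size_prod_XsubC r id) -Dp size_XnsubC.
have [|z] := hasP (has_prim_root n_gt0 rn1 _ sz_r); last by exists z.
by rewrite -separable_prod_XsubC -Dp separable_Xn_sub_1 // pnatr_eq0 -lt0n.
Qed.

Lemma cabs_prim_root n (z : C) : n.-primitive_root z -> cabs z = 1.
Proof.
move=> pz; have n0 := prim_order_gt0 pz.
apply: (@pexpIrn _ n) => //; rewrite ?nnegrE ?cabs_ge0//.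
by rewrite -cabsX (prim_expr_order pz) cabs1 expr1n.
Qed.

Lemma sum_prim_root n (z : C) m : n.-primitive_root z ->
  \sum_(j < n) z ^+ (j * m) = if (n %| m)%N then n%:R else 0.
Proof.
move=> pz; case: ifPn => nm.
  rewrite (eq_bigr (fun=> 1)); first by rewrite sumr_const card_ord.
  by move=> j _; apply/eqP; rewrite -(prim_order_dvd pz) dvdn_mull.
have zm1 : z ^+ m - 1 != 0 by rewrite subr_eq0 -(prim_order_dvd pz).
apply: (mulfI zm1); rewrite mulr0 (eq_bigr (fun j : 'I_n => (z ^+ m) ^+ j)).
  rewrite -subrX1 -exprM mulnC exprM (prim_expr_order pz) expr1n subrr//.
by move=> j _; rewrite mulnC exprM.
Qed.

(* Coefficients are discrete Fourier averages over the circle of radius r. *)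
Lemma cauchy_coef (p : {poly C}) (r M : R) (k : nat) : 0 <= r ->
  (forall l, cabs l = r -> cabs p.[l] <= M) -> cabs p`_k * r ^+ k <= M.
Proof.
(* The degrees of [p] and [k] are all below [N], hence distinct modulo [N]: the average keeps the
   coefficient of degree [k] alone. The exponent [j * (N - k)] stands for $-jk$. *)
move=> r0 pM; pose N := (maxn (size p) k.+1).
have N0 : (0 < N)%N by rewrite /N leq_max orbT.
have [z pz] := prim_root_exists N0.
have zr j : cabs (r%:C * z ^+ j) = r.
  by rewrite cabsM cabs_real ger0_norm// cabsX (cabs_prim_root pz) expr1n mulr1.
have E : \sum_(j < N) p.[r%:C * z ^+ j] * z ^+ (j * (N - k)) =
    N%:R * (p`_k * r%:C ^+ k).
  under eq_bigr => j _ do rewrite (@horner_coef_wide _ N) ?leq_maxl//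
    mulr_suml.
  rewrite exchange_big/=.
  have kN : (k < N)%N by rewrite /N leq_max ltnSn orbT.
  rewrite (bigD1 (Ordinal kN))//= [X in _ + X]big1 ?addr0.
    under eq_bigr => j _.
      rewrite exprMn -!mulrA -exprM -exprD -mulnDr subnKC ?(ltnW kN)//.
      rewrite mulrA; over.
    by rewrite -mulr_sumr sum_prim_root// dvdnn mulrC.
  move=> i ik; under eq_bigr => j _.
    rewrite exprMn -!mulrA -exprM -exprD -mulnDr mulrA; over.
  rewrite -mulr_sumr sum_prim_root//.
  rewrite ifN ?mulr0//; apply/negP => /dvdnP[q qE].
  have iN := ltn_ord i; have {}ik : (i : nat) != k.
    by apply: contra ik => /eqP ik; apply/eqP/val_inj.
  case: q qE => [|[|q]]; lia.
have pM' (j : 'I_N) :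
    cabs (p.[r%:C * z ^+ j] * z ^+ (j * (N - k))) <= M.
  by rewrite cabsM cabsX (cabs_prim_root pz) expr1n mulr1 pM.
rewrite -(@ler_pM2l _ N%:R) ?ltr0n//.
have -> : N%:R * (cabs p`_k * r ^+ k) = cabs (N%:R * (p`_k * r%:C ^+ k)).
  by rewrite cabsM cabs_nat cabsM cabsX cabs_real ger0_norm.
rewrite -E; apply: (le_trans (cabs_sum _ _ _)).
apply: (le_trans (ler_sum _ (fun j _ => pM' j))).
by rewrite sumr_const card_ord mulr_natl.
Qed.

Lemma Re_horner (p : {poly C}) (t : R) :
  complex.Re p.[t%:C] = (map_poly (@complex.Re R) p).[t] /\ complex.Im p.[t%:C] = (map_poly (@complex.Im R) p).[t].
Proof.
rewrite horner_coef cRe_sum cIm_sum.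
split; rewrite (@horner_coef_wide _ (size p)) ?size_poly//;
  apply: eq_bigr => i _; rewrite coef_map_id0// ?cReM ?cImM -rmorphXn/=.
  by rewrite mulr0 subr0.
by rewrite mulr0 add0r.
Qed.

(** The mean value theorem is real, so it is applied to the real and the imaginary part at two
    different points; this costs the factor 2. *)
Lemma poly_mean_value (p : {poly C}) (a b M : R) : a < b ->
  (forall t, a < t < b -> cabs p^`().[t%:C] <= M) ->
  cabs (p.[b%:C] - p.[a%:C]) <= 2 * M * (b - a).
Proof.
move=> ab pM.
have RM (x : C) n : complex.Re (x *+ n) = complex.Re x *+ n.
  by elim: n => // n IH; rewrite !mulrS cReD IH.
have IM (x : C) n : complex.Im (x *+ n) = complex.Im x *+ n.
  by elim: n => // n IH; rewrite !mulrS cImD IH.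
have dR : (map_poly (@complex.Re R) p)^`() = map_poly (@complex.Re R) p^`().
  by apply/polyP => i; rewrite coef_deriv !coef_map_id0// coef_deriv RM.
have dI : (map_poly (@complex.Im R) p)^`() = map_poly (@complex.Im R) p^`().
  by apply/polyP => i; rewrite coef_deriv !coef_map_id0// coef_deriv IM.
apply: (le_trans (cabs_le_ReIm _)).
rewrite cReD cImD cReN cImN !(Re_horner _ _).1 !(Re_horner _ _).2.
have [c cab ->] := poly_mvt (map_poly (@complex.Re R) p) ab.
have [e eab ->] := poly_mvt (map_poly (@complex.Im R) p) ab.
rewrite dR dI -(Re_horner _ _).1 -(Re_horner _ _).2 !normrM.
rewrite (@ger0_norm _ (b - a)) ?subr_ge0 ?(ltW ab)//.
rewrite -mulrDl ler_wpM2r ?subr_ge0 ?(ltW ab)// mulr2n mulrDl mul1r lerD//.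
  by apply: (le_trans (Re_le_cabs _)); apply: pM; move: cab; rewrite in_itv.
by apply: (le_trans (Im_le_cabs _)); apply: pM; move: eab; rewrite in_itv.
Qed.
End univariate.

Lemma deriv_prod (A : comNzRingType) (n : nat) (F : 'I_n -> {poly A}) :
  (\prod_i F i)^`() = \sum_k (F k)^`() * \prod_(i | i != k) F i.
Proof.
elim: n F => [|n IH] F; first by rewrite !big_ord0 -[1]/(1%:P) derivC.
rewrite big_ord_recl derivM IH [RHS]big_ord_recl; congr (_ * _ + _).
  rewrite [RHS](reindex_omap (lift ord0) (unlift ord0))/=.
    by apply: eq_bigl => i; rewrite liftK eqxx.
  by move=> i; case: (unliftP ord0 i) => [k -> _|->]; rewrite ?eqxx.
rewrite mulr_sumr; apply: eq_bigr => k _.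
rewrite [in RHS](bigD1 ord0)//= mulrCA; congr (_ * (_ * _)).
rewrite [RHS](reindex_omap (lift ord0) (unlift ord0))/=.
  apply: eq_bigl => i; rewrite liftK eqxx andbT.
  by rewrite (inj_eq lift_inj) andbT.
by move=> i /andP[_]; case: (unliftP ord0 i) => [l -> _|->]; rewrite ?eqxx.
Qed.

(** * Polynomials on the complex ball: evaluation, restriction to lines, Cauchy estimates *)

Section poly.
Variables (R : realType) (n : nat).
Local Notation C := R[i].
Local Notation mp := (mpoly n C).
Implicit Types (z w v : 'rV[C]_n) (p q : mp).

Definition nsq z : R := \sum_(i < n) cabs (z 0 i) ^+ 2.

Lemma hdot_nsq z : hdot z z = (nsq z)%:C.
Proof. rewrite [RHS]rmorph_sum; apply: eq_bigr => i _. by rewrite -cabs_mulJ. Qed.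

Lemma nsq_ge0 z : 0 <= nsq z.
Proof. by apply: sumr_ge0 => i _; rewrite sqr_ge0. Qed.

Lemma nsq0 : nsq 0 = 0.
Proof. by rewrite /nsq big1// => i _; rewrite mxE cabs0 expr0n. Qed.

Lemma nsqZ (a : C) z : nsq (a *: z) = cabs a ^+ 2 * nsq z.
Proof.
by rewrite /nsq mulr_sumr; apply: eq_bigr => i _; rewrite mxE cabsM exprMn.
Qed.

Lemma hdotDl z w v : hdot (z + w) v = hdot z v + hdot w v.
Proof. by rewrite -big_split; apply: eq_bigr => i _; rewrite mxE mulrDl. Qed.

Lemma hdotZl a z v : hdot (a *: z) v = a * hdot z v.
Proof. by rewrite mulr_sumr; apply: eq_bigr => i _; rewrite mxE mulrA. Qed.

Lemma hdotC z w : hdot w z = (hdot z w)^*%C.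
Proof.
by rewrite rmorph_sum; apply: eq_bigr => i _; rewrite rmorphM/= conjcK mulrC.
Qed.

Lemma nsqD z w : nsq (z + w) = nsq z + nsq w + 2 * complex.Re (hdot z w).
Proof.
rewrite /nsq /hdot cRe_sum mulr_sumr -!big_split/=; apply: eq_bigr => i _.
by rewrite mxE !cabs_sqr cReD cImD cReM cReJ cImJ; ring.
Qed.

Lemma coord_le_nsq z j : cabs (z 0 j) ^+ 2 <= nsq z.
Proof.
rewrite /nsq (bigD1 j)//= lerDl.
by apply: sumr_ge0 => i _; rewrite sqr_ge0.
Qed.

Lemma nsq_delta (j : 'I_n) : nsq (delta_mx 0 j) = 1.
Proof.
rewrite /nsq (bigD1 j)//= big1 => [|i ij].
  by rewrite mxE !eqxx cabs1 expr1n addr0.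
by rewrite mxE (negbTE ij) andbF cabs0 expr0n.
Qed.

Lemma hdot_delta z (j : 'I_n) : hdot z (delta_mx 0 j) = z 0 j.
Proof.
rewrite /hdot (bigD1 j)//= big1 => [|i ij].
  by rewrite mxE !eqxx conjc1 mulr1 addr0.
by rewrite mxE (negbTE ij) andbF conjc0 mulr0.
Qed.

Lemma nsqD_delta z (s : R) (l : C) j : 0 <= s -> nsq z <= s ^+ 2 ->
  nsq (z + l *: delta_mx 0 j) <= (s + cabs l) ^+ 2.
Proof.
move=> s0 zs; rewrite nsqD nsqZ nsq_delta mulr1.
have -> : hdot z (l *: delta_mx 0 j) = l^*%C * z 0 j.
  by rewrite hdotC hdotZl rmorphM/= -hdotC hdot_delta.
have l0 := cabs_ge0 l; have zj0 := cabs_ge0 (z 0 j).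
have zjs : cabs (z 0 j) <= s.
  rewrite -(@ler_pXn2r _ 2) ?nnegrE//.
  exact: le_trans (coord_le_nsq z j) zs.
have := le_trans (ler_norm _) (Re_le_cabs (l^*%C * z 0 j)).
rewrite cabsM cabsJ; nra.
Qed.

Definition pev p z : C := meval (fun i => z 0 i) p.

(** The restriction of [p] to the complex line $z + \mathbb{C}v$; it reduces estimates in several
    variables to [cauchy_coef] and [poly_mean_value]. *)
Definition lin z v p : {poly C} :=
  mmap (@polyC C) (fun i => (z 0 i)%:P + (v 0 i)%:P * 'X) p.

Lemma pevD z : {morph pev^~ z : p q / p + q}.
Proof. by move=> p q; rewrite /pev mevalD. Qed.
Lemma pevM z : {morph pev^~ z : p q / p * q}.
Proof. by move=> p q; rewrite /pev mevalM. Qed.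
Lemma pevZ z a p : pev (a *: p) z = a * pev p z.
Proof. by rewrite /pev mevalZ. Qed.
Lemma pevN z p : pev (- p) z = - pev p z.
Proof. by rewrite /pev mevalN. Qed.
Lemma pev0 z : pev 0 z = 0.
Proof. by rewrite /pev meval0. Qed.
Lemma pev1 z : pev 1 z = 1.
Proof. by rewrite /pev meval1. Qed.
Lemma pevX z (i : 'I_n) : pev (mpolyX C (mnm1 i)) z = z 0 i.
Proof. by rewrite /pev mevalXU. Qed.
Lemma pev_sum z (I : Type) (r : seq I) (P : pred I) (F : I -> mp) :
  pev (\sum_(i <- r | P i) F i) z = \sum_(i <- r | P i) pev (F i) z.
Proof. exact: (big_morph (pev^~ z) (pevD z) (pev0 z)). Qed.

Lemma linD z v : {morph lin z v : p q / p + q}.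
Proof. by move=> p q; rewrite /lin mmapD. Qed.
Lemma linZ z v a p : lin z v (a *: p) = a%:P * lin z v p.
Proof. by rewrite /lin mmapZ. Qed.
Lemma lin0 z v : lin z v 0 = 0.
Proof. by rewrite /lin mmap0. Qed.
Lemma linX z v (m : multinom n) : lin z v (mpolyX C m) =
  \prod_(i < n) ((z 0 i)%:P + (v 0 i)%:P * 'X) ^+ m i.
Proof. by rewrite /lin mmapX. Qed.

Lemma horner_lin z v p l : (lin z v p).[l] = pev p (z + l *: v).
Proof.
elim/mpolyind: p => [|c m p _ _ IH].
  by rewrite lin0 horner0 pev0.
rewrite linD linZ hornerD IH pevD pevZ hornerM hornerC linX /pev mevalX.
congr (_ * _ + _); rewrite horner_prod; apply: eq_bigr => i _.
by rewrite horner_exp !hornerE !mxE [l * _]mulrC.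
Qed.

Lemma deriv_lin z v p :
  (lin z v p)^`() = \sum_(k < n) (v 0 k)%:P * lin z v (mderiv k p).
Proof.
elim/mpolyind: p => [|c m p _ _ IH].
  by rewrite lin0 deriv0 big1// => k _; rewrite mderiv0 lin0 mulr0.
rewrite linD derivD IH linZ deriv_mulC.
under [RHS]eq_bigr => k _.
  rewrite mderivD mderivZ linD linZ mulrDr mulrCA; over.
rewrite big_split/= -mulr_sumr; congr (_ * _ + _).
rewrite linX deriv_prod.
under [RHS]eq_bigr => k _ do rewrite mderivX linZ linX.
apply: eq_bigr => k _.
rewrite deriv_exp derivD derivC add0r deriv_mulC derivX mulr1.
rewrite [in RHS](bigD1 k)//= mnmBE mnm1E eqxx subn1.
rewrite (@eq_bigr _ _ _ _ _ _ (fun i => ((z 0 i)%:P + (v 0 i)%:P * 'X) ^+ (mnm_sub m (mnm1 k)) i) (fun i => ((z 0 i)%:P + (v 0 i)%:P * 'X) ^+ m i)).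
  by rewrite rmorph_nat -mulr_natl; ring.
by move=> i ik; rewrite mnmBE mnm1E eq_sym (negbTE ik) subn0.
Qed.

(* [s] is the square of the radius of the ball. *)
Definition bnd p (s M : R) := forall z, nsq z <= s -> cabs (pev p z) <= M.

(** The directional derivative is the coefficient of degree 1 of [lin z v p]. The circle is only
    required to stay in the ball, so a direction in which the ball is wide allows a large [rho]. *)
Lemma dir_bound p z v (s M rho : R) : 0 < rho -> bnd p s M ->
  (forall l : C, cabs l = rho -> nsq (z + l *: v) <= s) ->
  cabs (\sum_(k < n) v 0 k * pev (mderiv k p) z) <= M / rho.
Proof.
move=> rho0 pM zs; rewrite ler_pdivlMr//.
have := @cauchy_coef R (lin z v p) rho M 1 (ltW rho0).
rewrite expr1 -[_`_1]/((lin z v p)`_1).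
have -> : (lin z v p)`_1 = \sum_(k < n) v 0 k * pev (mderiv k p) z.
  have -> : (lin z v p)`_1 = (lin z v p)^`().[0].
    by rewrite horner_coef0 coef_deriv mulr1n.
  rewrite deriv_lin horner_sum; apply: eq_bigr => k _.
  by rewrite hornerM hornerC horner_lin scale0r addr0.
by apply=> l lr; rewrite horner_lin; apply: pM; exact: zs.
Qed.

Lemma mderiv_bound p j (s s' M : R) : 0 <= s -> s < s' ->
  bnd p (s' ^+ 2) M -> bnd (mderiv j p) (s ^+ 2) (M / (s' - s)).
Proof.
move=> s0 ss' pM z zs.
have /(_ z (delta_mx 0 j)) := @dir_bound p _ _ _ M (s' - s) _ pM.
rewrite subr_gt0 => /(_ ss').
rewrite (bigD1 j)//= big1 => [|k kj]; last first.
  by rewrite mxE (negbTE kj) andbF mul0r.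
rewrite mxE !eqxx mul1r addr0; apply => l lE.
by apply: (le_trans (nsqD_delta _ _ s0 zs)); rewrite lE subrKC.
Qed.

Lemma bnd_le p (s s' M M' : R) : s' <= s -> M <= M' -> bnd p s M -> bnd p s' M'.
Proof. by move=> ss MM pM z zs; rewrite (le_trans (pM _ _))// (le_trans zs). Qed.

Lemma bnd_ge0 p (s M : R) : 0 <= s -> bnd p s M -> 0 <= M.
Proof. by move=> s0 /(_ 0); rewrite nsq0 => /(_ s0); apply: le_trans (cabs_ge0 _). Qed.

(** Induction on the degree: a derivative lowers one exponent and multiplies the coefficient by a
    positive integer, while Cauchy's estimate for it costs half the radius. *)
Lemma mcoeff_bound (m : multinom n) (s : R) : 0 < s ->
  exists2 K : R, 0 <= K & forall p M, bnd p (s ^+ 2) M ->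
    cabs (mcoeff m p) <= K * M.
Proof.
have [k] := ubnP (mdeg m); elim: k m s => // k IH m s mk s0.
have [m0|m0] := eqVneq m (@mnm0 n).
  exists 1 => // p M /(_ 0); rewrite nsq0 sqr_ge0 mul1r => /(_ isT).
  suff -> : pev p 0 = mcoeff m p by [].
  rewrite m0; elim/mpolyind: p => [|c m' p _ _ IHp].
    by rewrite pev0 mcoeff0.
  rewrite pevD pevZ IHp mcoeffD mcoeffZ mcoeffX; congr (_ * _ + _).
  rewrite /pev mevalX; have [->|] := eqVneq m' (@mnm0 n).
    by rewrite big1// => i _; rewrite mnm0E.
  move=> m'0; have [i mi] : exists i, m' i != 0%N.
    apply/existsP; apply: contraNT m'0; rewrite negb_exists => /forallP m'E.
    by apply/eqP/mnmP => i; rewrite mnm0E; apply/eqP; have := m'E i; rewrite negbK.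
  by rewrite (bigD1 i)//= mxE expr0n (negbTE mi) mul0r.
have [i mi] : exists i, m i != 0%N.
  apply/existsP; apply: contraNT m0; rewrite negb_exists => /forallP m'E.
  by apply/eqP/mnmP => i; rewrite mnm0E; apply/eqP; have := m'E i; rewrite negbK.
have mE : mnm_add (mnm_sub m (mnm1 i)) (mnm1 i) = m.
  by apply/mnmP => j; rewrite mnmDE mnmBE mnm1E; have [<-|_] := eqVneq; lia.
have dm : (mdeg (mnm_sub m (mnm1 i)) < k)%N.
  by move: mk; rewrite -{1}mE mdegD mdeg1 addn1.
have s20 : 0 < s / 2 by rewrite divr_gt0.
have [K K0 hK] := IH _ _ dm s20.
exists (K / (s - s / 2)) => [|p M pM].
  by rewrite divr_ge0// subr_ge0; lra.
have := hK _ _ (@mderiv_bound p i (s / 2) s M (ltW s20) ltac:(lra) pM).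
rewrite mcoeff_mderiv mE -[mcoeff m p *+ _]mulr_natl cabsM cabs_nat mulrA [K * M / _]mulrAC; apply: le_trans.
by rewrite ler_peMl ?cabs_ge0// ler1n.
Qed.


(* [q] is the integral of [mderiv j p] along the rays from the origin. *)
Lemma ray_integral p j : exists q, forall z,
  ('X * lin 0 z q)^`() = lin 0 z (mderiv j p).
Proof.
elim/mpolyind: p => [|c m p _ _ [q qE]].
  by exists 0 => z; rewrite mderiv0 !lin0 mulr0 deriv0.
(* Along the ray, $r$ times a monomial of degree $|m|-1$ is a multiple of $r^{|m|}$, and
   differentiation produces the factor $|m|$ that is divided out. If $m_j = 0$ the coefficient is 0,
   which also covers $|m| = 0$. *)
exists ((c * ((m j)%:R / (mdeg m)%:R)) *: mpolyX C (mnm_sub m (mnm1 j)) + q).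
move=> z; rewrite linD mulrDr derivD qE mderivD linD; congr (_ + _).
rewrite linZ mderivZ mderivX !linZ.
have [->|mj] := eqVneq (m j) 0%N.
  by rewrite !(mulr0n, mul0r, mulr0, polyC0, deriv0).
rewrite linX; set k := mdeg m.
have kE : (k = (mdeg (mnm_sub m (mnm1 j))).+1)%N.
  rewrite -addn1 -(mdeg1 j) -mdegD /k; congr mdeg.
  by apply/mnmP => i; rewrite mnmDE mnmBE mnm1E; have [<-|_] := eqVneq; lia.
set m' := mnm_sub m (mnm1 j).
have -> : \prod_(i < n) (((0 : 'rV[C]_n) 0 i)%:P + (z 0 i)%:P * 'X) ^+ m' i =
    (\prod_(i < n) z 0 i ^+ m' i)%:P * 'X^(mdeg m').
  rewrite mdegE expr_sum rmorph_prod -big_split/=; apply: eq_bigr => i _.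
  by rewrite mxE polyC0 add0r exprMn rmorphXn.
set P := (\prod_(i < n) z 0 i ^+ m' i)%:P; rewrite kE -/m'.
set D := mdeg m'; set a : C := (m j)%:R.
have -> : 'X * ((c * (a / D.+1%:R))%:P * (P * 'X^D)) =
    (c * (a / D.+1%:R))%:P * (P * 'X^(D.+1)) :> {poly C}.
  by rewrite exprS; ring.
rewrite !deriv_mulC derivXn/= -['X^D *+ _]mulr_natl.
have -> : D.+1%:R = (D.+1%:R : C)%:P by rewrite rmorph_nat.
rewrite [RHS]mulrA -rmorphM/= [P * (_ * _)]mulrCA [LHS]mulrA -rmorphM/=.
by congr (_%:P * _); rewrite -!mulrA mulVf ?mulr1// pnatr_eq0.
Qed.

(** * Approximation of $\bar z_j f$ on the sphere by a polynomial *)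

Section dbar.
Variables (f q : mp) (j : 'I_n).
Hypothesis qP : forall z, ('X * lin 0 z q)^`() = lin 0 z (mderiv j f).

(** As a function of $r$ this is $\bar z_j f(rz) - r q(rz)$, the quantity to be estimated at $r =
    1$. Its derivative is that of $f$ at $rz$ in the direction $\bar z_j z - e_j$, which is
    orthogonal to $z$ when $|z| = 1$. *)
Let G z : {poly C} := ((z 0 j)^*%C)%:P * lin 0 z f - 'X * lin 0 z q.

Lemma G_eval z (r : R) : (G z).[r%:C] =
  (z 0 j)^*%C * pev f (r%:C *: z) - r%:C * pev q (r%:C *: z).
Proof. by rewrite /G !hornerE !horner_lin add0r. Qed.

(** Since [v] is orthogonal to [z], Pythagoras keeps the circle of radius $\sqrt{1-r^2}$ around $rz$
    inside the ball, whereas a general direction allows only $1-r$. The gain makes the bound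
    integrable up to $r = 1$. Moreover $|v| \le 1$, as $\bar z_j z$ is the projection of $e_j$ on
    $z$. *)
Lemma G_deriv_bound z (r M : R) : nsq z = 1 -> 0 <= r -> r < 1 -> bnd f 1 M ->
  cabs (G z)^`().[r%:C] <= M / Num.sqrt (1 - r ^+ 2).
Proof.
move=> z1 r0 r1 fM; pose v : 'rV[C]_n := (z 0 j)^*%C *: z - delta_mx 0 j.
have -> : (G z)^`().[r%:C] = \sum_(k < n) v 0 k * pev (mderiv k f) (r%:C *: z).
  rewrite /G derivB deriv_mulC qP deriv_lin hornerD hornerN horner_lin add0r.
  rewrite hornerM hornerC horner_sum mulr_sumr.
  under [RHS]eq_bigr do rewrite !mxE mulrBl.
  rewrite sumrB; congr (_ - _).
    by apply: eq_bigr => k _; rewrite hornerM hornerC horner_lin add0r mulrA.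
  rewrite (bigD1 j)//= big1 => [|k kj].
    by rewrite !eqxx mul1r addr0.
  by rewrite (negbTE kj) ?andbF mul0r.
apply: (dir_bound _ fM) => [|l lE].
  by rewrite sqrtr_gt0 subr_gt0 expr_lt1.
have zv : hdot z v = 0.
  rewrite hdotC hdotDl hdotZl hdot_nsq z1 mulr1 -scaleN1r hdotZl.
  by rewrite (hdotC z) hdot_delta mulN1r subrr conjc0.
have v1 : nsq v <= 1.
  have := nsqD (v) (- ((z 0 j)^*%C *: z)).
  rewrite -scaleNr.
  have -> : hdot v (- (z 0 j)^*%C *: z) = 0.
    by rewrite hdotC hdotZl zv mulr0 conjc0.
  rewrite mulr0 addr0 scaleNr addrAC subrr add0r.
  rewrite -[- delta_mx _ _]scaleN1r nsqZ nsq_delta cabsN cabs1 expr1n mulr1 => ->.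
  by rewrite lerDl nsq_ge0.
rewrite nsqD !nsqZ z1 cabs_real ger0_norm// mulr1 lE sqr_sqrtr; last first.
  by rewrite subr_ge0 expr_le1// ltW.
rewrite hdotC !hdotZl hdotC hdotZl zv mulr0 conjc0 mulr0 conjc0 mulr0 addr0.
have : (1 - r ^+ 2) * nsq v <= 1 - r ^+ 2; last lra.
by rewrite ler_piMr// subr_ge0 expr_le1// ltW.
Qed.

(* The substitution [r = 1 - t ^ 2] removes the integrable singularity of
   [1 / sqrt (1 - r ^ 2)] at [r = 1]. *)
Lemma dbar_increment z (s t M : R) : nsq z = 1 -> 0 <= s -> s < t -> t <= 1 ->
  bnd f 1 M ->
  cabs ((G z).[(1 - s ^+ 2)%:C] - (G z).[(1 - t ^+ 2)%:C]) <= 4 * M * (t - s).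
Proof.
move=> z1 s0 st t1 fM; pose H := G z \Po (1 - 'X ^+ 2).
have M0 := bnd_ge0 ler01 fM.
have HE (x : R) : H.[x%:C] = (G z).[(1 - x ^+ 2)%:C].
  by rewrite horner_comp !hornerE rmorphB/= rmorphXn.
rewrite -!HE cabsC (_ : 4 * M = 2 * (2 * M)); last by ring.
apply: poly_mean_value => // x /andP[sx xt].
rewrite /H deriv_comp hornerM horner_comp.
have -> : (1 - 'X ^+ 2 : {poly C}).[x%:C] = (1 - x ^+ 2)%:C.
  by rewrite !hornerE rmorphB/= rmorphXn.
have -> : (1 - 'X ^+ 2 : {poly C})^`().[x%:C] = (- 2 * x)%:C.
  rewrite derivB -[1]/(1%:P) derivC sub0r derivXn/= expr1 hornerN hornerMn hornerX.
  by rewrite rmorphM rmorphN rmorph_nat/= mulNr mulr_natl.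
have x0 : 0 < x by apply: le_lt_trans sx.
have x1 : x < 1 by apply: lt_le_trans t1.
have x0' := ltW x0.
rewrite cabsM cabs_real normrM normrN (ger0_norm (ler0n _ _)) (ger0_norm x0').
have gb : cabs (G z)^`().[(1 - x ^+ 2)%:C] <=
    M / Num.sqrt (1 - (1 - x ^+ 2) ^+ 2).
  apply: G_deriv_bound fM => //; first by rewrite subr_ge0 expr_le1// ltW.
  by rewrite gtrBl exprn_gt0.
apply: (le_trans (ler_wpM2r _ gb)); first by rewrite mulr_ge0// ltW.
set w := Num.sqrt _.
(* $1-(1-x^2)^2 = 2x^2 - x^4 \ge x^2$, so the factor $2x$ of the substitution absorbs the
   singularity and the derivative is at most $2M$; [poly_mean_value] doubles this. *)
have xw : x <= w.
  rewrite -[leLHS]ger0_norm ?(ltW x0)// -sqrtr_sqr ler_wsqrtr//.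
  have y0 : 0 <= x ^+ 2 by rewrite exprn_ge0.
  have y1 : x ^+ 2 <= 1 by rewrite expr_le1// ltW.
  by move: (x ^+ 2) y0 y1 => y y0 y1; nra.
have w0 : 0 < w by apply: lt_le_trans xw.
rewrite -mulrA mulrC -mulrA [2 * x * M]mulrAC ler_pdivrMl//; nra.
Qed.

Lemma ray_integral_inner (s s' M : R) : 0 <= s -> s < s' ->
  bnd f (s' ^+ 2) M -> bnd q (s ^+ 2) (2 * (M / (s' - s))).
Proof.
move=> s0 ss' fM w ws.
have := @poly_mean_value R ('X * lin 0 w q) 0 1 (M / (s' - s)) ltr01.
rewrite !hornerM !hornerX mul1r mul0r subr0 subr0 mulr1 horner_lin scale1r add0r.
apply=> t /andP[t0 t1]; rewrite qP horner_lin add0r.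
apply: (mderiv_bound j s0 ss' fM).
rewrite nsqZ cabs_real ger0_norm ?(ltW t0)//.
apply: le_trans ws; rewrite ler_piMl ?nsq_ge0// expr_le1// ?ltW//.
Qed.

(** Near the sphere $\partial_j f$ is not controlled by $M$, but the increment of [G] from $r = 0$
    is. This gives $|r q| \le M + M + 4M$, and $r > 1/2$ yields 12. For $|w| \le 1/2$ Cauchy's
    estimate gives $4M$. *)
Lemma ray_integral_bound (M : R) : bnd f 1 M -> bnd q 1 (12 * M).
Proof.
move=> fM w w1; have M0 := bnd_ge0 ler01 fM.
have [w4|w4] := lerP (nsq w) ((1/2) ^+ 2).
  have h : bnd f (1 ^+ 2) M by rewrite expr1n.
  have h0 : (0 : R) <= 1/2 by lra.
  have h1 : (1/2 : R) < 1 by lra.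
  apply: (le_trans (ray_integral_inner h0 h1 h w4)).
  rewrite (_ : 1 - 1/2 = 2^-1) ?invrK; lra.
pose r := Num.sqrt (nsq w); have r2 : r ^+ 2 = nsq w by rewrite sqr_sqrtr ?nsq_ge0.
have r12 : 1/2 < r by rewrite -(@ltr_pXn2r _ 2) ?nnegrE ?sqrtr_ge0//= ?r2//; lra.
have r0 : 0 < r by lra.
have r1 : r <= 1 by rewrite -(@ler_pXn2r _ 2) ?nnegrE ?sqrtr_ge0//= ?r2 ?expr1n.
pose z := (r^-1)%:C *: w.
have wz : w = r%:C *: z.
  by rewrite scalerA -rmorphM/= divff ?scale1r// gt_eqF.
have z1 : nsq z = 1.
  rewrite nsqZ cabs_real ger0_norm ?invr_ge0 ?(ltW r0)// exprVn r2 mulVf//.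
  by rewrite -r2 expf_neq0// gt_eqF.
pose t0 := Num.sqrt (1 - r).
have t02 : t0 ^+ 2 = 1 - r by rewrite sqr_sqrtr// subr_ge0.
have t00 : 0 <= t0 by rewrite sqrtr_ge0.
have t01 : t0 < 1 by rewrite -(@ltr_pXn2r _ 2) ?nnegrE//= t02 expr1n; lra.
have := dbar_increment z1 t00 t01 (lexx 1) fM.
rewrite t02 expr1n subrr (_ : 1 - (1 - r) = r); last by ring.
rewrite !G_eval rmorph0 scale0r mul0r subr0 -wz.
have zj1 : cabs (z 0 j)^*%C <= 1.
  by rewrite cabsJ -(@ler_pXn2r _ 2) ?nnegrE ?cabs_ge0//= expr1n -z1 coord_le_nsq.
have f0 : cabs (pev f 0) <= M by apply: fM; rewrite nsq0.
have fw := fM _ w1.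
set a := (z 0 j)^*%C in zj1 *; set b := pev f w in fw *; set e := pev f 0 in f0 *.
set y := pev q w => h.
have : cabs (r%:C * y) <= cabs (a * b) + cabs (a * e) + 4 * M * (1 - t0).
  have -> : r%:C * y = (a * b - a * e) - (a * b - r%:C * y - a * e) by ring.
  by apply: (le_trans (cabsB _ _)); apply: lerD h; exact: cabsB.
rewrite !cabsM cabs_real ger0_norm ?(ltW r0)//.
have := cabs_ge0 b; have := cabs_ge0 e; have := cabs_ge0 y; have := cabs_ge0 a.
nra.
Qed.

(** From $r = 1$ to $r = 1-t^2$ the value of [G] changes by at most $4Mt$. At $r = 1-t^2$ only
    values in the slightly larger ball of radius $1-t^2/2$ matter; the gap $t^2/2$ between the radii
    is spent on Cauchy's estimate for [q]. *)
Lemma dbar_estimate z (t M m : R) : nsq z = 1 -> 0 < t -> t <= 1 -> bnd f 1 M ->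
  bnd f ((1 - t ^+ 2 / 2) ^+ 2) m ->
  cabs ((z 0 j)^*%C * pev f z - pev q z) <= 4 * M * t + (1 + 4 / t ^+ 2) * m.
Proof.
move=> z1 t0 t1 fM fm.
have tt0 : 0 < t ^+ 2 by rewrite exprn_gt0.
have tt1 : t ^+ 2 <= 1 by rewrite expr_le1// ltW.
have := dbar_increment z1 (lexx 0) t0 t1 fM.
rewrite expr0n/= !subr0 !G_eval scale1r rmorph1 !mul1r.
set r := 1 - t ^+ 2; set s' := 1 - t ^+ 2 / 2.
have r0 : 0 <= r by rewrite /r; lra.
have r1 : r <= 1 by rewrite /r; lra.
have rs : r < s' by rewrite /r /s'; lra.
have zr : nsq (r%:C *: z) <= r ^+ 2.
  by rewrite nsqZ z1 mulr1 cabs_real ger0_norm.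
have fr : cabs (pev f (r%:C *: z)) <= m.
  by apply: fm; apply: (le_trans zr); rewrite -/s' ler_pXn2r ?nnegrE//; lra.
have := ray_integral_inner r0 rs fm zr.
have -> : s' - r = t ^+ 2 / 2 by rewrite /r /s'; lra.
have -> : 2 * (m / (t ^+ 2 / 2)) = 4 / t ^+ 2 * m.
  by field; rewrite gt_eqF.
have zj1 : cabs (z 0 j)^*%C <= 1.
  by rewrite cabsJ -(@ler_pXn2r _ 2) ?nnegrE ?cabs_ge0//= expr1n -z1 coord_le_nsq.
set a := (z 0 j)^*%C in zj1 *; set b := pev f (_ *: _) in fr *.
set y := pev q (_ *: _); set c := _ - pev q z => qy h.
have -> : c = (c - (a * b - r%:C * y)) + (a * b - r%:C * y) by ring.
apply: (le_trans (cabsD _ _)); rewrite lerD//.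
apply: (le_trans (cabsB _ _)); rewrite !cabsM cabs_real ger0_norm//.
rewrite [leRHS]mulrDl mul1r lerD//.
  by rewrite (le_trans _ fr)// ler_piMl// cabs_ge0.
by rewrite (le_trans _ qy)// ler_piMl// cabs_ge0.
Qed.

End dbar.

End poly.

(** * Measurability of complex functions *)

Section cmeas.
Context dd (T : measurableType dd) (R : realType).
Local Notation C := R[i].
Implicit Types u v : T -> C.

Definition cmeas u := measurable_fun setT (fun x => complex.Re (u x)) /\
  measurable_fun setT (fun x => complex.Im (u x)).

Lemma cmeas_cst (a : C) : cmeas (fun=> a).
Proof. by split; exact: measurable_cst. Qed.

Lemma cmeasD u v : cmeas u -> cmeas v -> cmeas (fun x => u x + v x).
Proof.
move=> [ur ui] [vr vi]; split.
- by under eq_fun do rewrite cReD; exact: measurable_funD.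
- by under eq_fun do rewrite cImD; exact: measurable_funD.
Qed.

Lemma cmeasN u : cmeas u -> cmeas (fun x => - u x).
Proof.
move=> [ur ui]; split.
- by under eq_fun do rewrite cReN; exact: measurable_funN.
- by under eq_fun do rewrite cImN; exact: measurable_funN.
Qed.

Lemma cmeasB u v : cmeas u -> cmeas v -> cmeas (fun x => u x - v x).
Proof. by move=> mu mv; apply: cmeasD => //; exact: cmeasN. Qed.

Lemma cmeasM u v : cmeas u -> cmeas v -> cmeas (fun x => u x * v x).
Proof.
move=> [ur ui] [vr vi]; split.
- by under eq_fun do rewrite cReM; apply: measurable_funB; exact: measurable_funM.
- by under eq_fun do rewrite cImM; apply: measurable_funD; exact: measurable_funM.
Qed.

Lemma cmeasJ u : cmeas u -> cmeas (fun x => (u x)^*%C).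
Proof.
move=> [ur ui]; split.
- by under eq_fun do rewrite cReJ.
- by under eq_fun do rewrite cImJ; exact: measurable_funN.
Qed.

Lemma cmeas_real (f : T -> R) : measurable_fun setT f -> cmeas (fun x => (f x)%:C).
Proof. by move=> mf; split => //=; exact: measurable_cst. Qed.

(** Writing $f^{-1} = f \cdot (f^2)^{-1}$ lets the measurable real power act on a nonnegative base;
    where $f = 0$ both sides are 0. *)
Lemma measurable_inv (f : T -> R) : measurable_fun setT f ->
  measurable_fun setT (fun x => (f x)^-1).
Proof.
move=> mf.
have -> : (fun x => (f x)^-1) = (fun x => f x * (((f x) ^+ 2) `^ (-1))).
  apply/funext => x; rewrite powR_inv1 ?sqr_ge0//.
  have [->|fx0] := eqVneq (f x) 0; first by rewrite invr0 mul0r.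
  by rewrite expr2 invfM mulrA divff// mul1r.
apply: measurable_funM => //.
apply: (measurableT_comp (f := @powR R ^~ (-1)) (g := fun x => f x ^+ 2)).
  exact: measurable_powR.
exact: measurable_funX.
Qed.

Lemma measurable_sqrt (f : T -> R) : (forall x, 0 <= f x) ->
  measurable_fun setT f -> measurable_fun setT (fun x => Num.sqrt (f x)).
Proof.
move=> f0 mf; under eq_fun => x do rewrite -powR12_sqrt//.
apply: (measurableT_comp (f := @powR R ^~ 2^-1) (g := f)) => //.
Qed.

Lemma measurable_cabs u : cmeas u -> measurable_fun setT (fun x => cabs (u x)).
Proof.
move=> [ur ui]; under eq_fun do rewrite cabs_sqrt.
apply: measurable_sqrt; first by move=> x; rewrite addr_ge0 ?sqr_ge0.
by apply: measurable_funD; exact: measurable_funX.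
Qed.

Lemma cmeasV u : cmeas u -> cmeas (fun x => (u x)^-1).
Proof.
move=> mu.
have -> : (fun x => (u x)^-1) = (fun x => ((cabs (u x) ^+ 2)^-1)%:C * (u x)^*%C).
  by apply/funext => x; rewrite invc_norm cabsE -rmorphXn -fmorphV.
apply: cmeasM; last exact: cmeasJ.
apply: cmeas_real; apply: measurable_inv; apply: measurable_funX.
exact: measurable_cabs.
Qed.

Definition cindic (A : set T) (x : T) : C := (\1_A x)%:C.

Lemma cmeas_cindic A : measurable A -> cmeas (cindic A).
Proof. by move=> mA; apply: cmeas_real; exact: measurable_indic. Qed.

Lemma cabs_cindic A x : cabs (cindic A x) <= 1.
Proof. by rewrite /cindic cabs_real indicE; case: (_ \in _); rewrite ?normr1 ?normr0. Qed.

Lemma cmeas_lim (h : nat -> T -> C) u : (forall k, cmeas (h k)) ->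
  (forall x, (fun k => cabs (h k x - u x)) @ \oo --> (0 : R)) -> cmeas u.
Proof.
move=> mh hu.
have aux (f : C -> R) x : (forall a, `|f a| <= cabs a) ->
    (forall a b, f (a - b) = f a - f b) -> (fun k => f (h k x)) @ \oo --> f (u x).
  move=> fle fB; apply/cvgrPdist_le => e e0.
  have /cvgrPdist_le/(_ e e0) := hu x; apply: filterS => k.
  rewrite sub0r normrN (ger0_norm (cabs_ge0 _)) => /(le_trans _); apply.
  by rewrite distrC -fB.
split.
- apply: (@measurable_fun_cvg _ _ _ setT (fun k x => complex.Re (h k x))).
    by move=> k; exact: (mh k).1.
  move=> x _; apply: (aux (@complex.Re R)); first exact: Re_le_cabs.
  by move=> a b; rewrite cReD cReN.
- apply: (@measurable_fun_cvg _ _ _ setT (fun k x => complex.Im (h k x))).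
    by move=> k; exact: (mh k).2.
  move=> x _; apply: (aux (@complex.Im R)); first exact: Im_le_cabs.
  by move=> a b; rewrite cImD cImN.
Qed.

End cmeas.

(** * Complex integrable functions and the completeness of $L^1$ *)

Section L1.
Context dd (T : measurableType dd) (R : realType).
Variable tau : {finite_measure set T -> \bar R}.
Local Notation C := R[i].
Implicit Types u v : T -> C.

Definition L1 u := cmeas u /\
  tau.-integrable setT (EFin \o (fun x => cabs (u x))).
Definition cI u : C := (\int[tau]_x complex.Re (u x)) +i* (\int[tau]_x complex.Im (u x)).
Definition N1 u : R := \int[tau]_x cabs (u x).

Lemma L1_dom u (g : T -> R) : cmeas u -> tau.-integrable setT (EFin \o g) ->
  (forall x, cabs (u x) <= g x) -> L1 u.
Proof.
move=> mu ig ug; split => //; apply: le_integrable ig => //.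
  by apply/measurable_EFinP; exact: measurable_cabs.
move=> x _ /=; rewrite lee_fin ger0_norm ?cabs_ge0//.
exact: le_trans (ug x) (ler_norm _).
Qed.

Lemma L1_Re u : L1 u -> tau.-integrable setT (EFin \o (fun x => complex.Re (u x))).
Proof.
move=> [[mr _] iu]; apply: le_integrable iu => //; first exact/measurable_EFinP.
by move=> x _ /=; rewrite lee_fin (ger0_norm (cabs_ge0 _)) Re_le_cabs.
Qed.

Lemma L1_Im u : L1 u -> tau.-integrable setT (EFin \o (fun x => complex.Im (u x))).
Proof.
move=> [[_ mi] iu]; apply: le_integrable iu => //; first exact/measurable_EFinP.
by move=> x _ /=; rewrite lee_fin (ger0_norm (cabs_ge0 _)) Im_le_cabs.
Qed.

Lemma L1D u v : L1 u -> L1 v -> L1 (fun x => u x + v x).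
Proof.
move=> [mu iu] [mv iv].
apply: (@L1_dom _ (fun x => cabs (u x) + cabs (v x))); first exact: cmeasD.
  have := integrableD measurableT iu iv; apply: eq_integrable => //.
by move=> x; exact: cabsD.
Qed.

Lemma L1M u v (B : R) : cmeas v -> (forall x, cabs (v x) <= B) -> L1 u ->
  L1 (fun x => v x * u x).
Proof.
move=> mv vB [mu iu].
apply: (@L1_dom _ (fun x => B * cabs (u x))); first exact: cmeasM.
  have := integrableZl measurableT B iu; apply: eq_integrable => //.
by move=> x; rewrite cabsM ler_wpM2r ?cabs_ge0.
Qed.

Lemma L1Z u (a : C) : L1 u -> L1 (fun x => a * u x).
Proof. by move=> u1; apply: (@L1M u (fun=> a) (cabs a)) => //; exact: cmeas_cst. Qed.

Lemma L1N u : L1 u -> L1 (fun x => - u x).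
Proof.
move=> u1; have -> : (fun x => - u x) = (fun x => (-1) * u x).
  by apply/funext => x; rewrite mulN1r.
exact: L1Z.
Qed.

Lemma L1B u v : L1 u -> L1 v -> L1 (fun x => u x - v x).
Proof. by move=> u1 v1; apply: L1D => //; exact: L1N. Qed.

Lemma L1J u : L1 u -> L1 (fun x => (u x)^*%C).
Proof.
move=> [mu iu]; apply: (L1_dom _ iu); first exact: cmeasJ.
by move=> x; rewrite cabsJ.
Qed.

Lemma cID u v : L1 u -> L1 v -> cI (fun x => u x + v x) = cI u + cI v.
Proof.
move=> u1 v1; rewrite /cI.
under eq_Rintegral do rewrite cReD.
under [X in _ +i* X]eq_Rintegral do rewrite cImD.
rewrite !RintegralD//; by [exact: L1_Re|exact: L1_Im].
Qed.

Lemma cIZ u (a : C) : L1 u -> cI (fun x => a * u x) = a * cI u.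
Proof.
move=> u1; have ur := L1_Re u1; have ui := L1_Im u1.
have Zi (r : R) (f : T -> R) : tau.-integrable setT (EFin \o f) ->
    tau.-integrable setT (EFin \o (fun x => r * f x)).
  by move=> fi; have := integrableZl measurableT r fi; apply: eq_integrable.
rewrite /cI.
under eq_Rintegral do rewrite cReM.
under [X in _ +i* X]eq_Rintegral do rewrite cImM.
rewrite RintegralB// ?RintegralD//; try exact: Zi.
rewrite !RintegralZl//.
by case: a => x y /=; rewrite /GRing.mul/=; congr (_ +i* _); rewrite addrC.
Qed.

Lemma cIN u : L1 u -> cI (fun x => - u x) = - cI u.
Proof.
move=> u1; rewrite -mulN1r -cIZ//; congr cI; apply/funext => x.
by rewrite mulN1r.
Qed.

Lemma cIB u v : L1 u -> L1 v -> cI (fun x => u x - v x) = cI u - cI v.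
Proof. by move=> u1 v1; rewrite cID ?cIN//; exact: L1N. Qed.

Lemma N1_ge0 u : 0 <= N1 u.
Proof. by apply: Rintegral_ge0 => x _; exact: cabs_ge0. Qed.

Lemma cI_le u : L1 u -> cabs (cI u) <= 2 * N1 u.
Proof.
move=> u1; have [mu iu] := u1; apply: (le_trans (cabs_le_ReIm _)).
rewrite /= mulr2n mulrDl mul1r lerD//.
- apply: (le_trans (le_normr_Rintegral measurableT (L1_Re u1))).
  apply: le_Rintegral => //; first by apply: integrable_norm; exact: L1_Re.
  by move=> x _; exact: Re_le_cabs.
- apply: (le_trans (le_normr_Rintegral measurableT (L1_Im u1))).
  apply: le_Rintegral => //; first by apply: integrable_norm; exact: L1_Im.
  by move=> x _; exact: Im_le_cabs.
Qed.

Lemma N1_le u v (B : R) : L1 u -> L1 v -> (forall x, cabs (u x) <= B * cabs (v x)) ->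
  N1 u <= B * N1 v.
Proof.
move=> [mu iu] [mv iv] uv; rewrite /N1 -RintegralZl//.
apply: le_Rintegral => //.
by have := integrableZl measurableT B iv; apply: eq_integrable.
Qed.

Lemma N1D u v : L1 u -> L1 v -> N1 (fun x => u x + v x) <= N1 u + N1 v.
Proof.
move=> u1 v1; have [_ iuv] := L1D u1 v1; have [[_ iu] [_ iv]] := (u1, v1).
rewrite /N1 -RintegralD//; apply: le_Rintegral => //.
  by have := integrableD measurableT iu iv; apply: eq_integrable.
by move=> x _; exact: cabsD.
Qed.

Lemma N1_dominated (h : nat -> T -> C) u (g : T -> R) :
  (forall k, cmeas (h k)) -> tau.-integrable setT (EFin \o g) ->
  (forall k x, cabs (h k x) <= g x) ->
  (forall x, (fun k => cabs (h k x - u x)) @ \oo --> (0 : R)) ->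
  L1 u /\ forall e, 0 < e -> exists k, N1 (fun x => h k x - u x) < e.
Proof.
move=> mh ig hg hu; have mu := cmeas_lim mh hu.
have ug x : cabs (u x) <= g x.
  apply/ler_addgt0Pr => e e0.
  have /cvgrPdist_le/(_ e e0)[k _ /(_ k (leqnn k))] := hu x.
  rewrite sub0r normrN (ger0_norm (cabs_ge0 _)) => ke.
  have -> : u x = h k x - (h k x - u x) by ring.
  by apply: (le_trans (cabsB _ _)); exact: lerD.
have u1 : L1 u := L1_dom mu ig ug.
split=> // e e0.
have h1 k : L1 (h k) := L1_dom (mh k) ig (hg k).
pose f k : T -> \bar R := fun x => (cabs (h k x - u x))%:E.
have := @dominated_convergence _ T R tau setT measurableT f (cst 0%E)
  (fun x => (g x)%:E + (g x)%:E)%E.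
case.
- move=> k; apply/measurable_EFinP; apply: measurable_cabs; apply: cmeasB => //.
- exact: measurable_cst.
- by apply/aeW => x _; apply: (cvg_comp _ _ (hu x)); exact: cvg_refl.
- by apply: integrableD.
- apply/aeW => x k _; rewrite /f /= lee_fin (ger0_norm (cabs_ge0 _)).
  by apply: (le_trans (cabsB _ _)); exact: lerD.
move=> _ _; rewrite integral0 => /fine_cvgP[_] /cvgrPdist_lt/(_ e e0)[k _].
move=> /(_ k (leqnn k)) /=; rewrite sub0r normrN ger0_norm; first by exists k.
by apply: Rintegral_ge0 => x _; exact: cabs_ge0.
Qed.

(* Riesz-Fischer: the sum of the increments is integrable, hence finite almost
   everywhere, and the sequence converges there. *)
Lemma L1_complete (h : nat -> T -> C) : (forall k, L1 (h k)) ->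
  (forall k, N1 (fun x => h k.+1 x - h k x) <= (1 / 2) ^+ k) ->
  exists2 u, L1 u & forall e, 0 < e -> exists k, forall m, (k <= m)%N ->
    N1 (fun x => h m x - u x) < e.
Proof.
move=> h1 hle; pose f k x := cabs (h k.+1 x - h k x).
have mf k : measurable_fun setT (EFin \o f k).
  by apply/measurable_EFinP/measurable_cabs/cmeasB; [have [] := h1 k.+1|have [] := h1 k].
have if1 k : L1 (fun x => h k.+1 x - h k x) by exact: L1B.
pose G x := (\sum_(0 <= k <oo) (f k x)%:E)%E.
have mG : measurable_fun setT G.
  apply: ge0_emeasurable_sum; first by move=> k x _ _; rewrite lee_fin cabs_ge0.
  by move=> k _; exact: mf.
have G0 x : (0 <= G x)%E.
  by apply: nneseries_ge0 => k _ _; rewrite lee_fin cabs_ge0.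
have iG : tau.-integrable setT G.
  apply/integrableP; split => //.
  under eq_integral do rewrite gee0_abs//.
  rewrite integral_nneseries//; last by move=> k x _; rewrite lee_fin cabs_ge0.
  apply: (@le_lt_trans _ _ 2%:E); last by rewrite ltry.
  apply: lime_le.
    by apply: is_cvg_nneseries => k _ _; apply: integral_ge0 => x _; rewrite lee_fin cabs_ge0.
  apply: nearW => n.
  have geo : \sum_(0 <= k < n) (1 / 2 : R) ^+ k = 2 - 2 * (1 / 2) ^+ n.
    elim: n => [|n IH]; first by rewrite big_geq// expr0; lra.
    by rewrite big_nat_recr//= IH exprS; set y := (1/2) ^+ n; lra.
  apply: (@le_trans _ _ (\sum_(0 <= k < n) ((1 / 2) ^+ k)%:E)%E).
    apply: lee_sum => k _; have [_ ik] := if1 k.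
    by rewrite -(fineK (integrable_fin_num measurableT ik)) lee_fin; exact: hle.
  by rewrite sumEFin geo lee_fin gerBl mulr_ge0// exprn_ge0//; lra.
pose A := [set x | (G x < +oo)%E].
have mA : measurable A.
  by rewrite -[A]setTI; exact: emeasurable_fun_infty_o.
have GA x : A x -> G x \is a fin_num by move=> Ax; rewrite ge0_fin_numE.
have partial x : A x -> forall n, \sum_(0 <= k < n) f k x <= fine (G x).
  move=> Ax n; rewrite -lee_fin fineK ?GA// -sumEFin; apply: nneseries_lim_ge => k _ _.
  by rewrite lee_fin cabs_ge0.
have tele x m n : (m <= n)%N -> cabs (h n x - h m x) <=
    \sum_(m <= k < n) f k x.
  move=> mn; rewrite -(telescope_sumr (h^~ x) mn); exact: cabs_sum.
have diffA x m n : A x -> (m <= n)%N -> cabs (h n x - h m x) <= fine (G x).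
  move=> Ax mn; apply: (le_trans (tele x m n mn)); apply: le_trans (partial x Ax n).
  rewrite [leRHS](@big_cat_nat _ _ _ m)//= lerDr.
  by apply: sumr_ge0 => k _; exact: cabs_ge0.
have cvf x : A x -> cvgn (series (f^~ x)).
  move=> Ax; apply: nondecreasing_is_cvgn.
    by apply/nondecreasing_seqP => n; rewrite !seriesEnat/= big_nat_recr//= lerDl cabs_ge0.
  by exists (fine (G x)) => _ [n _ <-]; exact: partial.
have cvP x (g : C -> R) : A x -> (forall a, `|g a| <= cabs a) ->
    (forall a b, g (a - b) = g a - g b) -> cvgn (fun n => g (h n x)).
  move=> Ax gle gB.
  have c1 : cvgn (series (fun k => g (h k.+1 x) - g (h k x))).
    apply: normed_cvg; apply: (@series_le_cvg _ _ (f^~ x)).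
    - by move=> k /=.
    - by move=> k; exact: cabs_ge0.
    - by move=> k; rewrite /= -gB; exact: gle.
    - exact: cvf.
  have -> : (fun n => g (h n x)) =
      (fun n => series (fun k => g (h k.+1 x) - g (h k x)) n + g (h 0%N x)).
    by apply/funext => n; rewrite seriesEnat/= telescope_sumr// subrK.
  by apply: is_cvgD => //; exact: is_cvg_cst.
(* Off the set [A] of full measure the value 0 makes [u] the everywhere pointwise limit of
   [cindic R A x * h k x], hence measurable. *)
pose u x : C := if `[< A x >] then
  limn (fun n => complex.Re (h n x)) +i* limn (fun n => complex.Im (h n x)) else 0.
have hu x : A x -> (fun n => cabs (h n x - u x)) @ \oo --> (0 : R).
  move=> Ax; have cr := cvP x (@complex.Re R) Ax (@Re_le_cabs R).
  have {}cr := cr (fun a b => etrans (cReD _ _) (congr1 _ (cReN _))).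
  have ci := cvP x (@complex.Im R) Ax (@Im_le_cabs R).
  have {}ci := ci (fun a b => etrans (cImD _ _) (congr1 _ (cImN _))).
  apply: (@squeeze_cvgr _ _ _ _ (cst 0)
    (fun n => `|complex.Re (h n x) - complex.Re (u x)| + `|complex.Im (h n x) - complex.Im (u x)|)).
  - by apply: nearW => n; rewrite cabs_ge0/= -cReN -cReD -cImN -cImD; exact: cabs_le_ReIm.
  - exact: cvg_cst.
  - rewrite -[0 in X in _ --> X]addr0; apply: cvgD; apply/norm_cvg0P.
      rewrite /u asboolT//=; rewrite -[0](subrr (limn (fun n => complex.Re (h n x)))).
      by apply: cvgB => //; exact: cvg_cst.
    rewrite /u asboolT//=; rewrite -[0](subrr (limn (fun n => complex.Im (h n x)))).
    by apply: cvgB => //; exact: cvg_cst.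
have mu : cmeas u.
  apply: (@cmeas_lim _ _ _ (fun k x => cindic R A x * h k x)).
    by move=> k; apply: cmeasM; [exact: cmeas_cindic|have [] := h1 k].
  move=> x; have [Ax|nAx] := pselect (A x).
    rewrite /cindic indicE mem_set//; under eq_fun do rewrite mul1r.
    exact: hu.
  rewrite /cindic indicE memNset// /u asboolF//.
  by under eq_fun do rewrite mul0r subrr cabs0; exact: cvg_cst.
have huG x m : A x -> cabs (h m x - u x) <= fine (G x).
  move=> Ax; apply/ler_addgt0Pr => e e0.
  have /cvgrPdist_le/(_ e e0)[k _ /(_ (maxn k m) (leq_maxl _ _))] := hu x Ax.
  rewrite sub0r normrN (ger0_norm (cabs_ge0 _)) => ke.
  have -> : h m x - u x = - (h (maxn k m) x - h m x) + (h (maxn k m) x - u x) by ring.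
  apply: (le_trans (cabsD _ _)); rewrite lerD// cabsN.
  by apply: diffA => //; exact: leq_maxr.
have aeA : {ae tau, forall x, A x}.
  have := integrable_ae measurableT iG; apply: filterS => x /(_ I).
  by rewrite ge0_fin_numE.
have conv : [sequence (\int[tau]_x (cabs (h m x - u x))%:E)%E]_m @ \oo --> 0%E.
  have := @dominated_convergence _ T R tau setT measurableT
    (fun m x => (cabs (h m x - u x))%:E) (cst 0%E) G.
  rewrite integral0; case => //.
  - by move=> k; apply/measurable_EFinP/measurable_cabs/cmeasB => //; have [] := h1 k.
  - apply: filterS aeA => x Ax _.
    by apply: (cvg_comp _ _ (hu x Ax)); exact: cvg_refl.
  - apply: filterS aeA => x Ax k _; rewrite /= (ger0_norm (cabs_ge0 _)).
    by rewrite -(fineK (GA x Ax)) lee_fin; exact: huG.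
have u1 : L1 u.
  split=> //; have [_ ih0] := h1 0%N.
  have ihG : tau.-integrable setT (fun x => (cabs (h 0%N x))%:E + G x)%E.
    by apply: integrableD.
  have iAu : tau.-integrable setT (EFin \o (fun x => cabs (u x))).
    apply: le_integrable ihG => //; first exact/measurable_EFinP/measurable_cabs.
    move=> x _ /=; rewrite (ger0_norm (cabs_ge0 _)).
    rewrite [leRHS]gee0_abs; last by rewrite adde_ge0// lee_fin cabs_ge0.
    have [Ax|nAx] := pselect (A x); last first.
      by rewrite /u asboolF// cabs0 adde_ge0// lee_fin cabs_ge0.
    rewrite -(fineK (GA x Ax)) -EFinD lee_fin.
    rewrite (_ : u x = h 0%N x - (h 0%N x - u x)); last by ring.
    by apply: (le_trans (cabsB _ _)); rewrite lerD2l; exact: huG.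
  by [].
exists u => // e e0.
move: conv => /fine_cvgP[_] /cvgrPdist_lt/(_ e e0)[k _ kP].
exists k => m km; have := kP m km => /=; rewrite sub0r normrN ger0_norm//.
by apply: Rintegral_ge0 => x _; exact: cabs_ge0.
Qed.

End L1.

(** * Topology and Borel sets of the sphere *)

Section sphere_topology.
Variables (R : realType) (d : nat).
Local Notation C := R[i].
Local Notation S := (usphere R d).

Lemma continuous_Re : continuous (@complex.Re R : C -> R).
Proof.
move=> x A /nbhs_ballP [e /= e0 eA].
apply/nbhs_ballP; exists e%:C; first by rewrite /= ltcR.
move=> y; rewrite -ball_normE /= => xy; apply: eA.
rewrite -ball_normE /= -cReN -cReD.
by apply: (le_lt_trans (Re_le_cabs _)); move: xy; rewrite cabsE ltcR.
Qed.

Lemma continuous_Im : continuous (@complex.Im R : C -> R).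
Proof.
move=> x A /nbhs_ballP [e /= e0 eA].
apply/nbhs_ballP; exists e%:C; first by rewrite /= ltcR.
move=> y; rewrite -ball_normE /= => xy; apply: eA.
rewrite -ball_normE /= -cImN -cImD.
by apply: (le_lt_trans (Im_le_cabs _)); move: xy; rewrite cabsE ltcR.
Qed.

Lemma nbhs_row n (x : 'rV[C]_n) (V : set 'rV[C]_n) : nbhs x V ->
  exists2 e : R, 0 < e &
    forall y : 'rV[C]_n, (forall j, cabs (y 0 j - x 0 j) < e) -> V y.
Proof.
move=> /nbhs_ballP[e /= e0 eV].
have eR : e = (complex.Re e)%:C.
  by case: e e0 {eV}=> a b; rewrite ltcE /= => /andP[/eqP -> _].
exists (complex.Re e); first by move: e0; rewrite eR ltcR.
move=> y yx; apply: eV; split => // i j.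
by rewrite (ord1 i) -ball_normE /= distrC cabsE eR ltcR.
Qed.

Lemma continuous_coord (j : 'I_d.+1) : continuous (fun x : S => sval x 0 j : C).
Proof.
move=> x; apply: (@continuous_comp _ _ _ (sval : S -> 'rV[C]_d.+1)
  (fun z : 'rV[C]_d.+1 => z 0 j)).
  exact: initial_continuous.
exact: coord_continuous.
Qed.

Lemma sphere_nsq (x : S) : nsq (sval x) = 1.
Proof. by case: x => z /= /eqP; rewrite hdot_nsq => /complexI. Qed.

Lemma measurable_continuous (f : S -> R) : continuous f ->
  measurable_fun (setT : set (bsphere R d)) f.
Proof.
move=> /continuousP cf; apply: (measurability _ (RGenOpens.measurableE R)).
move=> _ [_ [a [b ->] <-]]; rewrite setTI; apply: sub_sigma_algebra.
exact/cf/interval_open.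
Qed.

Lemma cmeas_coord (j : 'I_d.+1) : cmeas (fun x : bsphere R d => sval x 0 j).
Proof.
split; apply: measurable_continuous => x.
- apply: (@continuous_comp _ _ _ (fun x : S => sval x 0 j : C) (@complex.Re R)).
    exact: continuous_coord.
  exact: continuous_Re.
- apply: (@continuous_comp _ _ _ (fun x : S => sval x 0 j : C) (@complex.Im R)).
    exact: continuous_coord.
  exact: continuous_Im.
Qed.

Lemma coord_le1 n (z : 'rV[C]_n) j : nsq z <= 1 -> cabs (z 0 j) <= 1.
Proof.
move=> z1; rewrite -(@ler_pXn2r _ 2) ?nnegrE ?cabs_ge0//= expr1n.
exact: le_trans (coord_le_nsq z j) z1.
Qed.

Definition rational_box (c : {ffun 'I_d.+1 -> rat * rat}) (k : nat) : set S :=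
  [set x : S | forall j, `|complex.Re (sval x 0 j) - ratr (c j).1| < k.+1%:R^-1 /\
                     `|complex.Im (sval x 0 j) - ratr (c j).2| < k.+1%:R^-1].

(** Rational boxes are a countable base cut out by inequalities on real and imaginary parts of
    coordinates, so that sigma-algebra arguments reach every open set. With $1/(k+1) < e/4$, each of
    the two parts of $y_j - x_j$ stays below $e/2$. *)
Lemma open_rational_boxes (U : set S) : open U -> forall x, U x ->
  exists c k, rational_box c k x /\ rational_box c k `<=` U.
Proof.
move=> [V oV <-] x Vx.
have /nbhs_row[e e0 eV] : nbhs (sval x) V by apply: open_nbhs_nbhs.
pose k := Num.truncn (4 / e).
have ke : k.+1%:R^-1 < e / 4.
  have : 4 / e < k.+1%:R by rewrite truncnS_gt.
  move=> h; rewrite -[e / 4]invrK ltf_pV2 ?posrE ?invr_gt0 ?divr_gt0//.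
  by rewrite invf_div.
have k0 : (0 : R) < k.+1%:R^-1 by rewrite invr_gt0.
have dense_rat (r : R) : exists q : rat, `|r - ratr q| < k.+1%:R^-1.
  move: (k.+1%:R^-1) k0 => w w0.
  have rw : r - w < r + w by lra.
  have [q] := rat_in_itvoo rw.
  by rewrite in_itv/= => /andP[q1 q2]; exists q; rewrite ltr_norml; lra.
have /choice[cr crP] : forall j : 'I_d.+1, exists q : rat,
  `|complex.Re (sval x 0 j) - ratr q| < k.+1%:R^-1 by move=> j; exact: dense_rat.
have /choice[ci ciP] : forall j : 'I_d.+1, exists q : rat,
  `|complex.Im (sval x 0 j) - ratr q| < k.+1%:R^-1 by move=> j; exact: dense_rat.
exists [ffun j => (cr j, ci j)], k; split.
  by move=> j; rewrite ffunE.
move=> y yb; apply: eV => j.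
have [] := yb j; rewrite ffunE /= => yr yi.
apply: (le_lt_trans (cabs_le_ReIm _)); rewrite cReD cReN cImD cImN.
move: (k.+1%:R^-1) ke yr yi (crP j) (ciP j) => w we; rewrite !ltr_norml => /andP[? ?] /andP[? ?] /andP[? ?] /andP[? ?].
rewrite (_ : e = 2 * (e / 4) + 2 * (e / 4)); last by lra.
by apply: ltrD; rewrite ltr_norml; apply/andP; split; lra.
Qed.

End sphere_topology.

(** * Tame densities and the algebra of their multipliers *)

Section henkin_class.
Variables (R : realType) (d : nat).
Local Notation C := R[i].
Local Notation S := (usphere R d).
Local Notation T := (bsphere R d).
Local Notation mp := (mpoly d.+1 C).
Variable tau : {finite_measure set T -> \bar R}.
Local Notation L1 := (L1 tau).
Local Notation cI := (cI tau).
Local Notation N1 := (N1 tau).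
Implicit Types (u v : T -> C) (p q : mp) (Nb : mp -> R -> Prop).

Definition ps p (x : T) : C := pev p (sval x).

Lemma ps_bound p M (x : T) : bnd p 1 M -> cabs (ps p x) <= M.
Proof. by apply; rewrite sphere_nsq. Qed.

Lemma cmeas_ps p : cmeas (ps p).
Proof.
have mX (m : multinom d.+1) : cmeas (ps (mpolyX C m)).
  have -> : ps (mpolyX C m) = (fun x : T => \prod_(i < d.+1) sval x 0 i ^+ m i).
    by apply/funext => x; rewrite /ps /pev mevalX.
  elim: (index_enum _) => [|i r IH].
    by under eq_fun do rewrite big_nil; exact: cmeas_cst.
  under eq_fun do rewrite big_cons; apply: cmeasM => //.
  elim: (m i) => [|k IHk].
    by under eq_fun do rewrite expr0; exact: cmeas_cst.
  by under eq_fun do rewrite exprS; apply: cmeasM => //; exact: cmeas_coord.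
elim/mpolyind: p => [|c m p _ _ IH].
  by rewrite /ps; under eq_fun do rewrite pev0; exact: cmeas_cst.
rewrite /ps; under eq_fun do rewrite pevD pevZ.
apply: cmeasD; last exact: IH.
by apply: cmeasM; [exact: cmeas_cst|exact: mX].
Qed.

Lemma bnd_exists p : exists2 K : R, 0 <= K & bnd p 1 K.
Proof.
elim/mpolyind: p => [|c m p _ _ [K K0 pK]].
  by exists 0 => // z _; rewrite pev0 cabs0.
exists (cabs c + K); first by rewrite addr_ge0// cabs_ge0.
move=> z z1; rewrite pevD pevZ; apply: (le_trans (cabsD _ _)).
apply: lerD; last exact: pK.
rewrite cabsM ler_piMr ?cabs_ge0// /pev mevalX.
elim/big_rec: _ => [|i y _ IH]; first by rewrite cabs1.
rewrite cabsM cabsX mulr_ile1 ?exprn_ge0 ?cabs_ge0// exprn_ile1 ?cabs_ge0//.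
exact: coord_le1.
Qed.

Lemma L1_ps p u : L1 u -> L1 (fun x => u x * ps p x).
Proof.
move=> u1; have [K K0 pK] := bnd_exists p.
under eq_fun do rewrite mulrC.
by apply: (@L1M _ _ _ _ _ _ K) => //; [exact: cmeas_ps|move=> x; exact: ps_bound].
Qed.

Lemma cI_ps_le p u M : L1 u -> bnd p 1 M ->
  cabs (cI (fun x => u x * ps p x)) <= 2 * (M * N1 u).
Proof.
move=> u1 pM; apply: (le_trans (cI_le (L1_ps _ u1))).
rewrite ler_wpM2l//; apply: N1_le => //; first exact: L1_ps.
by move=> x; rewrite cabsM mulrC ler_wpM2r ?cabs_ge0// ps_bound.
Qed.

(* The functional [p |-> \int p u dtau] is, up to a small multiple of the norm,
   controlled by the values of [p] on a smaller ball.  For the multiplier norm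
   this characterizes the weak-* continuous functionals. *)
Definition henkin_density Nb u := forall e : R, 0 < e ->
  exists s K : R, [/\ 0 <= s, s < 1, 0 <= K & forall p M m,
    Nb p M -> bnd p s m -> cabs (cI (fun x => u x * ps p x)) <= e * M + K * m].

Lemma henkin_densityD Nb u v : L1 u -> L1 v ->
  henkin_density Nb u -> henkin_density Nb v ->
  henkin_density Nb (fun x => u x + v x).
Proof.
move=> u1 v1 hu hv e e0; have e20 : 0 < e / 2 by rewrite divr_gt0.
have [s [K [s0 s1 K0 huK]]] := hu _ e20.
have [t [L [t0 t1 L0 hvL]]] := hv _ e20.
exists (Num.max s t), (K + L); split.
- by rewrite le_max s0.
- by rewrite gt_max s1.
- by rewrite addr_ge0.
move=> p M m pM pm.
have -> : (fun x => (u x + v x) * ps p x) = (fun x => u x * ps p x + v x * ps p x).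
  by apply/funext => x; rewrite mulrDl.
rewrite cID; [|exact: L1_ps..]; apply: (le_trans (cabsD _ _)).
have := huK p M m pM (bnd_le _ (lexx m) pm).
have := hvL p M m pM (bnd_le _ (lexx m) pm).
rewrite !le_max !lexx orbT => /(_ isT) h1 /(_ isT) h2; lra.
Qed.

Lemma henkin_densityZ Nb u (a : C) : L1 u -> henkin_density Nb u ->
  henkin_density Nb (fun x => a * u x).
Proof.
move=> u1 hu e e0; pose A := cabs a + 1.
have A0 : 0 < A by rewrite ltr_wpDl ?cabs_ge0.
have eA0 : 0 < e / A by rewrite divr_gt0.
have [s [K [s0 s1 K0 huK]]] := hu _ eA0.
exists s, (A * K); split => //; first by rewrite mulr_ge0// ltW.
move=> p M m pM pm.
have -> : (fun x => a * u x * ps p x) = (fun x => a * (u x * ps p x)).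
  by apply/funext => x; rewrite mulrA.
rewrite cIZ; last exact: L1_ps.
have h := huK p M m pM pm; rewrite cabsM.
have -> : e * M + A * K * m = A * (e / A * M + K * m).
  by field; rewrite gt_eqF.
have h0 : 0 <= e / A * M + K * m by apply: le_trans h; exact: cabs_ge0.
by apply: ler_pM => //; rewrite ?cabs_ge0// lerDl.
Qed.

(** The error $\int p(v-u)\,d\tau$ is bounded by the supremum of $|p|$ on the sphere, which the
    first hypothesis bounds by [M]. With the factor 2 of [cI_ps_le], an $L^1$ distance below $e/4$
    costs half of [e]. *)
Lemma henkin_density_lim Nb u : (forall p M, Nb p M -> bnd p 1 M) -> L1 u ->
  (forall e, 0 < e -> exists v, [/\ L1 v, henkin_density Nb v &
                                     N1 (fun x => v x - u x) < e]) ->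
  henkin_density Nb u.
Proof.
move=> Nb1 u1 hu e e0; have e40 : 0 < e / 4 by rewrite divr_gt0.
have e20 : 0 < e / 2 by rewrite divr_gt0.
have [v [v1 hv vu]] := hu _ e40.
have [s [K [s0 s1 K0 hvK]]] := hv _ e20.
exists s, K; split => // p M m pM pm.
have -> : (fun x => u x * ps p x) =
    (fun x => v x * ps p x - (v x - u x) * ps p x).
  by apply/funext => x; rewrite -mulrBl opprB addrC subrK.
have vu1 : L1 (fun x => v x - u x) by exact: L1B.
rewrite cIB; [|exact: L1_ps..]; apply: (le_trans (cabsB _ _)).
have pM1 := Nb1 _ _ pM.
have := hvK p M m pM pm; have := cI_ps_le vu1 pM1.
have M0 : 0 <= M := bnd_ge0 ler01 pM1.
have := N1_ge0 tau (fun x => v x - u x); nra.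
Qed.

Definition supnb p (M : R) := bnd p 1 M.
Local Notation HS := (henkin_density supnb).

(** Quantifying over all tame [u] makes the multipliers an algebra. Measurability and boundedness
    are bundled to keep products integrable and to make the class stable under bounded pointwise
    limits. *)
Definition hs_mult v := [/\ cmeas v, exists B : R, forall x, cabs (v x) <= B &
  forall u, L1 u -> HS u -> HS (fun x => v x * u x)].

Lemma hs_mult_cst (a : C) : hs_mult (fun=> a).
Proof.
split; [exact: cmeas_cst|by exists (cabs a)|].
by move=> u u1 hu; exact: henkin_densityZ.
Qed.

Lemma hs_mult_L1 v u : hs_mult v -> L1 u -> L1 (fun x => v x * u x).
Proof. by move=> [mv [B vB] _] u1; exact: (L1M mv vB). Qed.

Lemma hs_multD v w : hs_mult v -> hs_mult w -> hs_mult (fun x => v x + w x).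
Proof.
move=> hv hw; have [mv [B vB] vH] := hv; have [mw [D wD] wH] := hw.
split; first exact: cmeasD.
  by exists (B + D) => x; apply: (le_trans (cabsD _ _)); exact: lerD.
move=> u u1 uH; under eq_fun do rewrite mulrDl.
by apply: henkin_densityD; [exact: hs_mult_L1..|exact: vH|exact: wH].
Qed.

Lemma hs_multM v w : hs_mult v -> hs_mult w -> hs_mult (fun x => v x * w x).
Proof.
move=> hv hw; have [mv [B vB] vH] := hv; have [mw [D wD] wH] := hw.
split; first exact: cmeasM.
  exists (B * D) => x; rewrite cabsM ler_pM ?cabs_ge0//.
move=> u u1 uH; under eq_fun do rewrite -mulrA.
by apply: vH; [exact: hs_mult_L1|exact: wH].
Qed.

Lemma hs_multX v k : hs_mult v -> hs_mult (fun x => v x ^+ k).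
Proof.
move=> hv; elim: k => [|k IH]; first by under eq_fun do rewrite expr0; exact: hs_mult_cst.
by under eq_fun do rewrite exprS; exact: hs_multM.
Qed.

Lemma hs_mult_lim (h : nat -> T -> C) v (B : R) : (forall k, hs_mult (h k)) ->
  (forall k x, cabs (h k x) <= B) ->
  (forall x, (fun k => cabs (h k x - v x)) @ \oo --> (0 : R)) -> hs_mult v.
Proof.
move=> hH hB hv.
have mh k : cmeas (h k) by have [] := hH k.
have mv : cmeas v := cmeas_lim mh hv.
have vB x : cabs (v x) <= B.
  apply/ler_addgt0Pr => e e0.
  have /cvgrPdist_le/(_ e e0)[k _ /(_ k (leqnn k))] := hv x.
  rewrite sub0r normrN (ger0_norm (cabs_ge0 _)) => ke.
  have -> : v x = h k x - (h k x - v x) by ring.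
  by apply: (le_trans (cabsB _ _)); exact: lerD.
split => //; first by exists B.
move=> u u1 uH; apply: henkin_density_lim => //; first exact: (L1M mv vB).
move=> e e0.
have ig : tau.-integrable setT (EFin \o (fun x => B * cabs (u x))).
  have [_ iu] := u1; have := integrableZl measurableT B iu.
  by apply: eq_integrable.
have mhu k : cmeas (fun x => h k x * u x) by apply: cmeasM => //; have [] := u1.
have hub k x : cabs (h k x * u x) <= B * cabs (u x).
  by rewrite cabsM ler_wpM2r ?cabs_ge0.
have huv x : (fun k => cabs (h k x * u x - v x * u x)) @ \oo --> (0 : R).
  under eq_fun do rewrite -mulrBl cabsM.
  by rewrite -[0](mul0r (cabs (u x))); apply: cvgM => //; exact: cvg_cst.
have [_ /(_ e e0)[k ke]] := N1_dominated mhu ig hub huv.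
exists (fun x => h k x * u x); split => //; first exact: hs_mult_L1.
by have [_ _] := hH k; exact.
Qed.

End henkin_class.

(** * Bounded Borel functions preserve tameness for the supremum norm *)

Section borel_multipliers.
Variables (R : realType) (d : nat).
Local Notation C := R[i].
Local Notation S := (usphere R d).
Local Notation T := (bsphere R d).
Local Notation mp := (mpoly d.+1 C).
Variable tau : {finite_measure set T -> \bar R}.
Local Notation L1 := (L1 tau).
Local Notation cI := (cI tau).
Local Notation N1 := (N1 tau).
Local Notation HS := (henkin_density tau (@supnb R d)).
Local Notation hs_mult := (hs_mult tau).
Implicit Types (u v : T -> C) (p q : mp).

Lemma bndM p q (s M K : R) : 0 <= s -> bnd p s K -> bnd q s M -> bnd (p * q) s (K * M).
Proof.
move=> s0 pK qM z zs; rewrite pevM cabsM ler_pM ?cabs_ge0//; [exact: pK|exact: qM].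
Qed.

Lemma bnd_coord j (s : R) : s <= 1 -> bnd (mpolyX C (mnm1 j) : mp) s 1.
Proof. by move=> s1 z zs; rewrite pevX; apply: coord_le1; exact: le_trans s1. Qed.

Lemma sphere_coord_le1 (x : S) j : cabs (sval x 0 j) <= 1.
Proof. by apply: coord_le1; rewrite sphere_nsq. Qed.

Lemma hs_mult_coord (j : 'I_d.+1) : hs_mult (fun x => sval x 0 j).
Proof.
split; first exact: cmeas_coord.
  by exists 1 => x; exact: sphere_coord_le1.
move=> u u1 uH e e0; have [s [K [s0 s1 K0 h]]] := uH e e0.
exists s, K; split => // p M m pM pm.
have -> : (fun x : T => sval x 0 j * u x * ps p x) =
    (fun x => u x * ps (mpolyX C (mnm1 j) * p) x).
  by apply/funext => x; rewrite /ps pevM pevX; ring.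
apply: h.
- by rewrite /supnb -[M]mul1r; apply: bndM => //; exact: bnd_coord.
- by rewrite -[m]mul1r; apply: bndM => //; apply: bnd_coord; exact: ltW.
Qed.

(** With [q] from [ray_integral], $\int \bar z_j p u = \int(\bar z_j p - q)u + \int q u$. The first
    integrand is small pointwise by [dbar_estimate]; the second term is the tame functional of [u]
    at the polynomial [q]. *)
Lemma hs_mult_coordJ (j : 'I_d.+1) : hs_mult (fun x => (sval x 0 j)^*%C).
Proof.
split; first by apply: cmeasJ; exact: cmeas_coord.
  by exists 1 => x; rewrite cabsJ; exact: sphere_coord_le1.
move=> u u1 uH e e0; pose N := N1 u + 1.
have N0 : 0 < N by rewrite ltr_wpDl// N1_ge0.
have NN : N1 u <= N by rewrite lerDl.
(* The first integral contributes $2 \cdot 4Mt N$, which this choice bounds by $(e/2)M$. *)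
pose t := Num.min 1 (e / (16 * N)).
have t0 : 0 < t by rewrite lt_min ltr01 divr_gt0// mulr_gt0.
have t1 : t <= 1 by rewrite ge_min lexx.
have te : t * (16 * N) <= e.
  by rewrite -ler_pdivlMr ?mulr_gt0// ge_min lexx orbT.
have t20 : 0 < t ^+ 2 by rewrite exprn_gt0.
have t21 : t ^+ 2 <= 1 by rewrite expr_le1// ltW.
(* $24 = 2 \cdot 12$, where 12 is the constant of [ray_integral_bound] for the supremum norm of
   [q]. *)
have e24 : 0 < e / 24 by rewrite divr_gt0.
have [s0 [K [s00 s01 K0 h]]] := uH _ e24.
(* [s0] bounds squared norms, so its root is the radius; the midpoint [sg'] between it and 1 leaves
   room for the Cauchy estimate of [q]. *)
pose sg := Num.sqrt s0; have sg2 : sg ^+ 2 = s0 by rewrite sqr_sqrtr.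
have sg0 : 0 <= sg by rewrite sqrtr_ge0.
have sg1 : sg < 1 by rewrite -(@ltr_pXn2r _ 2) ?nnegrE//= sg2 expr1n.
pose sg' := (1 + sg) / 2; have sgsg : sg < sg' by rewrite /sg'; lra.
have sg'1 : sg' < 1 by rewrite /sg'; lra.
have sg'0 : 0 <= sg' by lra.
pose r := 1 - t ^+ 2 / 2; have r0 : 0 <= r by rewrite /r; lra.
have r1 : r < 1 by rewrite /r; lra.
pose L := 1 + 4 / t ^+ 2; have L0 : 0 <= L by rewrite addr_ge0// divr_ge0// ltW.
pose D := 2 / (sg' - sg); have D0 : 0 <= D by rewrite divr_ge0// subr_ge0 ltW.
exists (Num.max (r ^+ 2) (sg' ^+ 2)), (2 * L * N + K * D); split.
- by rewrite le_max sqr_ge0.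
- by rewrite gt_max; apply/andP; split; rewrite expr_lt1.
- have N0' := ltW N0.
  by apply: addr_ge0; apply: mulr_ge0 => //; apply: mulr_ge0.
move=> p M m pM pm.
have pmr : bnd p (r ^+ 2) m by apply: bnd_le pm => //; rewrite le_max lexx.
have pms : bnd p (sg' ^+ 2) m by apply: bnd_le pm => //; rewrite le_max lexx orbT.
have [q qP] := ray_integral p j.
have qM := ray_integral_bound qP pM.
have qm := ray_integral_inner qP sg0 sgsg pms.
rewrite sg2 in qm.
have M0 : 0 <= M := bnd_ge0 ler01 pM.
have m0 : 0 <= m := bnd_ge0 (sqr_ge0 _) pmr.
have -> : (fun x : T => (sval x 0 j)^*%C * u x * ps p x) =
    (fun x => u x * ((sval x 0 j)^*%C * ps p x - ps q x) + u x * ps q x).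
  by apply/funext => x; ring.
pose g (x : T) : C := (sval x 0 j)^*%C * ps p x - ps q x.
have gle (x : T) : cabs (g x) <= 4 * M * t + L * m.
  exact: (dbar_estimate qP (sphere_nsq x) t0 t1 pM pmr).
have mg : cmeas (g : T -> C).
  apply: cmeasB; last exact: cmeas_ps.
  by apply: cmeasM; [apply: cmeasJ; exact: cmeas_coord|exact: cmeas_ps].
have ug1 : L1 (fun x => u x * g x).
  by under eq_fun do rewrite mulrC; exact: (L1M mg gle).
rewrite cID//; last exact: L1_ps.
apply: (le_trans (cabsD _ _)).
have h1 : cabs (cI (fun x => u x * g x)) <= 2 * ((4 * M * t + L * m) * N1 u).
  apply: (le_trans (cI_le ug1)); rewrite ler_wpM2l//; apply: N1_le => //.
  by move=> x; rewrite cabsM mulrC ler_wpM2r ?cabs_ge0.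
have h2 := h q _ _ qM qm.
have h3 : 2 * ((4 * M * t + L * m) * N1 u) <= 2 * ((4 * M * t + L * m) * N).
  have ? : 0 <= L * m by rewrite mulr_ge0.
  have ? : 0 <= M * t by rewrite mulr_ge0// ltW.
  by rewrite ler_wpM2l// ler_wpM2l//; lra.
have h4 : 2 * (4 * M * t * N) <= e / 2 * M.
  have := ler_wpM2l M0 te; lra.
have -> : e * M + (2 * L * N + K * D) * m =
  (e / 2 * M + 2 * (L * m * N)) + (e / 24 * (12 * M) + K * (2 * (m / (sg' - sg)))).
  by rewrite /D; field; rewrite subr_eq0 gt_eqF.
apply: lerD => //; apply: (le_trans h1); apply: (le_trans h3).
have -> : 2 * ((4 * M * t + L * m) * N) =
  2 * (4 * M * t * N) + 2 * (L * m * N) by ring.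
by rewrite lerD2r.
Qed.

(** With $w = \sqrt z$, an induction gives $n w^n \le 1/(1-w)$, and the remaining factor $w^n$ tends
    to 0. *)
Lemma cvg_natr_expr (z : R) : 0 <= z -> z < 1 ->
  (fun n => n%:R * z ^+ n) @ \oo --> (0 : R).
Proof.
move=> z0 z1; pose w := Num.sqrt z; have w2 : w ^+ 2 = z by rewrite sqr_sqrtr.
have w0 : 0 <= w by rewrite sqrtr_ge0.
have w1 : w < 1 by rewrite -(@ltr_pXn2r _ 2) ?nnegrE//= w2 expr1n.
have bound n : n%:R * w ^+ n * (1 - w) <= 1 - w ^+ n.
  elim: n => [|n IH]; first by rewrite !mul0r expr0 subrr.
  have h1 : w * (n%:R * w ^+ n * (1 - w)) <= w * (1 - w ^+ n) by rewrite ler_wpM2l.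
  have h2 : (1 - w) * w ^+ n.+1 <= (1 - w) * 1.
    by rewrite ler_wpM2l ?exprn_ile1 ?subr_ge0// ltW.
  by move: h1 h2; rewrite -natr1 exprS; lra.
have w10 : 0 < 1 - w by rewrite subr_gt0.
apply: (@squeeze_cvgr _ _ _ _ (cst 0) (fun n => (1 - w)^-1 * w ^+ n)).
- apply: nearW => n; rewrite mulr_ge0// ?exprn_ge0//=.
  rewrite -w2 -exprM mulnC exprM expr2 mulrA ler_wpM2r ?exprn_ge0//.
  rewrite -[leRHS]mul1r ler_pdivlMr//; apply: (le_trans (bound n)).
  by rewrite gerBl exprn_ge0.
- exact: cvg_cst.
- rewrite -[0 in X in _ --> X](mulr0 (1 - w)^-1); apply: cvgM; first exact: cvg_cst.
  by apply: cvg_expr; rewrite ger0_norm.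
Qed.

(** Polynomials converging to a step, as in elementary proofs of the Stone-Weierstrass theorem.
    Below $1/2$ Bernoulli gives at least $1 - n(2x)^n$. From $1/2$ on, $(1-y)^k(1+y)^k \le 1$ and
    $(1+y)^k \ge 1+ky \ge n+1$ with $y = x^n$. The factor $n$ in the exponent settles the threshold,
    where $(1-2^{-n})^{2^n}$ would tend to $1/e$. *)
Lemma cvg_step (x : R) : 0 <= x -> x <= 1 ->
  (fun n => (1 - x ^+ n) ^+ (n * 2 ^ n)) @ \oo --> (((x < 1 / 2)%R : bool)%:R : R).
Proof.
move=> x0 x1; have xn0 n : 0 <= x ^+ n by rewrite exprn_ge0.
have xn1 n : x ^+ n <= 1 by rewrite exprn_ile1.
have bern (y : R) k : 0 <= y -> y <= 1 -> 1 - k%:R * y <= (1 - y) ^+ k.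
  move=> y0 y1; elim: k => [|k IH]; first by rewrite mul0r subr0 expr0.
  rewrite exprS -natr1.
  have : (1 - y) * (1 - k%:R * y) <= (1 - y) * (1 - y) ^+ k by rewrite ler_wpM2l// subr_ge0.
  have : 0 <= k%:R * y * y by rewrite !mulr_ge0.
  lra.
have bern2 (y : R) k : 0 <= y -> 1 + k%:R * y <= (1 + y) ^+ k.
  move=> y0; elim: k => [|k IH]; first by rewrite mul0r addr0 expr0.
  rewrite exprS -natr1.
  have : (1 + y) * (1 + k%:R * y) <= (1 + y) * (1 + y) ^+ k by rewrite ler_wpM2l// addr_ge0.
  have : 0 <= k%:R * y * y by rewrite !mulr_ge0.
  lra.
have [xh|xh] := ltrP x (1 / 2).
  apply: (@squeeze_cvgr _ _ _ _ (fun n => 1 - n%:R * (2 * x) ^+ n) (cst 1)).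
  - apply: nearW => n; apply/andP; split.
      apply: le_trans (bern _ _ (xn0 n) (xn1 n)).
      by rewrite natrM natrX exprMn mulrA.
    by rewrite exprn_ile1 ?subr_ge0// gerBl.
  - rewrite -[1 in X in _ --> X]subr0; apply: cvgB; first exact: cvg_cst.
    by apply: cvg_natr_expr; lra.
  - exact: cvg_cst.
apply: (@squeeze_cvgr _ _ _ _ (cst 0) (fun n => (n.+1%:R)^-1)).
- apply: nearW => n; rewrite exprn_ge0 ?subr_ge0//=.
  set k := (n * 2 ^ n)%N; rewrite -[_ ^+ _]mul1r.
  have yk : (1 - x ^+ n) ^+ k * (1 + x ^+ n) ^+ k <= 1.
    have y0 := xn0 n; have y1 := xn1 n.
    by rewrite -exprMn exprn_ile1//; nra.
  have nk : n.+1%:R <= (1 + x ^+ n) ^+ k.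
    apply: le_trans (bern2 _ k (xn0 n)).
    rewrite -natr1 addrC lerD2l natrM natrX -mulrA -exprMn ler_peMr//.
    by rewrite exprn_ege1//; lra.
  have n0 : (0 : R) < n.+1%:R by rewrite ltr0n.
  rewrite mul1r -[leRHS]mul1r ler_pdivlMr//.
  apply: (le_trans _ yk); rewrite ler_wpM2l// exprn_ge0// subr_ge0//.
- exact: cvg_cst.
- exact: cvg_harmonic.
Qed.

Definition borel_mult : set (set S) := [set A | hs_mult (cindic R (A : set T))].

Lemma hs_multN v : hs_mult v -> hs_mult (fun x => - v x).
Proof.
move=> hv; under eq_fun do rewrite -mulN1r.
by apply: hs_multM => //; exact: hs_mult_cst.
Qed.

(** An affine map sends the values of [f] into $[0,1]$ and [a] to $1/2$; the polynomials of
    [cvg_step] in [f] are multipliers and converge boundedly to the indicator. *)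
Lemma borel_mult_sublevel (f : T -> R) (B a : R) : (forall x, `|f x| <= B) ->
  hs_mult (fun x => (f x)%:C) -> borel_mult [set x | f x < a].
Proof.
move=> fB fH; pose D := B + `|a| + 1.
have D0 : 0 < D.
  have := fB point; have := normr_ge0 a; have := normr_ge0 (f point); rewrite /D; lra.
pose g x := (f x - a) / (2 * D) + 1 / 2.
have D20 : 0 < 2 * D by rewrite mulr_gt0.
have gE x : g x * (2 * D) = f x - a + D.
  by rewrite /g; field; rewrite gt_eqF.
have g01 x : 0 <= g x <= 1.
  have := fB x; rewrite ler_norml => /andP[f1 f2].
  have := ler_norm a; have := ler_norm (- a); rewrite normrN => a1 a2.
  apply/andP; split; rewrite -(ler_pM2r D20) gE; rewrite /D; lra.
have ga x : (g x < 1 / 2) = (f x < a).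
  rewrite -(ltr_pM2r D20) gE; have -> : 1 / 2 * (2 * D) = D by field.
  by rewrite gtrDr subr_lt0.
have gH : hs_mult (fun x => (g x)%:C).
  have -> : (fun x => (g x)%:C) =
      (fun x => ((2 * D)^-1)%:C * (f x)%:C + (1 / 2 - a / (2 * D))%:C).
    apply/funext => x; rewrite -rmorphM -rmorphD; congr (_%:C).
    by rewrite /g; ring.
  by apply: hs_multD; [apply: hs_multM => //|]; exact: hs_mult_cst.
apply: (@hs_mult_lim _ _ _ (fun n x => (1 - (g x)%:C ^+ n) ^+ (n * 2 ^ n)) _ 1).
- move=> n; apply: hs_multX; apply: hs_multD; first exact: hs_mult_cst.
  by apply: hs_multN; exact: hs_multX.
- move=> n x; have /andP[g0 g1] := g01 x.
  have gn0 : 0 <= g x ^+ n by rewrite exprn_ge0.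
  have gn1 : g x ^+ n <= 1 by rewrite exprn_ile1.
  rewrite -[1]/(1%:C) -rmorphXn -rmorphB -rmorphXn/= cabs_real ger0_norm.
    by rewrite exprn_ile1 ?subr_ge0// gerBl.
  by rewrite exprn_ge0// subr_ge0.
- move=> x; have /andP[g0 g1] := g01 x.
  have -> : (fun k => cabs ((1 - (g x)%:C ^+ k) ^+ (k * 2 ^ k) - cindic R [set x | f x < a] x)) =
     (fun k => `|(1 - g x ^+ k) ^+ (k * 2 ^ k) - ((g x < 1 / 2)%R : bool)%:R|).
    apply/funext => k.
    rewrite -[X in X - _ ^+ k]/(1%:C) -rmorphXn -rmorphB -rmorphXn/= /cindic -rmorphB cabs_real.
    rewrite indicE ga; have [fa|/negP fa] := boolP (f x < a); first by rewrite mem_set.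
    by rewrite memNset.
  apply/norm_cvg0P.
  rewrite -[0 in X in _ --> X](subrr (((g x < 1 / 2)%R : bool)%:R : R)).
  by apply: cvgB; [exact: cvg_step|exact: cvg_cst].
Qed.

Lemma borel_multC A : borel_mult A -> borel_mult (~` A).
Proof.
move=> hA; rewrite /borel_mult /=.
have -> : cindic R (~` A : set T) = (fun x => 1 + - cindic R (A : set T) x).
  apply/funext => x; rewrite /cindic !indicE !rmorph_nat.
  have [Ax|Ax] := pselect (A x); last by rewrite mem_set// memNset// subr0.
  by rewrite memNset ?mem_set ?subrr//; exact.
by apply: hs_multD; [exact: hs_mult_cst|exact: hs_multN].
Qed.

Lemma borel_mult_bigcap (F : nat -> set S) : (forall k, borel_mult (F k)) ->
  borel_mult (\bigcap_k F k).
Proof.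
move=> hF; pose h n (x : T) : C := \prod_(k < n) cindic R (F k : set T) x.
have hE n x : h n x = ((`[< forall k, (k < n)%N -> F k x >])%:R : R)%:C.
  elim: n => [|n IH]; first by rewrite /h big_ord0 asboolT.
  rewrite /h big_ord_recr/= -/(h n x) IH /cindic indicE -rmorphM -natrM; congr (_%:R%:C).
  have [Fx|Fx] := pselect (F n x); last first.
    rewrite memNset// muln0 asboolF// => /(_ n (ltnSn n)) //.
  rewrite mem_set// muln1; congr (nat_of_bool _); apply/asbool_equiv_eq; split=> [H k|H k kn].
    by rewrite ltnS leq_eqVlt => /predU1P[->//|]; exact: H.
  by apply: H; exact: ltnW.
apply: (@hs_mult_lim _ _ _ h _ 1).
- elim=> [|n IH]; first by rewrite /h; under eq_fun do rewrite big_ord0; exact: hs_mult_cst.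
  rewrite /h; under eq_fun do rewrite big_ord_recr/=.
  by apply: hs_multM => //; exact: hF.
- by move=> n x; rewrite hE cabs_real; case: asbool; rewrite ?normr1 ?normr0.
- move=> x; have [Fx|Fx] := pselect ((\bigcap_k F k) x).
    have -> : (fun k => cabs (h k x - cindic R (\bigcap_k F k : set T) x)) = cst 0.
      apply/funext => k; rewrite hE /cindic indicE mem_set// asboolT ?subrr ?cabs0//.
      by move=> j _; exact: Fx.
    exact: cvg_cst.
  have [k Fk] : exists k, ~ F k x.
    by apply: contrapT => /forallNP nF; apply: Fx => k _; exact: contrapT (nF k).
  apply: cvg_near_cst; exists k.+1 => // n /= kn.
  rewrite hE /cindic indicE memNset// asboolF ?subrr ?cabs0//.
  by move=> /(_ k kn).
Qed.

Lemma borel_mult_sigma : sigma_algebra setT borel_mult.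
Proof.
have b0 : borel_mult set0.
  rewrite /borel_mult /=; have -> : cindic R (set0 : set T) = (fun=> 0).
    by apply/funext => x; rewrite /cindic indic0.
  exact: hs_mult_cst.
split => //.
  by move=> A hA; rewrite setTD; exact: borel_multC.
move=> F hF; rewrite -[\bigcup_k F k]setCK; apply: borel_multC.
by rewrite setC_bigcup; apply: borel_mult_bigcap => k; exact: borel_multC.
Qed.

Lemma borel_multI A B : borel_mult A -> borel_mult B -> borel_mult (A `&` B).
Proof.
move=> hA hB; rewrite /borel_mult /=.
have -> : cindic R (A `&` B : set T) =
    (fun x => cindic R (A : set T) x * cindic R (B : set T) x).
  by apply/funext => x; rewrite /cindic indicI rmorphM.
exact: hs_multM.
Qed.

Lemma hs_mult_Re j : hs_mult (fun x => (complex.Re (sval x 0 j))%:C) /\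
  hs_mult (fun x => (complex.Im (sval x 0 j))%:C).
Proof.
split.
- under eq_fun do rewrite ReJ_add mulrC.
  apply: hs_multM; first exact: hs_mult_cst.
  by apply: hs_multD; [exact: hs_mult_coord|exact: hs_mult_coordJ].
- under eq_fun do rewrite ImJ_sub mulrC.
  apply: hs_multM; first exact: hs_mult_cst.
  under eq_fun do rewrite mulrC.
  apply: hs_multM; first exact: hs_mult_cst.
  apply: hs_multD; first exact: hs_mult_coordJ.
  by apply: hs_multN; exact: hs_mult_coord.
Qed.

Lemma borel_mult_box c k : borel_mult (@rational_box R d c k).
Proof.
have band (f : T -> R) (r w : R) : (forall x, `|f x| <= 1) ->
    hs_mult (fun x => (f x)%:C) -> borel_mult [set x | `|f x - r| < w].
  move=> f1 fH; have -> : [set x | `|f x - r| < w] =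
      [set x | f x < r + w] `&` [set x | - f x < w - r].
    by apply/seteqP; split=> x /=; rewrite ltr_norml; [move=> /andP[]|]; lra.
  apply: borel_multI; apply: (@borel_mult_sublevel _ 1) => //.
    by move=> x; rewrite normrN.
  by under eq_fun do rewrite rmorphN; exact: hs_multN.
(* A finite intersection written as a countable one: indices that are not coordinates contribute the
   whole sphere. *)
pose F (i : nat) : set S := match insub i : option 'I_d.+1 with
  | Some j => [set x : S | `|complex.Re ((sval x : 'rV[C]_d.+1) 0 j) - ratr (c j).1| < k.+1%:R^-1] `&`
              [set x : S | `|complex.Im ((sval x : 'rV[C]_d.+1) 0 j) - ratr (c j).2| < k.+1%:R^-1]
  | None => setT end.
have -> : rational_box c k = \bigcap_i F i.
  apply/seteqP; split=> [x xb i _|x xF j].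
    by rewrite /F; case: insubP => // j _ _; have [] := xb j.
  by have := xF j I; rewrite /F valK => -[].
apply: borel_mult_bigcap => i; rewrite /F; case: insubP => [j _ _|_]; last first.
  by have [b0 bC _] := borel_mult_sigma; rewrite -setC0 -setTD; exact: bC.
have [hr hi] := hs_mult_Re j.
apply: borel_multI; apply: band => // x.
- exact: le_trans (Re_le_cabs _) (sphere_coord_le1 x j).
- exact: le_trans (Im_le_cabs _) (sphere_coord_le1 x j).
Qed.

Lemma borel_mult_measurable (A : set T) : measurable A -> borel_mult A.
Proof.
apply: smallest_sub; first exact: borel_mult_sigma.
(* All rational boxes contained in [U], enumerated through [pickle]; the other codes give the empty
   set. *)
move=> U oU; pose F (i : nat) : set S :=
  match unpickle i : option ({ffun 'I_d.+1 -> rat * rat} * nat) with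
  | Some (c, k) => if `[< @rational_box R d c k `<=` U >] then rational_box c k else set0
  | None => set0 end.
have -> : U = \bigcup_i F i.
  apply/seteqP; split=> [x Ux|x [i _]].
    have [c [k [xb bU]]] := open_rational_boxes oU Ux.
    by exists (pickle (c, k)) => //; rewrite /F pickleK asboolT.
  rewrite /F; case: unpickle => // -[c k]; case: asboolP => // bU; exact: bU.
have [b0 _ bU] := borel_mult_sigma; apply: bU => i.
rewrite /F; case: unpickle => // -[c k]; case: asboolP => // _.
exact: borel_mult_box.
Qed.

Lemma hs_mult_bounded (v : T -> C) (B : R) : cmeas v -> (forall x, cabs (v x) <= B) ->
  hs_mult v.
Proof.
suff real01 (f : T -> R) : measurable_fun setT f -> (forall x, 0 <= f x <= 1) ->
    hs_mult (fun x => (f x)%:C).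
  move=> [mr mi] vB; pose D := B + 1.
  have D0 : 0 < D by rewrite ltr_wpDl//; apply: le_trans (vB point); exact: cabs_ge0.
  have D20 : 0 < 2 * D by rewrite mulr_gt0.
  have bounded (f : T -> R) : measurable_fun setT f -> (forall x, `|f x| <= B) ->
      hs_mult (fun x => (f x)%:C).
    move=> mf fB.
    have -> : (fun x => (f x)%:C) =
        (fun x => (2 * D)%:C * ((2 * D)^-1 * (f x + D))%:C + (- D)%:C).
      apply/funext => x; rewrite -rmorphM -rmorphD; congr (_%:C).
      by field; rewrite gt_eqF.
    apply: hs_multD; last exact: hs_mult_cst.
    apply: hs_multM; first exact: hs_mult_cst.
    apply: real01.
      apply: measurable_funM => //; apply: measurable_funD => //.
    move=> x; have := fB x; rewrite ler_norml => /andP[f1 f2].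
    rewrite mulr_ge0 ?invr_ge0 ?(ltW D20)//=; last by rewrite /D; lra.
    by rewrite mulrC ler_pdivrMr// mul1r /D; lra.
  have -> : v = (fun x => (complex.Re (v x))%:C + 'i%C * (complex.Im (v x))%:C).
    by apply/funext => x; rewrite -complexE.
  apply: hs_multD; first by apply: bounded => // x; exact: le_trans (Re_le_cabs _) (vB x).
  apply: hs_multM; first exact: hs_mult_cst.
  by apply: bounded => // x; exact: le_trans (Im_le_cabs _) (vB x).
move=> mf f01.
pose A n k := [set x : T | k.+1%:R / n.+1%:R <= f x].
have mA n k : measurable (A n k).
  have := mf measurableT _ (measurable_itv `[k.+1%:R / n.+1%:R, +oo[).
  rewrite setTI; congr measurable; apply/seteqP; split=> x;
    by rewrite /A /= in_itv/= andbT.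
(* This is $\lfloor (n+1)f \rfloor/(n+1)$, within $1/(n+1)$ of $f$: the sum counts the integers from
   1 to $n+1$ that are at most $(n+1)f(x)$, and [count] locates that number. *)
pose h n (x : T) : C := (n.+1%:R^-1)%:C * \sum_(k < n.+1) cindic R (A n k) x.
have count (y : R) N : 0 <= y ->
    let S := \sum_(k < N) ((k.+1%:R <= y)%R : bool)%:R in
    S <= y /\ (y < S + 1 \/ S = N%:R) /\ S <= N%:R.
  move=> y0; elim: N => [|N [IH1 [IH2 IH3]]] /=.
    by rewrite big_ord0; do !split => //; right.
  rewrite big_ord_recr/=; set S := \sum_(i < N) _ in IH1 IH2 IH3 *.
  have [Ny|Ny] := lerP N.+1%:R y; rewrite ?mulr1n ?mulr0n ?addr0.
    have SN : S = N%:R.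
      by case: IH2 => // yS; move: Ny; rewrite -natr1; lra.
    by rewrite SN natr1; do !split => //; right.
  split=> //; split; last by rewrite -natr1; lra.
  by left; case: IH2 => // ->; rewrite natr1.
have hE n x : h n x = (n.+1%:R^-1 *
    \sum_(k < n.+1) ((k.+1%:R <= n.+1%:R * f x)%R : bool)%:R)%:C.
  rewrite /h rmorphM rmorph_sum; congr (_ * _); apply: eq_bigr => k _.
  rewrite /cindic indicE -(ler_pdivrMl _ _ (ltr0Sn R n)) mulrC.
  have [kf|/negP kf] := boolP (k.+1%:R / n.+1%:R <= f x); first by rewrite mem_set.
  by rewrite memNset.
have hf n x : cabs (h n x - (f x)%:C) <= n.+1%:R^-1.
  have /andP[f0 f1] := f01 x; have n0 : (0 : R) < n.+1%:R by rewrite ltr0n.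
  have nf0 : 0 <= n.+1%:R * f x by rewrite mulr_ge0// ltW.
  have nf1 : n.+1%:R * f x <= n.+1%:R by rewrite ler_piMr// ltW.
  have /= [] := count _ n.+1 nf0.
  rewrite hE -rmorphB cabs_real; set S := \sum_(k < n.+1) _ => S1 [S2 S3].
  have -> : n.+1%:R^-1 * S - f x = n.+1%:R^-1 * (S - n.+1%:R * f x).
    by rewrite mulrBr mulKf// gt_eqF.
  have ni0 : 0 <= n.+1%:R^-1 :> R by rewrite invr_ge0 ltW.
  rewrite normrM (ger0_norm ni0) -[leRHS]mulr1 ler_wpM2l//.
  by rewrite ler_norml; case: S2 => S2; lra.
apply: (@hs_mult_lim _ _ _ h _ 2).
- move=> n; apply: hs_multM; first exact: hs_mult_cst.
  elim: (index_enum _) => [|k r IH].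
    by under eq_fun do rewrite big_nil; exact: hs_mult_cst.
  under eq_fun do rewrite big_cons; apply: hs_multD => //.
  exact: borel_mult_measurable.
- move=> n x; rewrite -[h n x](subrK (f x)%:C); apply: (le_trans (cabsD _ _)).
  rewrite -[2]/(1 + 1) lerD//.
    by apply: (le_trans (hf n x)); rewrite invf_le1 ?ltr0n// ler1n.
  by have /andP[f0 f1] := f01 x; rewrite cabs_real ger0_norm.
- move=> x; apply: (@squeeze_cvgr _ _ _ _ (cst 0) (fun n => n.+1%:R^-1)).
  + by apply: nearW => n; rewrite cabs_ge0/=.
  + exact: cvg_cst.
  + exact: cvg_harmonic.
Qed.

(** The functional of an annihilating density is zero, hence tame with $s = K = 0$;
    [hs_mult_bounded] then inserts the factor [v]. This is where arbitrary Borel factors are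
    used. *)
Lemma annihilator_henkin m (v : T -> C) (B : R) : L1 m ->
  (forall p, cI (fun x => m x * ps p x) = 0) ->
  cmeas v -> (forall x, cabs (v x) <= B) -> HS (fun x => v x * m x).
Proof.
move=> m1 m0 mv vB; have [_ _] := hs_mult_bounded mv vB; apply => //.
move=> e e0; exists 0, 0; split => // p M k pM _.
by rewrite m0 cabs0 mul0r addr0 mulr_ge0 ?(ltW e0)// (bnd_ge0 ler01 pM).
Qed.

End borel_multipliers.

Lemma Rintegral_lin3 dd (T : measurableType dd) (R : realType)
    (tau : {finite_measure set T -> \bar R}) (a b c : R) (f g h : T -> R) :
  tau.-integrable setT (EFin \o f) -> tau.-integrable setT (EFin \o g) ->
  tau.-integrable setT (EFin \o h) ->
  \int[tau]_x (a * f x + b * g x + c * h x) =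
  a * \int[tau]_x f x + b * \int[tau]_x g x + c * \int[tau]_x h x.
Proof.
move=> fi gi hi.
have Zi (r : R) (k : T -> R) : tau.-integrable setT (EFin \o k) ->
    tau.-integrable setT (EFin \o (fun x => r * k x)).
  by move=> ki; have := integrableZl measurableT r ki; apply: eq_integrable.
have Di (k l : T -> R) : tau.-integrable setT (EFin \o k) ->
    tau.-integrable setT (EFin \o l) ->
    tau.-integrable setT (EFin \o (fun x => k x + l x)).
  by move=> ki li; have := integrableD measurableT ki li; apply: eq_integrable.
have af := Zi a f fi; have bg := Zi b g gi; have ch := Zi c h hi.
rewrite (RintegralD measurableT (Di _ _ af bg) ch).
rewrite (RintegralD measurableT af bg).
by rewrite (RintegralZl a measurableT fi) (RintegralZl b measurableT gi)
  (RintegralZl c measurableT hi).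
Qed.

(** For two consecutive near-minimizers, [Y] is their squared distance and [I] the infimum: $Y \le
    2e_1 + 2e_0 \le 4e_0 = t^2 W_1$, and both summands of the conclusion are at most $tW_1/2$. *)
Lemma minimizing_increment (R : realType) (Y e1 e0 q1 q0 I t W1 W : R) :
  0 < t -> e1 <= e0 -> q1 < I + e1 -> q0 < I + e0 -> Y <= 2 * q1 + 2 * q0 - 4 * I ->
  e0 = t * (t * W1) / 4 -> W <= W1 -> (2 * t)^-1 * Y + t / 2 * W <= t * W1.
Proof.
move=> t0 e10 qe1 qe0 dY eE WW.
have YY : Y <= t * (t * W1) by lra.
have t20 : 0 < 2 * t by rewrite mulr_gt0.
have : (2 * t)^-1 * Y <= t * W1 / 2 by rewrite mulrC (ler_pdivrMr _ _ t20); lra.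
have : t / 2 * W <= t / 2 * W1 by rewrite ler_wpM2l// divr_ge0// ltW.
lra.
Qed.

(** First variation at a near-minimizer with value [q]: [y] is the squared modulus of the inner
    product of the residual with a direction of squared norm [P]. A step with $sP \le 1$ lowers [q]
    by at least $sy$, which cannot exceed $q - I$. *)
Lemma variation_bound (R : realType) (s y P I e q : R) :
  0 <= s -> 0 <= y -> s * P <= 1 -> I <= q + 2 * - (s * y) + s ^+ 2 * y * P ->
  q < I + e -> s * y <= e.
Proof.
move=> s0 y0 sP hI qe; have : s * y * (s * P) <= s * y * 1.
  by rewrite ler_wpM2l// mulr_ge0.
move: hI; rewrite (_ : s ^+ 2 * y * P = s * y * (s * P)); [lra|ring].
Qed.

(** * The band property for an abstract norm dominating the supremum norm *)

Section band.
Variables (R : realType) (d : nat).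
Local Notation C := R[i].
Local Notation S := (usphere R d).
Local Notation T := (bsphere R d).
Local Notation mp := (mpoly d.+1 C).
Variable tau : {finite_measure set T -> \bar R}.
Local Notation L1 := (L1 tau).
Local Notation cI := (cI tau).
Local Notation N1 := (N1 tau).
Local Notation HS := (henkin_density tau (@supnb R d)).
Implicit Types (u v : T -> C) (p q : mp).

(** [Nb p M] stands for an upper bound [M] of the multiplier norm. The band argument uses only that
    it dominates the supremum norm and that multiplication by a fixed polynomial is bounded; no
    Hilbert space occurs here. *)
Variable Nb : mp -> R -> Prop.
Hypothesis Nb_bnd : forall p M, Nb p M -> bnd p 1 M.
Hypothesis Nb_mul : forall q, exists2 K : R, 0 <= K &
  forall p M, Nb p M -> Nb (q * p) (K * M).
Local Notation HN := (henkin_density tau Nb).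

Lemma HS_HN u : HS u -> HN u.
Proof.
move=> uS e e0; have [s [K [s0 s1 K0 h]]] := uS e e0.
by exists s, K; split => // p M m pM; apply: h; exact: Nb_bnd.
Qed.

Lemma HN_poly q u : HN u -> HN (fun x => ps q x * u x).
Proof.
move=> uH e e0; have [K K0 qK] := Nb_mul q; have [B B0 qB] := bnd_exists q.
have K1 : 0 < K + 1 by rewrite ltr_wpDl.
have eK : 0 < e / (K + 1) by rewrite divr_gt0.
have [s [L [s0 s1 L0 h]]] := uH _ eK.
exists s, (L * B); split => //; first by rewrite mulr_ge0.
move=> p M m pM pm.
have -> : (fun x : T => ps q x * u x * ps p x) = (fun x => u x * ps (q * p) x).
  by apply/funext => x; rewrite /ps pevM; ring.
have M0 : 0 <= M := bnd_ge0 ler01 (Nb_bnd pM).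
apply: (le_trans (h _ _ (B * m) (qK _ _ pM) _)).
  by apply: bndM => //; apply: bnd_le qB => //; exact: ltW.
rewrite [L * _]mulrA lerD2r [_ * (K * M)]mulrA ler_wpM2r// mulrAC ler_pdivrMr//.
by rewrite ler_wpM2l ?lerDl// ltW.
Qed.

Variable theta : T -> C.
Hypothesis theta1 : L1 theta.
Hypothesis thetaH : HN theta.

Let W (x : T) : R := cabs (theta x).

Let W0 x : 0 <= W x. Proof. exact: cabs_ge0. Qed.

Let sqi (w : T -> C) (B : R) : cmeas w -> (forall x, cabs (w x) <= B) ->
  tau.-integrable setT (EFin \o (fun x => cabs (w x) ^+ 2 * W x)).
Proof.
move=> mw wB; have [_ iw] := theta1.
have := integrableZl measurableT (B ^+ 2) iw; apply: le_integrable => //.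
  apply/measurable_EFinP; apply: measurable_funM; last by apply: measurable_cabs; have [] := theta1.
  by apply: measurable_funX; exact: measurable_cabs.
move=> x _ /=; have w0 := cabs_ge0 (w x); have h := wB x.
have h2 : cabs (w x) ^+ 2 <= B ^+ 2 by nra.
rewrite lee_fin [leLHS]ger0_norm ?mulr_ge0 ?sqr_ge0//.
apply: le_trans (ler_norm _); exact: ler_wpM2r.
Qed.

Let Q (w : T -> C) : R := \int[tau]_x (cabs (w x) ^+ 2 * W x).

Let Q_ge0 w : 0 <= Q w.
Proof. by apply: Rintegral_ge0 => x _; rewrite mulr_ge0 ?sqr_ge0. Qed.

(** The phase of [theta], set to 1 on its zeros so as to be unimodular everywhere and undone by its
    conjugate. *)
Let sgn (x : T) : C := if theta x == 0 then 1 else theta x / (W x)%:C.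

Let sgnE x : (theta x)^*%C * sgn x = (W x)%:C.
Proof.
rewrite /sgn /W; have [->|t0] := eqVneq (theta x) 0; first by rewrite conjc0 mul0r cabs0.
rewrite mulrA [_^*%C * _]mulrC -cabs_mulJ -fmorphV -rmorphM; congr (_%:C).
by rewrite expr2 mulfK// cabs_eq0.
Qed.

Let sgn_abs x : cabs (sgn x) = 1.
Proof.
rewrite /sgn /W; case: eqVneq => [_|t0]; first exact: cabs1.
by rewrite cabsM cabsV cabs_real ger0_norm ?cabs_ge0// divff// cabs_eq0.
Qed.

Let cmeas_sgn : cmeas sgn.
Proof.
have [mt _] := theta1.
have mZ : measurable [set x | theta x = 0].
  have mc := measurable_cabs mt.
  have := mc measurableT _ (measurable_itv `]-oo, (0 : R)]).
  rewrite setTI; congr measurable; apply/seteqP; split=> x /=; rewrite in_itv/=.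
    by move=> h; apply/eqP; rewrite -cabs_eq0 eq_le h cabs_ge0.
  by move=> ->; rewrite cabs0.
have -> : sgn = (fun x => cindic R [set x | theta x = 0] x + theta x * ((W x)^-1)%:C).
  apply/funext => x; rewrite /sgn /W /cindic indicE.
  have [t0|t0] := eqVneq (theta x) 0.
    by rewrite mem_set// t0 mul0r addr0.
  by rewrite memNset ?add0r ?fmorphV//; exact/eqP.
apply: cmeasD; first exact: cmeas_cindic.
apply: cmeasM => //; apply: cmeas_real; apply: measurable_inv; exact: measurable_cabs.
Qed.

Lemma HN_bounded_mul v (B : R) : cmeas v -> (forall x, cabs (v x) <= B) ->
  HN (fun x => v x * theta x).
Proof.
move=> mv vB; have [mt it] := theta1.
have wb p : exists B' : R, forall x, cabs (v x - ps p x) <= B'.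
  have [K K0 pK] := bnd_exists p; exists (B + K) => x.
  by apply: (le_trans (cabsB _ _)); apply: lerD => //; exact: ps_bound.
have mw p : cmeas (fun x => v x - ps p x) by apply: cmeasB => //; exact: cmeas_ps.
have iQ p : tau.-integrable setT (EFin \o (fun x => cabs (v x - ps p x) ^+ 2 * W x)).
  by have [B' hB'] := wb p; exact: sqi (mw p) hB'.
have iP p : tau.-integrable setT (EFin \o (fun x => cabs (ps p x) ^+ 2 * W x)).
  by have [K K0 pK] := bnd_exists p; apply: (sqi (B := K)) => [|x]; [exact: cmeas_ps|exact: ps_bound].
have Rint_le (f g : T -> R) : tau.-integrable setT (EFin \o f) ->
    tau.-integrable setT (EFin \o g) -> (forall x, f x <= g x) ->
    \int[tau]_x f x <= \int[tau]_x g x.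
  by move=> fi gi fg; apply: le_Rintegral.
pose QP p := Q (fun x => v x - ps p x).
pose A := [set QP p | p in setT].
have infA : has_inf A.
  by split; [exists (QP 0), 0|exists 0 => _ [p _ <-]; exact: Q_ge0].
pose I := inf A.
have QI p : I <= QP p by apply: ge_inf; [by have [] := infA|exists p].
pose W1 := N1 theta + 1; have W10 : 0 < W1 by rewrite ltr_wpDl// N1_ge0.
(* The parallelogram law gives squared distance at most $4\,eps_k = 4^{-k}/W_1$ between consecutive
   near-minimizers. As the weight has mass at most $W_1$, the $L^1$ distance is at most $2^{-k}$,
   the rate that [L1_complete] expects. *)
pose eps (k : nat) : R := (1 / 4) ^+ k / (4 * W1).
have eps0 k : 0 < eps k by rewrite divr_gt0 ?mulr_gt0// exprn_gt0//; lra.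
have /choice[P PI] : forall k, exists p, QP p < I + eps k.
  move=> k; have [_ [p _ <-] h] := inf_adherent (eps0 k) infA.
  by exists p.
(* Parallelogram law: the midpoint of two polynomials is a polynomial, so its value is at least
   [I]. *)
have diff p q : \int[tau]_x (cabs (ps p x - ps q x) ^+ 2 * W x) <=
    2 * QP p + 2 * QP q - 4 * I.
  have := QI ((1 / 2)%:C *: (p + q)).
  suff -> : \int[tau]_x (cabs (ps p x - ps q x) ^+ 2 * W x) =
    2 * QP p + 2 * QP q - 4 * QP ((1 / 2)%:C *: (p + q)).
    move: (QP p) (QP q) (QP _) => a b c Ic; rewrite lerB// ler_wpM2l//.
  have := Rintegral_lin3 2 2 (- 4) (iQ p) (iQ q) (iQ ((1 / 2)%:C *: (p + q))).
  rewrite mulNr => <-; apply: eq_Rintegral => x _.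
  rewrite /ps pevZ pevD !cabs_sqr; move: (pev p _) (pev q _) (v x) (W x) => a b c w.
  case: a b c => a1 a2 [b1 b2] [c1 c2] /=; lra.
have Zi (r : R) (f : T -> R) : tau.-integrable setT (EFin \o f) ->
    tau.-integrable setT (EFin \o (fun x => r * f x)).
  by move=> fi; have := integrableZl measurableT r fi; apply: eq_integrable.
have Di (f g : T -> R) : tau.-integrable setT (EFin \o f) ->
    tau.-integrable setT (EFin \o g) ->
    tau.-integrable setT (EFin \o (fun x => f x + g x)).
  by move=> fi gi; have := integrableD measurableT fi gi; apply: eq_integrable.
pose h k (x : T) : C := theta x * ps (P k) x.
have h1 k : L1 (h k) by exact: L1_ps.
have fast k : N1 (fun x => h k.+1 x - h k x) <= (1 / 2) ^+ k.
  pose t : R := (1 / 2) ^+ k / W1; have t0 : 0 < t.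
    by rewrite divr_gt0// exprn_gt0//; lra.
  have tW : t * W1 = (1 / 2) ^+ k by rewrite /t divfK// gt_eqF.
  have epsE : eps k = t * (t * W1) / 4.
    rewrite tW /t /eps (_ : (1 / 4 : R) ^+ k = (1 / 2) ^+ k * (1 / 2) ^+ k).
      by field; rewrite gt_eqF.
    by rewrite -exprMn; congr (_ ^+ _); lra.
  have ipp : tau.-integrable setT (EFin \o (fun x => cabs (ps (P k.+1) x - ps (P k) x) ^+ 2 * W x)).
    have := iP (P k.+1 - P k); apply: eq_integrable => // x _ /=.
    by rewrite /ps pevD pevN.
  (* The pointwise inequality $a \le a^2/(2t) + t/2$, integrated against the weight, takes the place
     of Cauchy-Schwarz. *)
  pose g x := (2 * t)^-1 * (cabs (ps (P k.+1) x - ps (P k) x) ^+ 2 * W x) + t / 2 * W x.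
  have ig : tau.-integrable setT (EFin \o g) by apply: Di; exact: Zi.
  apply: (@le_trans _ _ (\int[tau]_x g x)).
    apply: Rint_le => //; first by have [] := L1B (h1 k.+1) (h1 k).
    move=> x; rewrite /h -mulrBr cabsM /g -/(W x).
    move: (cabs (ps _ x - ps _ x)) (W x) (W0 x) => a w w0.
    have key : a <= (2 * t)^-1 * a ^+ 2 + t / 2.
      have -> : (2 * t)^-1 * a ^+ 2 + t / 2 = (a ^+ 2 + t ^+ 2) / (2 * t).
        by field; rewrite gt_eqF.
      have tt2 : 0 < 2 * t by rewrite mulr_gt0.
      rewrite (ler_pdivlMr _ _ tt2); have := sqr_ge0 (a - t).
      by rewrite sqrrB mulr2n; move: (t) => t'; lra.
    by have := ler_wpM2l w0 key; lra.
  have := Rintegral_lin3 (2 * t)^-1 (t / 2) 0 ipp it it.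
  rewrite mul0r addr0 (_ : \int[tau]_x _ = \int[tau]_x g x); last first.
    by apply: eq_Rintegral => x _; rewrite mul0r addr0.
  move=> ->; rewrite -tW.
  apply: (minimizing_increment t0 _ (PI k.+1) (PI k) (diff (P k.+1) (P k)) epsE).
    rewrite /eps ler_wpM2r ?invr_ge0 ?mulr_ge0 ?(ltW W10)// exprS.
    by rewrite ler_piMl ?exprn_ge0// ler_pdivrMr// mul1r ler1n.
  by rewrite /W1 lerDl.
have [u u1 uh] := L1_complete h1 fast.
have hH k : HN (h k).
  by rewrite /h; under eq_fun do rewrite mulrC; exact: HN_poly.
have uH : HN u.
  apply: henkin_density_lim => // e /uh[k kP]; exists (h k); split => //.
  exact: (kP k (leqnn k)).
pose r x := v x * theta x - u x.
have vt1 : L1 (fun x => v x * theta x) by exact: (L1M mv vB).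
have r1 : L1 r by exact: L1B.
(* By [sgnE], $\bar\theta$ times the phase is $|\theta|$, so [m] is the $L^1$ limit of $\overline{(v
   - P_k)}\,|\theta|$. *)
pose m x := (r x)^*%C * sgn x.
have m1 : L1 m.
  rewrite /m; under eq_fun do rewrite mulrC.
  by apply: (L1M cmeas_sgn (B := 1)) => [x|]; [rewrite sgn_abs|exact: L1J].
have m0 p : cI (fun x => m x * ps p x) = 0.
  have [K K0 pK] := bnd_exists p.
  (* The inner product of [p] with the residual of $P_k$. It approximates the integral of $mp$
     because $\theta P_k$ converges to [u] in $L^1$, and it tends to 0 because $P_k$ is nearly
     minimizing. *)
  pose Ik k := cI (fun x => (v x - ps (P k) x)^*%C * (W x)%:C * ps p x).
  have W1c : L1 (fun x => (W x)%:C).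
    split; first by apply: cmeas_real; exact: measurable_cabs.
    by apply: eq_integrable it => // x _ /=; rewrite cabs_real ger0_norm.
  have vW1 k : L1 (fun x => (v x - ps (P k) x)^*%C * (W x)%:C).
    have [B' hB'] := wb (P k); apply: (L1M (B := B')) => //; first exact: cmeasJ.
    by move=> x; rewrite cabsJ.
  have near k : cabs (cI (fun x => m x * ps p x) - Ik k) <=
      2 * (K * N1 (fun x => h k x - u x)).
    rewrite /Ik -cIB; [|exact: L1_ps..].
    have -> : (fun x => m x * ps p x - (v x - ps (P k) x)^*%C * (W x)%:C * ps p x) =
        (fun x => (h k x - u x)^*%C * sgn x * ps p x).
      apply/funext => x; rewrite -mulrBl; congr (_ * _); rewrite -sgnE /m /r /h.
      by rewrite !(rmorphB, rmorphM)/=; ring.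
    have hus1 : L1 (fun x => (h k x - u x)^*%C * sgn x).
      under eq_fun do rewrite mulrC; apply: (L1M cmeas_sgn (B := 1)) => [x|].
        by rewrite sgn_abs.
      by apply: L1J; exact: L1B.
    apply: (le_trans (cI_ps_le hus1 pK)); rewrite ler_wpM2l// ler_wpM2l//.
    rewrite -[leRHS]mul1r; apply: N1_le => //; first exact: L1B.
    by move=> x; rewrite cabsM sgn_abs mulr1 cabsJ mul1r.
  pose PP := \int[tau]_x (cabs (ps p x) ^+ 2 * W x).
  have PP0 : 0 <= PP by apply: Rintegral_ge0 => x _; rewrite mulr_ge0 ?sqr_ge0.
  have small k : cabs (Ik k) ^+ 2 <= eps k * (PP + 1).
    pose s := (PP + 1)^-1; have PP1 : 0 < PP + 1 by rewrite ltr_wpDl.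
    have s0 : 0 < s by rewrite invr_gt0.
    (* The conjugate makes the first-order term real and negative; $s = 1/(PP+1)$ ensures $s \cdot
       PP \le 1$ without assuming $PP \ne 0$. *)
    pose c := - (s%:C * (Ik k)^*%C).
    have := QI (P k - c *: p).
    have -> : QP (P k - c *: p) = QP (P k) + 2 * complex.Re (c * Ik k) + cabs c ^+ 2 * PP.
      have ic : L1 (fun x => (v x - ps (P k) x)^*%C * (W x)%:C * ps p x) by exact: L1_ps.
      rewrite /Ik -cIZ// -[complex.Re _]/(\int[tau]_x _) -[QP (P k)]mul1r.
      have := Rintegral_lin3 1 2 (cabs c ^+ 2) (iQ (P k)) (L1_Re (L1Z c ic)) (iP p).
      move=> <-; apply: eq_Rintegral => x _; rewrite /ps pevD pevN pevZ.
      move: (pev p _) (pev (P k) _) (v x) (W x) c => a b y w c'.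
      by rewrite !cabs_sqr; case: a b y c' => a1 a2 [b1 b2] [y1 y2] [e1 e2] /=; ring.
    have -> : complex.Re (c * Ik k) = - (s * cabs (Ik k) ^+ 2).
      by rewrite /c mulNr cReN -mulrA [_^*%C * _]mulrC -cabs_mulJ -rmorphM.
    have -> : cabs c ^+ 2 = s ^+ 2 * cabs (Ik k) ^+ 2.
      by rewrite /c cabsN cabsM cabsJ cabs_real ger0_norm ?(ltW s0)// exprMn.
    move: (cabs (Ik k) ^+ 2) (sqr_ge0 (cabs (Ik k))) => y y0 hI.
    rewrite -ler_pdivrMr// mulrC -/s.
    have sP : s * PP <= 1 by rewrite /s mulrC ler_pdivrMr// mul1r lerDl.
    exact: (variation_bound (ltW s0) y0 sP hI (PI k)).
  apply/eqP; rewrite -cabs_eq0 eq_le cabs_ge0 andbT.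
  apply/ler_addgt0Pr => e e0; rewrite add0r.
  have e40 : 0 < e / (4 * (K + 1)) by rewrite divr_gt0// mulr_gt0// ltr_wpDl.
  have [k0 kP] := uh _ e40.
  have [k1 kP1] : exists k1, forall k, (k1 <= k)%N -> eps k * (PP + 1) < (e / 2) ^+ 2.
    have c0 : (fun k => eps k * (PP + 1)) @ \oo --> (0 : R).
      have -> : (fun k => eps k * (PP + 1)) = (fun k => (PP + 1) / (4 * W1) * (1 / 4) ^+ k).
        by apply/funext => k; rewrite /eps; field; rewrite gt_eqF.
      rewrite -[0](mulr0 ((PP + 1) / (4 * W1))); apply: cvgM; first exact: cvg_cst.
      by apply: cvg_expr; rewrite ger0_norm; lra.
    have e2 : 0 < (e / 2) ^+ 2 by rewrite exprn_gt0// divr_gt0.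
    move: c0 => /cvgrPdist_lt/(_ _ e2)[k1 _ k1P]; exists k1 => k /k1P.
    by rewrite /= sub0r normrN ger0_norm// mulr_ge0 ?(ltW (eps0 k))// addr_ge0.
  pose k := maxn k0 k1.
  have a1 := near k; have a2 := kP k (leq_maxl _ _).
  have a3 : cabs (Ik k) <= e / 2.
    rewrite -(@ler_pXn2r _ 2) ?nnegrE ?cabs_ge0 ?divr_ge0 ?(ltW e0)//.
    by apply: (le_trans (small k)); apply: ltW; apply: kP1; exact: leq_maxr.
  rewrite -[cI _](subrK (Ik k)); apply: (le_trans (cabsD _ _)).
  have a4 : K * N1 (fun x => h k x - u x) <= e / 4.
    have : (K + 1) * N1 (fun x => h k x - u x) <= e / 4.
      rewrite mulrC -ler_pdivlMr ?ltr_wpDl//; apply: (le_trans (ltW a2)).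
      by rewrite invfM mulrA.
    by apply: le_trans; rewrite ler_wpM2r ?N1_ge0// lerDl.
  lra.
have rH : HN r.
  (* The factor with $r = bm$; where $r = 0$ division by zero gives $b = 0$, and the identity still
     holds. *)
  pose b x := (r x / (r x)^*%C) * (sgn x)^*%C.
  have mr : cmeas r by have [] := r1.
  have mb : cmeas b.
    apply: cmeasM; last exact: cmeasJ.
    by apply: cmeasM => //; apply: cmeasV; exact: cmeasJ.
  have b1 x : cabs (b x) <= 1.
    rewrite /b !cabsM cabsV !cabsJ sgn_abs mulr1.
    by have [->|r0] := eqVneq (cabs (r x)) 0; rewrite ?mul0r// divff.
  have -> : r = (fun x => b x * m x).
    apply/funext => x; rewrite /b /m; have [->|r0] := eqVneq (r x) 0.
      by rewrite !mul0r.
    have -> : r x / (r x)^*%C * (sgn x)^*%C * ((r x)^*%C * sgn x) =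
        r x * ((r x)^*%C / (r x)^*%C) * (sgn x * (sgn x)^*%C) by ring.
    by rewrite -cabs_mulJ sgn_abs expr1n mulr1 divff ?mulr1// conjc_eq0.
  by apply: HS_HN; exact: (annihilator_henkin m1 m0 mb b1).
have -> : (fun x => v x * theta x) = (fun x => u x + r x).
  by apply/funext => x; rewrite /r addrC subrK.
exact: henkin_densityD.
Qed.

Lemma measurable_ge0 (f : T -> R) : measurable_fun setT f ->
  measurable [set x | 0 <= f x].
Proof.
move=> mf; have := mf measurableT _ (measurable_itv `[(0 : R), +oo[).
by rewrite setTI; congr measurable; apply/seteqP; split=> x /=; rewrite in_itv/= andbT.
Qed.

(** On $\{|g| \le k|\theta|\}$ the quotient $g/\theta$ is bounded by $k$, so [HN_bounded_mul]
    applies to the truncation [w k]. The products $w_k\theta$ are dominated by $|g|$ and tend to $g$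
    off the zeros of $\theta$, where by hypothesis all of $g$ lives up to a null set. *)
Lemma henkin_density_band g : L1 g ->
  N1 (fun x => cindic R [set x | theta x = 0] x * g x) = 0 -> HN g.
Proof.
move=> g1 g0; have [mt it] := theta1; have [mg ig] := g1.
pose Z := [set x : T | theta x = 0].
pose A k := [set x : T | 0 <= k%:R * cabs (theta x) - cabs (g x)].
have mA k : measurable (A k).
  apply: measurable_ge0; apply: measurable_funB; last exact: measurable_cabs.
  by apply: measurable_funM => //; exact: measurable_cabs.
pose w k x := cindic R (A k) x * (g x / theta x).
have mw k : cmeas (w k).
  apply: cmeasM; first exact: cmeas_cindic.
  by apply: cmeasM => //; exact: cmeasV.
have wk k x : cabs (w k x) <= k%:R.
  rewrite /w /cindic indicE; have [Ax|nAx] := pselect (A k x); last first.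
    by rewrite memNset// mul0r cabs0.
  rewrite mem_set// mul1r cabsM cabsV.
  have [t0|t0] := eqVneq (cabs (theta x)) 0; first by rewrite t0 invr0 mulr0.
  rewrite ler_pdivrMr ?lt_neqAle ?cabs_ge0 1?eq_sym ?t0//.
  by move: Ax; rewrite /A /= subr_ge0.
pose g' x := if theta x == 0 then 0 else g x.
have [g'1 lim] : L1 g' /\ forall e, 0 < e -> exists k,
    N1 (fun x => w k x * theta x - g' x) < e.
  apply: (@N1_dominated _ _ _ _ (fun k x => w k x * theta x) g' (fun x => cabs (g x))) => //.
  - by move=> k; exact: cmeasM.
  - move=> k x; rewrite /w; have [t0|t0] := eqVneq (theta x) 0.
      by rewrite t0 mulr0 cabs0 cabs_ge0.
    by rewrite -mulrA divfK// cabsM ler_piMl ?cabs_ge0// cabs_cindic.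
  - move=> x; rewrite /g' /w; have [t0|t0] := eqVneq (theta x) 0.
      by rewrite t0; under eq_fun do rewrite mulr0 subrr cabs0; exact: cvg_cst.
    have t0' : 0 < cabs (theta x) by rewrite lt_neqAle cabs_ge0 eq_sym cabs_eq0 t0.
    apply: cvg_near_cst; exists (Num.truncn (cabs (g x) / cabs (theta x))).+1 => // k /= kg.
    have Ax : A k x.
      rewrite /A /= subr_ge0 -ler_pdivrMr//; apply/ltW/(lt_le_trans (truncnS_gt _)).
      by rewrite ler_nat.
    by rewrite /cindic indicE mem_set// mul1r divfK// subrr cabs0.
apply: henkin_density_lim => // e /lim[k ke].
exists (fun x => w k x * theta x); split.
- exact: (L1M (mw k) (wk k)).
- exact: HN_bounded_mul (mw k) (wk k).
have wt1 := L1M (mw k) (wk k) theta1.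
apply: le_lt_trans ke.
have -> : (fun x => w k x * theta x - g x) =
    (fun x => (w k x * theta x - g' x) + (- (cindic R Z x * g x))).
  apply/funext => x; rewrite /g' /cindic indicE; have [t0|/eqP t0] := eqVneq (theta x) 0.
    by rewrite mem_set// mul1r subr0.
  by rewrite memNset// mul0r subr0.
have mZ : measurable Z.
  have := @measurable_ge0 (fun x => - cabs (theta x)).
  have -> : [set x | 0 <= - cabs (theta x)] = Z.
    apply/seteqP; split=> x; rewrite /Z /= ?oppr_ge0; last by move=> ->; rewrite cabs0.
    by move=> h; apply/eqP; rewrite -cabs_eq0 eq_le h cabs_ge0.
  by apply; apply: measurable_funN; exact: measurable_cabs.
have zg1 : L1 (fun x => cindic R Z x * g x).
  by apply: (L1M (B := 1)) => //; [exact: cmeas_cindic|move=> x; exact: cabs_cindic].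
apply: (le_trans (N1D (L1B wt1 g'1) (L1N zg1))).
rewrite gerDl; apply: le_trans (_ : 1 * N1 (fun x => cindic R Z x * g x) <= 0).
  by apply: N1_le => //; [exact: L1N|move=> x; rewrite cabsN mul1r].
by rewrite g0 mulr0.
Qed.

End band.

(** * Hilbert space geometry *)

Section hilbert.
Variables (R : realType) (X : Type) (H : rkhs R X).
Local Notation C := R[i].
Implicit Types (f g h : H) (a : C).

Definition dt f g : C := rkhs_dot H f g.
Definition hn f : R := complex.Re `|f|.

Lemma hnE f : `|f| = (hn f)%:C.
Proof. by rewrite /hn RRe_real// ger0_real. Qed.

Lemma hn_ge0 f : 0 <= hn f. Proof. by rewrite -ler0c -hnE normr_ge0. Qed.
Lemma hn0 : hn 0 = 0. Proof. by rewrite /hn normr0. Qed.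
Lemma hnN f : hn (- f) = hn f. Proof. by rewrite /hn normrN. Qed.
Lemma hnC f g : hn (f - g) = hn (g - f). Proof. by rewrite -hnN opprB. Qed.
Lemma hn_eq0 f : (hn f == 0) = (f == 0).
Proof. by rewrite -[RHS]normr_eq0 hnE -(inj_eq (@complexI R)). Qed.
Lemma hnD f g : hn (f + g) <= hn f + hn g.
Proof. by rewrite -lecR rmorphD/= -!hnE ler_normD. Qed.
Lemma hnZ a f : hn (a *: f) = cabs a * hn f.
Proof. by apply: complexI; rewrite rmorphM/= -!hnE normrZ cabsE. Qed.
Lemma hn_dist f g h : hn (f - h) <= hn (f - g) + hn (g - h).
Proof. by rewrite -[f - h](subrKA g); exact: hnD. Qed.

Lemma dtC f g : dt f g = (dt g f)^*%C.
Proof. by rewrite /dt hermC expr0 mul1r. Qed.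
Lemma dtDl f g h : dt (f + g) h = dt f h + dt g h.
Proof. exact: linearDl. Qed.
Lemma dtZl a f h : dt (a *: f) h = a * dt f h.
Proof. exact: linearZl_LR. Qed.
Lemma dtDr f g h : dt h (f + g) = dt h f + dt h g.
Proof. exact: linearDr. Qed.
Lemma dtZr a f h : dt h (a *: f) = a^*%C * dt h f.
Proof. by rewrite dtC dtZl rmorphM/= -dtC. Qed.
Lemma dtNl f h : dt (- f) h = - dt f h. Proof. exact: linearNl. Qed.
Lemma dtNr f h : dt h (- f) = - dt h f. Proof. exact: linearNr. Qed.
Lemma dtBl f g h : dt (f - g) h = dt f h - dt g h.
Proof. by rewrite dtDl dtNl. Qed.
Lemma dt0l h : dt 0 h = 0. Proof. exact: linear0l. Qed.
Lemma dt0r h : dt h 0 = 0. Proof. exact: linear0r. Qed.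
Lemma dt_suml (I : Type) (r : seq I) (P : pred I) (F : I -> H) h :
  dt (\sum_(i <- r | P i) F i) h = \sum_(i <- r | P i) dt (F i) h.
Proof. by apply: (big_morph (dt^~ h)) => [f g|]; [exact: dtDl|exact: dt0l]. Qed.
Lemma dt_sumr (I : Type) (r : seq I) (P : pred I) (F : I -> H) h :
  dt h (\sum_(i <- r | P i) F i) = \sum_(i <- r | P i) dt h (F i).
Proof. by apply: (big_morph (dt h)) => [f g|]; [exact: dtDr|exact: dt0r]. Qed.

Lemma dt_sqr f : dt f f = (hn f ^+ 2)%:C.
Proof. by rewrite /dt -rkhs_normE hnE rmorphXn. Qed.

Lemma hn_sqrD f g : hn (f + g) ^+ 2 = hn f ^+ 2 + hn g ^+ 2 + 2 * complex.Re (dt f g).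
Proof.
have sq h : hn h ^+ 2 = complex.Re (dt h h) by rewrite dt_sqr.
by rewrite !sq dtDl !dtDr (dtC g f) !cReD cReJ; ring.
Qed.

Lemma hn_sqrB f g : hn (f - g) ^+ 2 = hn f ^+ 2 + hn g ^+ 2 - 2 * complex.Re (dt f g).
Proof. by rewrite hn_sqrD hnN dtNr cReN mulrN. Qed.

Lemma dt_le f g : cabs (dt f g) <= hn f * hn g.
Proof.
have [->|g0] := eqVneq g 0; first by rewrite dt0r cabs0 hn0 mulr0.
have g0' : 0 < hn g by rewrite lt_neqAle hn_ge0 eq_sym hn_eq0 g0.
have g20 : 0 < hn g ^+ 2 by rewrite exprn_gt0.
rewrite -(@ler_pXn2r _ 2) ?nnegrE ?cabs_ge0 ?mulr_ge0 ?hn_ge0//.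
pose t := (hn g ^+ 2)^-1; have t0 : 0 <= t by rewrite invr_ge0 ltW.
pose c : C := t%:C * dt f g.
have := sqr_ge0 (hn (f - c *: g)).
rewrite hn_sqrB hnZ exprMn dtZr.
have -> : complex.Re (c^*%C * dt f g) = t * cabs (dt f g) ^+ 2.
  by rewrite /c rmorphM/= -mulrA [_^*%C * _]mulrC -cabs_mulJ cReM/=; ring.
have -> : cabs c ^+ 2 * hn g ^+ 2 = t * cabs (dt f g) ^+ 2.
  rewrite /c cabsM cabs_real ger0_norm// exprMn.
  have tg : t * hn g ^+ 2 = 1 by rewrite mulVf// gt_eqF.
  by rewrite -[RHS]mulr1 -tg; ring.
rewrite exprMn -ler_pdivrMr// -/t; lra.
Qed.

Lemma complete_seq (F : nat -> H) :
  (forall e : R, 0 < e -> exists N, forall k l, (N <= k)%N -> (N <= l)%N ->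
    hn (F k - F l) < e) ->
  exists g, forall e : R, 0 < e -> exists N, forall k, (N <= k)%N -> hn (F k - g) < e.
Proof.
move=> cF.
have pos (e : C) : 0 < e -> e = (complex.Re e)%:C /\ 0 < complex.Re e.
  by case: e => x y; rewrite ltcE /= => /andP[/eqP -> ->].
have cv : cvgn F.
  apply: cauchy_cvg; apply: cauchy_exP => e e0; have [eE e0'] := pos _ e0.
  have [N NP] := cF _ e0'; exists (F N); exists N => // k /= Nk.
  by rewrite -ball_normE /= hnE eE ltcR; apply: NP.
exists (limn F) => e e0.
have e0' : 0 < e%:C by rewrite ltcR.
have /cvgrPdist_lt/(_ _ e0')[N _ NP] := cv.
by exists N => k /NP; rewrite hnE ltcR hnC.
Qed.

(** Near-minimizers of the distance from [f] to [D] are Cauchy by the parallelogram law. By first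
    variation [f] minus their limit is orthogonal to [D], hence 0, so the near-minimizers themselves
    approximate [f]. *)
Lemma total_dense (D : H -> Prop) : D 0 -> (forall a f g, D f -> D g -> D (a *: f + g)) ->
  (forall f, (forall g, D g -> dt f g = 0) -> f = 0) ->
  forall f (e : R), 0 < e -> exists2 g, D g & hn (f - g) < e.
Proof.
move=> D0 Dlin Dtot f e e0.
pose A := [set hn (f - g) ^+ 2 | g in [set g | D g]].
have infA : has_inf A.
  by split; [exists (hn (f - 0) ^+ 2), 0|exists 0 => _ [g _ <-]; exact: sqr_ge0].
pose I := inf A.
have AI g : D g -> I <= hn (f - g) ^+ 2.
  by move=> Dg; apply: ge_inf; [by have [] := infA|exists g].
have /choice[G GP] : forall k : nat, exists g, D g /\ hn (f - g) ^+ 2 < I + k.+1%:R^-1.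
  move=> k; have k0 : (0 : R) < k.+1%:R^-1 by rewrite invr_gt0.
  by have [_ [g Dg <-] h] := inf_adherent k0 infA; exists g.
have DG k : D (G k) by have [] := GP k.
have lim0 (s : R) : 0 < s -> exists N, forall k, (N <= k)%N -> k.+1%:R^-1 < s.
  move=> s0; have /cvgrPdist_lt/(_ _ s0)[N _ NP] := @cvg_harmonic R.
  by exists N => k /NP; rewrite /= sub0r normrN ger0_norm.
have par k l : hn (G k - G l) ^+ 2 <= 2 * k.+1%:R^-1 + 2 * l.+1%:R^-1.
  pose a := f - G k; pose b := f - G l.
  have := AI _ (Dlin (1 / 2)%:C _ _ (Dlin 1 _ _ (DG k) (DG l)) D0).
  rewrite addr0 scale1r.
  have -> : f - (1 / 2)%:C *: (G k + G l) = (1 / 2)%:C *: (a + b).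
    rewrite /a /b addrACA -opprD scalerBr; congr (_ - _).
    by rewrite scalerDr -scalerDl -rmorphD -splitr scale1r.
  rewrite hnZ cabs_real exprMn (hn_sqrD a b) ger0_norm//.
  have -> : G k - G l = b - a by rewrite /a /b opprB [RHS]addrC subrKA.
  rewrite (hn_sqrB b a) (dtC b a) cReJ.
  have [_] := GP k; have [_] := GP l; rewrite -/a -/b.
  by move: (hn a) (hn b) (complex.Re _) (I) (k.+1%:R^-1) (l.+1%:R^-1) => *; lra.
have [g gP] : exists g, forall e : R, 0 < e -> exists N, forall k, (N <= k)%N -> hn (G k - g) < e.
  apply: complete_seq => s s0.
  have s2 : 0 < s ^+ 2 / 4 by rewrite divr_gt0// exprn_gt0.
  have [N NP] := lim0 _ s2; exists N => k l Nk Nl.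
  rewrite -(@ltr_pXn2r _ 2) ?nnegrE ?hn_ge0 ?(ltW s0)//.
  apply: (le_lt_trans (par k l)); have := NP k Nk; have := NP l Nl.
  by move: (k.+1%:R^-1) (l.+1%:R^-1) => *; lra.
suff fg : f - g = 0.
  have [N NP] := gP _ e0; exists (G N) => //.
  have -> : f = g by apply/eqP; rewrite -subr_eq0 fg.
  by rewrite hnC; exact: NP.
apply: Dtot => s Ds.
have small k : cabs (dt (f - G k) s) ^+ 2 <= k.+1%:R^-1 * (hn s ^+ 2 + 1).
  set a := f - G k; pose P := hn s ^+ 2; pose t := (P + 1)^-1.
  have P0 : 0 <= P by exact: sqr_ge0.
  have P1 : 0 < P + 1 by rewrite ltr_wpDl.
  have t0 : 0 < t by rewrite invr_gt0.
  pose c := t%:C * dt a s.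
  have := AI _ (Dlin c _ _ Ds (DG k)).
  have -> : f - (c *: s + G k) = a - c *: s by rewrite /a opprD addrA addrAC.
  rewrite (hn_sqrB a) hnZ dtZr exprMn.
  have -> : complex.Re (c^*%C * dt a s) = t * cabs (dt a s) ^+ 2.
    by rewrite /c rmorphM/= -mulrA [_^*%C * _]mulrC -cabs_mulJ cReM/=; ring.
  have -> : cabs c ^+ 2 = t ^+ 2 * cabs (dt a s) ^+ 2.
    by rewrite /c cabsM cabs_real ger0_norm ?(ltW t0)// exprMn.
  move=> hI; rewrite -ler_pdivrMr// mulrC -/t.
  have tP : t * P <= 1 by rewrite /t mulrC ler_pdivrMr// mul1r lerDl.
  have [_ h] := GP k.
  apply: (variation_bound (ltW t0) (sqr_ge0 _) tP _ h).
  by apply: (le_trans hI); rewrite -/P -/a addrAC mulrN.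
apply/eqP; rewrite -cabs_eq0 eq_le cabs_ge0 andbT.
apply/ler_addgt0Pr => w w0; rewrite add0r.
have s10 : 0 < hn s + 1 by rewrite ltr_wpDl ?hn_ge0.
have P10 : 0 < hn s ^+ 2 + 1 by rewrite ltr_wpDl ?sqr_ge0.
have w1 : 0 < w / 2 / (hn s + 1) by rewrite !divr_gt0.
have w2 : 0 < (w / 2) ^+ 2 / (hn s ^+ 2 + 1) by rewrite divr_gt0// exprn_gt0// divr_gt0.
have [N NP] := gP _ w1; have [M MP] := lim0 _ w2.
pose k := maxn N M; have kN := NP k (leq_maxl _ _); have kM := MP k (leq_maxr _ _).
rewrite -(subrKA (G k)) dtDl; apply: (le_trans (cabsD _ _)).
rewrite [w]splitr lerD//.
  rewrite -(@ler_pXn2r _ 2) ?nnegrE ?cabs_ge0 ?divr_ge0 ?(ltW w0)//.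
  by apply: (le_trans (small k)); rewrite -ler_pdivlMr// ltW.
apply: (le_trans (dt_le _ _)); rewrite ltr_pdivlMr// in kN.
apply: ltW; apply: le_lt_trans kN; rewrite ler_wpM2l ?hn_ge0// lerDl//.
Qed.

End hilbert.

(** * Kernel functions and boundedness of multiplication operators *)

Section rkhs_multipliers.
Variables (R : realType) (X : Type) (H : rkhs R X).
Local Notation C := R[i].
Implicit Types (f g h : H) (a : C).
Local Notation kp := (rkhs_point H).
Local Notation ev := (rkhs_eval H).

Lemma evE f x : ev f x = dt f (kp x).
Proof. exact: rkhs_reproducing. Qed.

Definition kernel_comb (s : seq (C * X)) : H := \sum_(c <- s) c.1 *: kp c.2.

Lemma dt_kernel_comb f s :
  dt f (kernel_comb s) = \sum_(c <- s) c.1^*%C * ev f c.2.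
Proof. by rewrite dt_sumr; apply: eq_bigr => c _; rewrite dtZr evE. Qed.

Lemma kernel_dense f (e : R) : 0 < e -> exists s, hn (f - kernel_comb s) < e.
Proof.
move=> e0; have [||h hP|_ [s ->] hs] :=
  @total_dense R X H (fun y => exists s, y = kernel_comb s) _ _ _ f e e0.
- by exists [::]; rewrite /kernel_comb big_nil.
- move=> a _ _ [s ->] [t ->]; exists ([seq (a * c.1, c.2) | c <- s] ++ t).
  rewrite /kernel_comb big_cat big_map scaler_sumr; congr (_ + _).
  by apply: eq_bigr => c _; rewrite scalerA.
- apply: (@rkhs_eval_inj R X H); apply/funext => x; rewrite evE linear0.
  by apply: hP; exists [:: (1, x)]; rewrite /kernel_comb big_seq1 scale1r.
- by exists s.
Qed.

Lemma ev_inj f g : (forall x, ev f x = ev g x) -> f = g.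
Proof. by move=> fg; apply: (@rkhs_eval_inj R X H); apply/funext. Qed.

Lemma evD f g x : ev (f + g) x = ev f x + ev g x.
Proof. by rewrite linearD. Qed.

Lemma evZ a f x : ev (a *: f) x = a * ev f x.
Proof. by rewrite linearZ. Qed.

Lemma mult_opE (phi : Mult H) f x : ev (mult_op phi f) x = val phi x * ev f x.
Proof.
rewrite /mult_op; case: xgetP => [g _ gP|noP]; first exact: gP.
have /asboolP/(_ f)[g gP] := valP phi.
by have := noP g.
Qed.

Lemma mult_op_lin (phi : Mult H) a f g :
  mult_op phi (a *: f + g) = a *: mult_op phi f + mult_op phi g.
Proof. by apply: ev_inj => x; rewrite !(mult_opE, evD, evZ); ring. Qed.

Lemma mult_opD (phi : Mult H) f g : mult_op phi (f + g) = mult_op phi f + mult_op phi g.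
Proof. by have := mult_op_lin phi 1 f g; rewrite !scale1r. Qed.

Lemma mult_op0 (phi : Mult H) : mult_op phi 0 = 0.
Proof. by apply: ev_inj => x; rewrite mult_opE linear0 mulr0. Qed.

Lemma mult_opZ (phi : Mult H) a f : mult_op phi (a *: f) = a *: mult_op phi f.
Proof. by have := mult_op_lin phi a f 0; rewrite mult_op0 !addr0. Qed.

Lemma mult_opB (phi : Mult H) f g : mult_op phi (f - g) = mult_op phi f - mult_op phi g.
Proof. by rewrite mult_opD -scaleN1r mult_opZ scaleN1r. Qed.

Lemma mult_op_linl (phi psi : Mult H) a f :
  mult_op (a *: phi + psi) f = a *: mult_op phi f + mult_op psi f.
Proof.
apply: ev_inj => x; rewrite !(mult_opE, evD, evZ) linearP /=.
by rewrite -/(val phi) -/(val psi) /GRing.add/= /GRing.scale/= mulrDl mulrA.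
Qed.

(* Uniform boundedness for the functionals [f |-> <phi f, y>], [y] in the
   kernel span, by a gliding hump. *)
Lemma mult_op_bounded (phi : Mult H) :
  exists2 K : R, 0 <= K & forall f, hn (mult_op phi f) <= K * hn f.
Proof.
apply: contrapT => unb.
have scale f : hn f != 0 -> hn ((hn f)^-1%:C *: f) = 1.
  by move=> f0; rewrite hnZ cabs_real ger0_norm ?invr_ge0 ?hn_ge0// mulVf.
have big (K : R) : exists f, hn f <= 1 /\ K < hn (mult_op phi f).
  apply: contrapT => /forallNP nK; apply: unb; exists `|K| => // f.
  have [/eqP|f0] := eqVneq (hn f) 0.
    by rewrite hn_eq0 => /eqP ->; rewrite mult_op0 hn0 mulr0.
  have /not_andP[|/negP] := nK ((hn f)^-1%:C *: f); first by rewrite scale.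
  rewrite -leNgt mult_opZ hnZ cabs_real ger0_norm ?invr_ge0 ?hn_ge0//.
  rewrite mulrC ler_pdivrMr; last by rewrite lt_neqAle eq_sym f0 hn_ge0.
  by move=> /le_trans; apply; rewrite ler_wpM2r ?hn_ge0// ler_norm.
pose T y f := dt (mult_op phi f) y.
have T_lin y a f g : T y (a *: f + g) = a * T y f + T y g.
  by rewrite /T mult_op_lin dtDl dtZl.
have T_bd s : exists2 K : R, 0 <= K & forall f, cabs (T (kernel_comb s) f) <= K * hn f.
  exists (\sum_(c <- s) cabs (c.1) * cabs (val phi c.2) * hn (kp c.2)).
    by apply: sumr_ge0 => c _; rewrite !mulr_ge0 ?cabs_ge0 ?hn_ge0.
  move=> f; rewrite /T dt_kernel_comb mulr_suml.
  apply: (le_trans (cabs_sum _ _ _)); apply: ler_sum => c _.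
  rewrite mult_opE !cabsM cabsJ !mulrA -!mulrA ler_wpM2l ?cabs_ge0//.
  by rewrite ler_wpM2l ?cabs_ge0// evE mulrC dt_le.
(* [y] approximates the unit vector along a large value $\varphi f_0$ by a kernel combination, for
   which [T y] is visibly bounded; [f] nearly attains its norm. *)
have /choice[yf yfP] : forall n : nat, exists yf : H * H,
    [/\ hn yf.1 <= 2, hn yf.2 <= 1, 4 ^+ n < cabs (T yf.1 yf.2) &
        forall g, cabs (T yf.1 g) <= 3 / 2 * cabs (T yf.1 yf.2) * hn g].
  move=> n; pose K : R := 4 ^+ n; have K0 : 0 < K by rewrite exprn_gt0.
  have [f0 [f01 f0K]] := big (4 * K).
  have m0 : 0 < hn (mult_op phi f0) by apply: le_lt_trans f0K; rewrite mulr_ge0// ltW.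
  pose u := (hn (mult_op phi f0))^-1%:C *: mult_op phi f0.
  have u1 : hn u = 1 by rewrite scale// gt_eqF.
  have h12 : (0 : R) < 1 / 2 by lra.
  have [s us] := kernel_dense u h12.
  set y := kernel_comb s in us.
  have y2 : hn y <= 2.
    have := hn_dist y u 0; rewrite !subr0 u1 (hnC y u); lra.
  have Tf0 : 2 * K < cabs (T y f0).
    have mu : cabs (dt (mult_op phi f0) u) = hn (mult_op phi f0).
      rewrite /u dtZr dt_sqr cabsM cabsJ !cabs_real !ger0_norm ?invr_ge0 ?exprn_ge0 ?hn_ge0//.
      by rewrite expr2 mulKf// gt_eqF.
    have : cabs (dt (mult_op phi f0) u) <= hn (mult_op phi f0) * hn (u - y) + cabs (T y f0).
      rewrite -[X in cabs (dt _ X)](subrK y) dtDr; apply: (le_trans (cabsD _ _)).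
      by rewrite lerD2r; exact: dt_le.
    rewrite mu; have : hn (mult_op phi f0) * hn (u - y) <= hn (mult_op phi f0) * (1 / 2).
      by rewrite ler_wpM2l ?hn_ge0// ltW.
    move: f0K; lra.
  have [B B0 TB] := T_bd s.
  pose A := [set cabs (T y f) | f in [set f | hn f <= 1]].
  have supA : has_sup A.
    split; first by exists (cabs (T y 0)), 0 => //=; rewrite hn0.
    exists B => _ [f f1 <-]; apply: (le_trans (TB f)).
    by rewrite ler_piMr.
  have S0 : 2 * K < sup A.
    by apply: (lt_le_trans Tf0); apply: ub_le_sup; [have [] := supA|exists f0].
  (* Reaching two thirds of the supremum gives the factor $3/2$ of [yfP]. *)
  have e0 : 0 < sup A / 3 by rewrite divr_gt0//; lra.
  have [_ [f f1 <-] fS] := sup_adherent e0 supA.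
  exists (y, f); split => //=.
    by rewrite -/K; lra.
  move=> g; have [/eqP|g0] := eqVneq (hn g) 0.
    rewrite hn_eq0 => /eqP ->; rewrite hn0 mulr0.
    by rewrite /T mult_op0 dt0l cabs0.
  have g0' : 0 < hn g by rewrite lt_neqAle eq_sym g0 hn_ge0.
  rewrite -ler_pdivrMr//.
  have h1 : cabs (T y ((hn g)^-1%:C *: g)) <= sup A.
    apply: ub_le_sup; first by have [] := supA.
    by exists ((hn g)^-1%:C *: g) => //=; rewrite scale.
  move: h1; rewrite /T mult_opZ dtZl cabsM cabs_real ger0_norm ?invr_ge0 ?hn_ge0//.
  by rewrite mulrC => h1; apply: (le_trans h1); move: fS; rewrite /T; lra.
(* The steps after the [n]-th move the point by at most $\frac32 3^{-(n+1)} = dl_n/2$. They undo at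
   most $\frac32\cdot\frac12 = \frac34$ of the gain $dl_n |T f|$, and the remaining quarter grows
   like $(4/3)^n$ because $|T f| > 4^n$. *)
pose dl n : R := (1 / 3) ^+ n.
have dl0 n : 0 < dl n by rewrite exprn_gt0//; lra.
(* The values of [T y] at $x \pm dl_n f$ differ by $2\,dl_n T f$, so one of them is large enough. *)
have step n x : exists x', hn (x' - x) <= dl n /\
    dl n * cabs (T (yf n).1 (yf n).2) <= cabs (T (yf n).1 x').
  have [_ f1 _ _] := yfP n; set y := (yf n).1; set f := (yf n).2.
  have TpE (c : R) : T y (c%:C *: f + x) = c%:C * T y f + T y x by exact: T_lin.
  have hc (c : R) : `|c| <= dl n -> hn ((c%:C *: f + x) - x) <= dl n.
    rewrite addrK hnZ cabs_real => cd; apply: le_trans cd.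
    by rewrite ler_piMr.
  have [ok|/ltW bad] := lerP (dl n * cabs (T y f)) (cabs (T y ((dl n)%:C *: f + x))).
    by exists ((dl n)%:C *: f + x); split => //; apply: hc; rewrite (ger0_norm (ltW (dl0 n))).
  exists ((- dl n)%:C *: f + x); split.
    by apply: hc; rewrite normrN (ger0_norm (ltW (dl0 n))).
  have : 2 * dl n * cabs (T y f) <= cabs (T y ((dl n)%:C *: f + x)) + cabs (T y ((- dl n)%:C *: f + x)).
    have -> : 2 * dl n * cabs (T y f) = cabs (T y ((dl n)%:C *: f + x) - T y ((- dl n)%:C *: f + x)).
      rewrite !TpE rmorphN.
      have -> : (dl n)%:C * T y f + T y x - (- (dl n)%:C * T y f + T y x) =
          (2 * dl n)%:C * T y f by rewrite rmorphM rmorph_nat; ring.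
      have d2 : 0 <= 2 * dl n by rewrite mulr_ge0// ltW.
      by rewrite cabsM cabs_real (ger0_norm d2).
    exact: cabsB.
  move: bad; move: (cabs _) (cabs _) (cabs _) => *; lra.
have /choice[st stP] : forall nx : nat * H, exists x', hn (x' - nx.2) <= dl nx.1 /\
    dl nx.1 * cabs (T (yf nx.1).1 (yf nx.1).2) <= cabs (T (yf nx.1).1 x').
  by move=> [n x]; exact: step.
pose xs := fix xs n := if n is m.+1 then st (m, xs m) else 0.
have xsS n : hn (xs n.+1 - xs n) <= dl n by have [] := stP (n, xs n).
have xsT n : dl n * cabs (T (yf n).1 (yf n).2) <= cabs (T (yf n).1 (xs n.+1)).
  by have [] := stP (n, xs n).
have xs_far k j : hn (xs (k + j)%N - xs k) <= 3 / 2 * (dl k - dl (k + j)%N).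
  elim: j => [|j IH]; first by rewrite addn0 !subrr hn0 mulr0.
  apply: (le_trans (hn_dist _ (xs (k + j)%N) _)); rewrite addnS.
  have := xsS (k + j)%N; have -> : dl (k + j).+1 = dl (k + j)%N / 3.
    by rewrite /dl exprS; lra.
  move: IH; move: (hn _) (hn _) (dl _) (dl _) => *; lra.
have xs_far' k l : (k <= l)%N -> hn (xs l - xs k) <= 3 / 2 * dl k.
  move=> /subnKC <-; apply: (le_trans (xs_far _ _)).
  by rewrite ler_wpM2l// gerBl ltW.
have dl_lim (e : R) : 0 < e -> exists N, dl N < e.
  move=> e0; have : dl @ \oo --> (0 : R) by apply: cvg_expr; rewrite ger0_norm; lra.
  move=> /cvgrPdist_lt/(_ _ e0)[N _ /(_ N (leqnn N))].
  by rewrite /= sub0r normrN ger0_norm ?(ltW (dl0 _)) => // NP; exists N.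
have [x xP] : exists x, forall e : R, 0 < e -> exists N, forall k, (N <= k)%N -> hn (xs k - x) < e.
  apply: complete_seq => e e0.
  have e3 : 0 < e / 3 by lra.
  have [N NP] := dl_lim _ e3; exists N => k l Nk Nl.
  apply: (le_lt_trans (hn_dist _ (xs N) _)); rewrite (hnC (xs N)).
  have := xs_far' _ _ Nk; have := xs_far' _ _ Nl.
  by move: (hn _) (hn _) (dl _) NP => *; lra.
have xk k : hn (xs k - x) <= 3 / 2 * dl k.
  apply/ler_addgt0Pr => e /xP[N NP]; pose l := maxn N k.
  apply: (le_trans (hn_dist _ (xs l) _)); rewrite lerD//.
    by rewrite hnC; apply: xs_far'; exact: leq_maxr.
  by apply: ltW; apply: NP; exact: leq_maxl.
have bad n : (4 / 3) ^+ n <= 8 * hn (mult_op phi x).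
  have [y2 f1 Tf Tg] := yfP n.
  have h1 : cabs (T (yf n).1 x) <= hn (mult_op phi x) * 2.
    by apply: (le_trans (dt_le _ _)); rewrite ler_wpM2l ?hn_ge0.
  have h2 : cabs (T (yf n).1 (xs n.+1)) <= cabs (T (yf n).1 x) + cabs (T (yf n).1 (xs n.+1 - x)).
    have -> : T (yf n).1 (xs n.+1) = T (yf n).1 x + T (yf n).1 (xs n.+1 - x).
      by rewrite /T mult_opB dtBl subrKC.
    exact: cabsD.
  have h3 := Tg (xs n.+1 - x); have h4 := xsT n; have h5 := xk n.+1.
  set t := cabs (T (yf n).1 (yf n).2) in Tf h3 h4.
  have dS : dl n.+1 = dl n / 3 by rewrite /dl exprS; lra.
  have h6 : 3 / 2 * t * hn (xs n.+1 - x) <= 3 / 2 * t * (dl n / 2).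
    by rewrite ler_wpM2l ?mulr_ge0 ?cabs_ge0//; move: h5; rewrite dS; lra.
  have h7 : dl n * 4 ^+ n <= dl n * t by rewrite ler_wpM2l ?ltW.
  have <- : dl n * 4 ^+ n = (4 / 3) ^+ n by rewrite /dl -exprMn; congr (_ ^+ _); lra.
  move: h1 h2 h3 h4 h6 h7; move: (dl n * 4 ^+ n) (cabs (T _ x)) (cabs (T _ (xs _))) (cabs (T _ (_ - _))) (hn (mult_op _ _)).
  by move: (hn _) (dl n) => *; nra.
have bern n : 1 + n%:R / 3 <= (4 / 3 : R) ^+ n.
  elim: n => [|n IH]; first by rewrite mul0r addr0 expr0.
  rewrite exprS -natr1; have := ler_wpM2l (_ : 0 <= 4 / 3 :> R) IH.
  have n0 : 0 <= n%:R :> R by [].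
  by move=> /(_ ltac:(lra)); lra.
have := truncnS_gt (24 * hn (mult_op phi x)); set N := (Num.truncn _).+1.
have := le_trans (bern N) (bad N).
by move: (N%:R) (hn _) => {bern bad} a b; lra.
Qed.

End rkhs_multipliers.

Lemma sum_cauchy_schwarz (R : realType) (I : finType) (x y : I -> R[i]) :
  cabs (\sum_i x i * (y i)^*%C) ^+ 2 <=
  (\sum_i cabs (x i) ^+ 2) * (\sum_i cabs (y i) ^+ 2).
Proof.
set S := \sum_i x i * _; set A := \sum_i cabs (x i) ^+ 2; set B := \sum_i cabs (y i) ^+ 2.
have B0 : 0 <= B by apply: sumr_ge0 => i _; exact: sqr_ge0.
have key (t : R) : 0 <= A - 2 * (t * cabs S ^+ 2) + t ^+ 2 * cabs S ^+ 2 * B.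
  have -> : A - 2 * (t * cabs S ^+ 2) + t ^+ 2 * cabs S ^+ 2 * B =
      \sum_i cabs (x i - t%:C * S * y i) ^+ 2.
    have SE : \sum_i complex.Re (S^*%C * (x i * (y i)^*%C)) = cabs S ^+ 2.
      by rewrite -cRe_sum -mulr_sumr -/S mulrC -cabs_mulJ.
    rewrite -[X in _ - 2 * (t * X)]SE /A /B; move: (S) => z {SE}.
    rewrite !mulr_sumr -sumrB -big_split/=; apply: eq_bigr => i _.
    rewrite !cabs_sqr; move: z (x i) (y i) => [s1 s2] [x1 x2] [y1 y2] /=; ring.
  by apply: sumr_ge0 => i _; exact: sqr_ge0.
have [B00|Bn0] := eqVneq B 0.
  have y0 i : y i = 0.
    apply/eqP; rewrite -cabs_eq0 -sqrf_eq0.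
    by move/eqP: B00; rewrite psumr_eq0 => [/allP/(_ i)|j _]; [apply; rewrite mem_index_enum|exact: sqr_ge0].
  by rewrite /S big1 ?cabs0 ?expr0n ?B00 ?mulr0// => i _; rewrite y0 conjc0 mulr0.
have B1 : 0 < B by rewrite lt_neqAle eq_sym Bn0.
have := key B^-1.
have -> : B^-1 ^+ 2 * cabs S ^+ 2 * B = B^-1 * cabs S ^+ 2 by field.
rewrite -ler_pdivrMr// [_ / B]mulrC; move: (_ * cabs S ^+ 2) => *; lra.
Qed.

Lemma cvg_complex_unique (R : realType) (u v : nat -> R[i]) (a b : R[i]) :
  u @ \oo --> a -> v @ \oo --> b -> (exists k, forall n, (k <= n)%N -> u n = v n) ->
  a = b.
Proof.
move=> /cvg_complex_parts[ra ia] /cvg_complex_parts[rb ib] [k uv].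
have near_eq (f : R[i] -> R) : {near \oo, (f \o v) =1 (f \o u)}.
  by exists k => // n /= kn; rewrite uv.
apply/eqP; rewrite eq_complex; apply/andP; split; apply/eqP.
- apply: (cvg_unique (@Rhausdorff R) ra).
  by apply: cvg_trans rb; apply: near_eq_cvg; exact: near_eq.
- apply: (cvg_unique (@Rhausdorff R) ia).
  by apply: cvg_trans ib; apply: near_eq_cvg; exact: near_eq.
Qed.

Lemma cvg_sum_seq (R : realType) (I : Type) (r : seq I) (F : I -> nat -> R[i]) (a : I -> R[i]) :
  (forall i, F i @ \oo --> a i) ->
  (fun n => \sum_(i <- r) F i n) @ \oo --> \sum_(i <- r) a i.
Proof.
move=> Fa; elim: r => [|i r IH].
  by under eq_fun do rewrite big_nil; rewrite big_nil; exact: cvg_cst.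
rewrite big_cons; under eq_fun do rewrite big_cons.
exact: (@cvgD _ _ _ _ _ (F i) (fun n => \sum_(j <- r) F j n) _ _ (Fa i) IH).
Qed.

Lemma mul_le_sqr (R : realType) (M x y : R) : 0 <= M ->
  M * x * y <= M * (x ^+ 2 + y ^+ 2) / 2.
Proof.
move=> M0; rewrite -!mulrA ler_wpM2l// ler_pdivlMr//.
by have := sqr_ge0 (x - y); lra.
Qed.

Lemma hn_sqrZ (R : realType) (X : Type) (H : rkhs R X) (t : R) (f : H) :
  hn (t%:C *: f) ^+ 2 = t ^+ 2 * hn f ^+ 2.
Proof. by rewrite hnZ cabs_real exprMn real_normK// num_real. Qed.

(** * Radial weights: homogeneous parts, Fejer means, windows of degrees *)

Section weights.
Variables (R : realType) (n : nat).
Local Notation C := R[i].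
Local Notation mp := (mpoly n C).
Implicit Types (p q : mp) (c : nat -> C).

(** Scales the homogeneous part of degree $k$ by $c_k$; one operation covers homogeneous parts,
    Fejer means and windows. *)
Definition wt c p : mp := \sum_(m <- msupp p) (c (mdeg m) * mcoeff m p) *: mpolyX C m.

Lemma mcoeff_wt c p m : mcoeff m (wt c p) = c (mdeg m) * mcoeff m p.
Proof.
rewrite /wt raddf_sum /=.
under eq_bigr => j _ do rewrite mcoeffZ mcoeffX.
have [mp|mp] := boolP (m \in msupp p).
  rewrite (bigD1_seq m) ?msupp_uniq//= eqxx mulr1 big1 ?addr0// => j /negbTE jm.
  by rewrite jm mulr0.
rewrite (memN_msupp_eq0 mp) mulr0 big_seq big1// => j jp.
by have [jm|_] := eqVneq j m; [rewrite -jm jp in mp|rewrite mulr0].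
Qed.

Lemma wt_lin c a p q : wt c (a *: p + q) = a *: wt c p + wt c q.
Proof.
by apply/mpolyP => m; rewrite !(mcoeff_wt, mcoeffD, mcoeffZ); ring.
Qed.

Lemma wt0 c : wt c 0 = 0.
Proof. by apply/mpolyP => m; rewrite mcoeff_wt mcoeff0 mulr0. Qed.

Lemma wtX c m : wt c (mpolyX C m) = c (mdeg m) *: mpolyX C m.
Proof.
apply/mpolyP => k; rewrite mcoeff_wt mcoeffZ !mcoeffX.
by case: eqP => [->//|_]; rewrite !mulr0.
Qed.

Lemma mpoly_lin_ind (P : mp -> Prop) : (forall m, P (mpolyX C m)) -> P 0 ->
  (forall a p q, P p -> P q -> P (a *: p + q)) -> forall p, P p.
Proof.
move=> PX P0 PD; elim/mpolyind => // a m p _ _ Pp; exact: PD.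
Qed.

Definition hompart k := wt (fun j => (j == k)%:R).

Lemma homog_hompart k p (l : C) z : pev (hompart k p) (l *: z) = l ^+ k * pev (hompart k p) z.
Proof.
elim/mpoly_lin_ind: p => [m||a p q IHp IHq]; rewrite /hompart ?wtX ?wt0 ?pev0 ?mulr0//.
  have [<-|_] := eqVneq (mdeg m) k; last by rewrite scale0r !pev0 mulr0.
  rewrite scale1r (_ : mdeg m = (\sum_i m i)%N); last exact: mdegE.
  rewrite /pev !mevalX expr_sum -big_split/=.
  by apply: eq_bigr => i _; rewrite mxE exprMn.
by rewrite wt_lin !pevD !pevZ -/(hompart k p) -/(hompart k q) IHp IHq; ring.
Qed.

Lemma wt_hompart c p : exists L0, forall L, (L0 <= L)%N ->
  wt c p = \sum_(0 <= k < L) c k *: hompart k p.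
Proof.
elim/mpoly_lin_ind: p => [m||a p q [L IHp] [L' IHq]].
- exists (mdeg m).+1 => L mL; rewrite wtX.
  under eq_bigr => k _ do rewrite /hompart wtX.
  rewrite (bigD1_seq (mdeg m)) ?mem_index_iota ?iota_uniq//= eqxx scale1r.
  by rewrite big1 ?addr0// => k km; rewrite eq_sym (negbTE km) scale0r scaler0.
- by exists 0%N => L _; rewrite big1 ?wt0// => k _; rewrite /hompart wt0 scaler0.
- exists (maxn L L') => M; rewrite geq_max => /andP[/IHp Hp /IHq Hq].
  rewrite wt_lin Hp Hq scaler_sumr -big_split/=; apply: eq_bigr => k _.
  by rewrite /hompart wt_lin scalerDr !scalerA mulrC.
Qed.

Lemma wt1 p : wt (fun=> 1) p = p.
Proof. by apply/mpolyP => m; rewrite mcoeff_wt mul1r. Qed.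

(** The homogeneous parts at $w = z/s$ are the coefficients of $l \mapsto p(lw)$, so the
    one-variable Cauchy estimate bounds them by $M$; homogeneity supplies $s^k$. *)
Lemma hompart_bound k p (s M : R) z : 0 < s -> bnd p 1 M -> nsq z <= s ^+ 2 ->
  cabs (pev (hompart k p) z) <= M * s ^+ k.
Proof.
move=> s0 pM zs; pose w := s^-1%:C *: z.
have zE : z = s%:C *: w by rewrite scalerA -rmorphM divff ?gt_eqF// scale1r.
have w1 : nsq w <= 1.
  rewrite nsqZ cabs_real ger0_norm ?invr_ge0 ?(ltW s0)// exprVn mulrC.
  by rewrite ler_pdivrMr ?exprn_gt0// mul1r.
have [L0 /(_ _ (leq_maxl L0 k.+1))] := wt_hompart (fun=> 1) p.
rewrite wt1; set L := maxn _ _ => pE; have kL : (k < L)%N by exact: leq_maxr.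
pose q : {poly C} := \poly_(j < L) pev (hompart j p) w.
have := @cauchy_coef R q 1 M k ler01; rewrite coef_poly kL expr1n mulr1 => h.
rewrite zE homog_hompart cabsM cabsX cabs_real (ger0_norm (ltW s0)) mulrC.
rewrite ler_wpM2r ?exprn_ge0 ?(ltW s0)//; apply: h => l l1.
have -> : q.[l] = pev p (l *: w).
  rewrite [in RHS]pE pev_sum big_mkord horner_poly; apply: eq_bigr => j _.
  by rewrite scale1r homog_hompart mulrC.
by apply: pM; rewrite nsqZ l1 expr1n mul1r.
Qed.

(** The weight is $(1-k/N)^+$: subtraction on [nat] truncates, so degrees from [N] on vanish. *)
Definition fejer (N : nat) := wt (fun k => ((N - k)%:R / N%:R : R)%:C).
Definition window (N s : nat) := wt (fun k => ((k <= s < k + N)%N)%:R).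

Lemma sum_pow_bound (r : R) L : 0 <= r -> r < 1 ->
  \sum_(0 <= k < L) k%:R * r ^+ k <= (1 - r) ^- 2.
Proof.
move=> r0 r1; have r10 : 0 < 1 - r by rewrite subr_gt0.
rewrite -[leRHS]mul1r ler_pdivlMr ?exprn_gt0//.
case: L => [|L]; first by rewrite big_geq// mul0r.
suff -> : (\sum_(0 <= k < L.+1) k%:R * r ^+ k) * (1 - r) ^+ 2 =
    r - (r ^+ L.+1 + L%:R * r ^+ L.+1 * (1 - r)).
  rewrite lerBlDr; apply: (le_trans (ltW r1)); rewrite lerDl addr_ge0 ?exprn_ge0//.
  by rewrite !mulr_ge0 ?exprn_ge0 ?(ltW r10).
elim: L => [|L IH]; first by rewrite big_nat1 mul0r; ring.
by rewrite big_nat_recr//= mulrDl IH -!natr1 !exprS; ring.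
Qed.

(** The part of degree $k$ is multiplied by at most $k/N$ and is at most $Ms^k$ on the smaller ball;
    $\sum_k k s^k \le (1-s)^{-2}$. *)
Lemma fejer_bound N p (s M : R) : (0 < N)%N -> 0 < s -> s < 1 -> bnd p 1 M ->
  bnd (p - fejer N p) (s ^+ 2) (M * (1 - s) ^- 2 / N%:R).
Proof.
move=> N0 s0 s1 pM z zs.
have N0' : 0 < N%:R :> R by rewrite ltr0n.
have M0 := bnd_ge0 ler01 pM.
have [L0 pE] := wt_hompart (fun=> 1) p.
have [L1 sE] := wt_hompart (fun k => ((N - k)%:R / N%:R : R)%:C) p.
have := pE _ (leq_maxl L0 L1); have := sE _ (leq_maxr L0 L1).
rewrite wt1 -/(fejer N p); set L := maxn _ _ => {}sE {}pE.
rewrite {1}pE sE -sumrB pev_sum.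
apply: (le_trans (cabs_sum _ _ _)).
apply: (@le_trans _ _ (\sum_(0 <= k < L) M / N%:R * (k%:R * s ^+ k))).
  apply: ler_sum => k _; rewrite -scalerBl pevZ cabsM.
  have -> : 1 - ((N - k)%:R / N%:R : R)%:C = ((N%:R - (N - k)%:R) / N%:R : R)%:C.
    by rewrite mulrBl divff ?gt_eqF// rmorphB rmorph1.
  have h1 : 0 <= N%:R - (N - k)%:R :> R by rewrite subr_ge0 ler_nat leq_subr.
  have h2 : N%:R - (N - k)%:R <= k%:R :> R.
    by rewrite lerBlDr -natrD ler_nat; lia.
  rewrite cabs_real ger0_norm ?divr_ge0 ?(ltW N0')//.
  have h3 := hompart_bound k s0 pM zs.
  rewrite (_ : M / N%:R * _ = k%:R / N%:R * (M * s ^+ k)); last by ring.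
  apply: ler_pM => //; rewrite ?divr_ge0 ?cabs_ge0 ?(ltW N0')//.
  by rewrite ler_wpM2r// invr_ge0 ltW.
rewrite -mulr_sumr -!mulrA ler_wpM2l// mulrC ler_wpM2r ?invr_ge0 ?(ltW N0')//.
by apply: sum_pow_bound => //; exact: ltW.
Qed.

(** A multiplier monomial of degree [i] maps degree [j] to [i + j]. The windows containing both
    degrees number $(N-i)^+$, which is [N] times the Fejer weight of [i]. *)
Lemma sum_windows (N i j S : nat) : (i + j + N <= S)%N ->
  (\sum_(0 <= s < S) ((j <= s < j + N) && (i + j <= s < i + j + N)) = N - i)%N.
Proof.
move=> hS; rewrite -[RHS](_ : \sum_(i + j <= s < j + N) 1 = _)%N; last first.
  by rewrite sum_nat_const_nat muln1; lia.
rewrite [RHS](big_nat_widen _ _ S) 1?[in RHS](big_nat_widenl _ 0)//=; last by lia.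
rewrite [RHS]big_mkcond/=; apply: eq_bigr => s _.
by case: ifP; case: (boolP (_ && _)) => //=; lia.
Qed.

End weights.

(** * Limits of complex sequences through their parts *)

Section complex_limits.
Variable R : realType.
Local Notation C := R[i].

Lemma cvg_real_complex (u : nat -> R) (a : R) : u @ \oo --> a ->
  (fun n => (u n)%:C) @ \oo --> a%:C.
Proof.
move=> ua; apply/cvgrPdist_lt => e e0.
have eE : e = (complex.Re e)%:C by move: e0; case: e => x y; rewrite ltcE /= => /andP[/eqP ->].
have e1 : 0 < complex.Re e by rewrite -ltcR -eE.
move/cvgrPdist_lt: ua => /(_ _ e1); apply: filterS => n h.
by rewrite -rmorphB cabsE cabs_real eE ltcR.
Qed.

Lemma cvg_complex_of_parts (u : nat -> C) (a : C) :
  (fun n => complex.Re (u n)) @ \oo --> complex.Re a ->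
  (fun n => complex.Im (u n)) @ \oo --> complex.Im a -> u @ \oo --> a.
Proof.
move=> /cvg_real_complex ra /cvg_real_complex ia.
have split z : z = (complex.Re z)%:C + (0 +i* 1 : C) * (complex.Im z)%:C.
  by case: z => x y; simpc.
rewrite (split a) (_ : u = fun n => (complex.Re (u n))%:C + (0 +i* 1 : C) * (complex.Im (u n))%:C).
  exact: (cvgD ra (cvgM (cvg_cst (0 +i* 1 : C)) ia)).
by apply/funext => n; exact: split.
Qed.

Lemma summable_cabs (u : nat -> C) (v : nat -> R) : (forall n, cabs (u n) <= v n) ->
  cvgn (series v) -> exists a : C, (series u : nat -> C) @ \oo --> a.
Proof.
move=> uv cv.
have part (f : C -> R) : (forall x, `|f x| <= cabs x) -> cvgn (series (f \o u)).
  move=> fc; apply: normed_cvg; apply: series_le_cvg cv => n //=.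
    exact: le_trans (cabs_ge0 _) (uv n).
  exact: le_trans (fc _) (uv n).
have /cvg_ex[a ra] := part (@complex.Re R) (@Re_le_cabs R).
have /cvg_ex[b ib] := part (@complex.Im R) (@Im_le_cabs R).
exists (a +i* b); apply: cvg_complex_of_parts => /=.
  rewrite (_ : (fun _ => _) = series (@complex.Re R \o u))//.
  by apply/funext => n; rewrite !seriesEnat /= cRe_sum.
rewrite (_ : (fun _ => _) = series (@complex.Im R \o u))//.
by apply/funext => n; rewrite !seriesEnat /= cIm_sum.
Qed.

Lemma cvg_cabs (u : nat -> C) (a : C) (e : R) : u @ \oo --> a -> 0 < e ->
  exists N, forall n, (N <= n)%N -> cabs (a - u n) < e.
Proof.
move=> ua e0; have e1 : 0 < e%:C by rewrite ltcR.
move/cvgrPdist_lt: ua => /(_ _ e1)[N _ NP]; exists N => n /NP.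
by rewrite cabsE ltcR.
Qed.

Lemma cvg_limn_eq (u : nat -> C) (a : C) : u @ \oo --> a -> limn u = a.
Proof.
move=> ua; have cu : u @ \oo --> limn u := cvgP _ ua.
by apply: (cvg_complex_unique cu ua); exists 0%N.
Qed.

Lemma cvg_linear_comb (u v : nat -> C) (a b c : C) : u @ \oo --> b -> v @ \oo --> c ->
  (fun n => a * u n + v n) @ \oo --> a * b + c.
Proof. by move=> ub vc; exact: (cvgD (cvgM (cvg_cst a) ub) vc). Qed.

End complex_limits.

(** * Normal functionals on multipliers *)

Section predual_theory.
Variables (R : realType) (X : Type) (H : rkhs R X).
Local Notation C := R[i].
Implicit Types (w : predual H) (phi psi : Mult H).

Definition pterm w phi n := dt (mult_op phi (predual_l w n)) (predual_r w n).
Definition pmass w n := hn (predual_l w n) ^+ 2 + hn (predual_r w n) ^+ 2.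

Lemma pmass_ge0 w n : 0 <= pmass w n.
Proof. by rewrite addr_ge0 ?sqr_ge0. Qed.

Lemma summable_hn (f : nat -> H) : cvgn (series (fun n => `|f n| ^+ 2)) ->
  cvgn (series (fun n => hn (f n) ^+ 2)).
Proof.
move=> /cvg_ex[a /cvg_complex_parts[h _]]; apply/cvg_ex; exists (complex.Re a).
rewrite (_ : series _ = (fun n => complex.Re (series (fun n => `|f n| ^+ 2) n)))//.
apply/funext => n; rewrite !seriesEnat /= cRe_sum; apply: eq_bigr => i _.
by rewrite hnE -rmorphXn.
Qed.

Lemma summable_normr (f : nat -> H) : cvgn (series (fun n => hn (f n) ^+ 2)) ->
  cvgn (series (fun n => `|f n| ^+ 2)).
Proof.
move=> /cvg_ex[a /cvg_real_complex h]; apply/cvg_ex; exists a%:C.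
rewrite (_ : series _ = (fun n => (series (fun n => hn (f n) ^+ 2) n)%:C))//.
apply/funext => n; rewrite !seriesEnat /= rmorph_sum; apply: eq_bigr => i _.
by rewrite hnE /= rmorphXn.
Qed.

Lemma pmass_cvg w : cvgn (series (pmass w)).
Proof.
have -> : pmass w = (fun n => hn (predual_l w n) ^+ 2) + (fun n => hn (predual_r w n) ^+ 2) by [].
rewrite seriesD; apply: is_cvgD; apply: summable_hn.
  exact: predual_l_summable.
exact: predual_r_summable.
Qed.

Lemma pterm_le w phi (M : R) n : 0 <= M -> (forall f, hn (mult_op phi f) <= M * hn f) ->
  cabs (pterm w phi n) <= M / 2 * pmass w n.
Proof.
move=> M0 hM; apply: (le_trans (dt_le _ _)).
apply: le_trans (ler_wpM2r (hn_ge0 _) (hM _)) _.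
by apply: le_trans (mul_le_sqr _ _ M0) _; rewrite mulrAC.
Qed.

Lemma predual_cvg w phi : (series (pterm w phi) : nat -> C) @ \oo --> predual_eval w (mult_op phi).
Proof.
have [K K0 hK] := mult_op_bounded phi.
have [a ha] : exists a : C, (series (pterm w phi) : nat -> C) @ \oo --> a.
  apply: (summable_cabs (fun n => pterm_le w n K0 hK)).
  rewrite (_ : (fun n => _) = K / 2 *: pmass w)//.
  by rewrite seriesZ; apply: is_cvgZr; exact: pmass_cvg.
by rewrite /predual_eval -/(pterm w phi) (cvg_limn_eq ha).
Qed.

Arguments predual_cvg w phi : clear implicits.

Lemma predual_lin w a phi psi : predual_eval w (mult_op (a *: phi + psi)) =
  a * predual_eval w (mult_op phi) + predual_eval w (mult_op psi).
Proof.
apply: (cvg_complex_unique (predual_cvg w (a *: phi + psi))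
  (cvg_linear_comb (a := a) (predual_cvg w phi) (predual_cvg w psi))).
exists 0%N => n _; rewrite !seriesEnat /= mulr_sumr -big_split/=.
by apply: eq_bigr => i _; rewrite /pterm mult_op_linl dtDl dtZl.
Qed.

(** The tail is uniformly small over multipliers of norm at most [M], so a normal functional is a
    norm limit of finite sums; $N = 0$ gives a bound for its norm. *)
Lemma predual_tail w phi (M : R) N : 0 <= M -> (forall f, hn (mult_op phi f) <= M * hn f) ->
  cabs (predual_eval w (mult_op phi) - series (pterm w phi) N) <=
  M / 2 * (limn (series (pmass w)) - series (pmass w) N).
Proof.
move=> M0 hM; apply/ler_addgt0Pr => e e0.
have [n0 hn0] := cvg_cabs (predual_cvg w phi) e0; pose n := maxn n0 N.
have h := ltW (hn0 n (leq_maxl _ _)).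
rewrite -[predual_eval _ _](subrK (series (pterm w phi) n)) -addrA.
apply: (le_trans (cabsD _ _)); rewrite [leRHS]addrC lerD//.
apply: (@le_trans _ _ (M / 2 * (series (pmass w) n - series (pmass w) N))).
  rewrite !sub_series_geq ?leq_maxr// mulr_sumr.
  by apply: (le_trans (cabs_sum _ _ _)); apply: ler_sum => i _; exact: pterm_le.
rewrite ler_wpM2l ?divr_ge0// lerD2r.
apply: nondecreasing_cvgn_le; last exact: pmass_cvg.
by apply: nondecreasing_series => i _ _; exact: pmass_ge0.
Qed.

End predual_theory.
Arguments predual_cvg {R X H} w phi.
Arguments pmass_cvg {R X H} w.

(** * A common dominating measure and complex densities *)

Section finite_sum.
Context dd (T : measurableType dd) (R : realType).
Variables m1 m2 : {finite_measure set T -> \bar R}.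

Definition fsum : set T -> \bar R := measure_add m1 m2.

HB.instance Definition _ := Measure.on fsum.

Lemma fsum_finite : fin_num_fun fsum.
Proof.
by move=> A mA; rewrite /fsum measure_addE fin_numD !fin_num_measure.
Qed.

HB.instance Definition _ := @Measure_isFinite.Build _ _ _ fsum fsum_finite.

Lemma fsum_dominates : m1 `<< fsum /\ m2 `<< fsum.
Proof.
split; apply/null_content_dominatesP => A mA; rewrite /= /fsum measure_addE => /eqP;
  by rewrite padde_eq0 ?measure_ge0// => /andP[/eqP ? /eqP ?].
Qed.

End finite_sum.

Section radon_nikodym_densities.
Context dd (T : measurableType dd) (R : realType).
Local Notation C := R[i].

(** Stated for the Hahn decomposition chosen in [integral_charge], so that densities apply directly
    to that integral. *)
Definition dominated (tau : {finite_measure set T -> \bar R}) (s : {charge set T -> \bar R}) :=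
  let sPN := projT2 (cid (projT2 (cid (Hahn_decomposition s)))) in
  jordan_pos sPN `<< tau /\ jordan_neg sPN `<< tau.

Lemma dominated_trans (tau tau' : {finite_measure set T -> \bar R}) s :
  tau `<< tau' -> dominated tau s -> dominated tau' s.
Proof.
move=> tt [h1 h2]; split; exact: null_dominates_trans tt.
Qed.

Lemma dominating_measure (s1 s2 : {charge set T -> \bar R}) :
  exists tau : {finite_measure set T -> \bar R}, dominated tau s1 /\ dominated tau s2.
Proof.
pose v (s : {charge set T -> \bar R}) : {finite_measure set T -> \bar R} :=
  let sPN := projT2 (cid (projT2 (cid (Hahn_decomposition s)))) in
  fsum (jordan_pos sPN) (jordan_neg sPN).
have vd s : dominated (v s) s by exact: fsum_dominates.
exists (fsum (v s1) (v s2) : {finite_measure set T -> \bar R}).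
have [h1 h2] := fsum_dominates (v s1) (v s2).
by split; [exact: dominated_trans (vd s1)|exact: dominated_trans (vd s2)].
Qed.

Section density.
Variable tau : {finite_measure set T -> \bar R}.

Lemma integrable_bounded_mul (h F : T -> R) (B : R) : tau.-integrable setT (EFin \o h) ->
  measurable_fun setT F -> (forall x, `|F x| <= B) ->
  tau.-integrable setT (EFin \o (fun x => h x * F x)).
Proof.
move=> ih mF FB; have mh : measurable_fun setT h by apply/measurable_EFinP; exact: measurable_int ih.
apply: (@le_integrable _ _ _ tau setT measurableT _ (EFin \o (fun x => B * `|h x|))).
- by apply/measurable_EFinP; exact: measurable_funM.
- move=> x _; rewrite /= lee_fin normrM mulrC [leRHS]ger0_norm.
    by rewrite ler_wpM2r.
  by rewrite mulr_ge0// (le_trans _ (FB x)).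
- have := integrableZl measurableT B (integrable_abse ih).
  by apply: eq_integrable => // x _ /=; rewrite EFinM.
Qed.

Lemma bounded_integrable (m : {finite_measure set T -> \bar R}) (F : T -> R) (B : R) :
  measurable_fun setT F -> (forall x, `|F x| <= B) -> m.-integrable setT (EFin \o F).
Proof.
move=> mF FB; apply: (@le_integrable _ _ _ m setT measurableT _ (EFin \o cst B)).
- exact/measurable_EFinP.
- by move=> x _ /=; rewrite lee_fin (le_trans (FB x))// ler_norm.
- exact: finite_measure_integrable_cst.
Qed.

Lemma density_measure (m : {finite_measure set T -> \bar R}) : m `<< tau ->
  exists2 h : T -> R, tau.-integrable setT (EFin \o h) &
    forall (F : T -> R) (B : R), measurable_fun setT F -> (forall x, `|F x| <= B) ->
      Rintegral m setT F = Rintegral tau setT (fun x => h x * F x).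
Proof.
move=> mt; pose rn := Radon_Nikodym (charge_of_finite_measure m) tau.
have fn x : rn x \is a fin_num by exact: Radon_Nikodym_fin_num.
have rnE : rn = EFin \o (fine \o rn) by apply/funext => x /=; rewrite fineK.
have irn : tau.-integrable setT rn by exact: Radon_Nikodym_integrable.
exists (fine \o rn); first by rewrite -rnE.
move=> F B mF FB; rewrite /Rintegral; congr fine.
rewrite -(Radon_Nikodym_change_of_variables mt measurableT (bounded_integrable m mF FB)).
apply: eq_integral => x _ /=; rewrite -/rn EFinM muleC; congr (_ * _)%E.
by rewrite fineK.
Qed.

Lemma density_charge (s : {charge set T -> \bar R}) : dominated tau s ->
  exists2 h : T -> R, tau.-integrable setT (EFin \o h) &
    forall (F : T -> R) (B : R), measurable_fun setT F -> (forall x, `|F x| <= B) ->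
      integral_charge s F = Rintegral tau setT (fun x => h x * F x).
Proof.
move=> [/density_measure[h ih hE] /density_measure[k ik kE]].
exists (fun x => h x - k x).
  by have := integrableB measurableT ih ik; apply: eq_integrable.
move=> F B mF FB; rewrite /integral_charge (hE F B)// (kE F B)//.
rewrite -RintegralB//; try exact: integrable_bounded_mul FB.
by apply: eq_Rintegral => x _; rewrite mulrBl.
Qed.

Lemma integral_charge_indic (s : {charge set T -> \bar R}) (A : set T) :
  measurable A -> integral_charge s (\1_A) = fine (s A).
Proof.
move=> mA; pose sPN := projT2 (cid (projT2 (cid (Hahn_decomposition s)))).
rewrite /integral_charge -/sPN.
rewrite (jordan_decomp sPN mA) /cadd /= /cscale EFinN mulN1e fineB ?fin_num_measure//.
congr (_ - _); rewrite /Rintegral.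
  by rewrite integral_indic// setIT.
by rewrite integral_indic// setIT.
Qed.

Lemma density_complex (mu : {charge set T -> \bar C}) :
  dominated tau (chRe mu) -> dominated tau (chIm mu) ->
  exists theta : T -> C, [/\ L1 tau theta,
    forall (F : T -> C) (B : R), cmeas F -> (forall x, cabs (F x) <= B) ->
      integral_complex mu F = cI tau (fun x => theta x * F x) &
    forall A, measurable A -> fine (mu A) = cI tau (fun x => theta x * cindic R A x)].
Proof.
move=> /density_charge[h ih hE] /density_charge[k ik kE].
have mh : measurable_fun setT h by apply/measurable_EFinP; exact: measurable_int ih.
have mk : measurable_fun setT k by apply/measurable_EFinP; exact: measurable_int ik.
pose theta x : C := h x +i* k x.
have int F (B : R) : cmeas F -> (forall x, cabs (F x) <= B) ->
    integral_complex mu F = cI tau (fun x => theta x * F x).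
  move=> [mr mi] FB.
  have Fr x : `|complex.Re (F x)| <= B by exact: le_trans (Re_le_cabs _) (FB x).
  have Fi x : `|complex.Im (F x)| <= B by exact: le_trans (Im_le_cabs _) (FB x).
  rewrite /integral_complex /cI (hE _ B)// (kE _ B)// (hE _ B)// (kE _ B)//.
  congr (_ +i* _).
    rewrite -RintegralB//; last 2 first.
    - exact: integrable_bounded_mul Fr.
    - exact: integrable_bounded_mul Fi.
    by apply: eq_Rintegral => x _; rewrite cReM.
  rewrite -RintegralD//; last 2 first.
  - exact: integrable_bounded_mul Fi.
  - exact: integrable_bounded_mul Fr.
  by apply: eq_Rintegral => x _; rewrite cImM.
exists theta; split => //.
  split; first by [].
  apply: (@le_integrable _ _ _ tau setT measurableT _ (EFin \o (fun x => `|h x| + `|k x|))).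
  - by apply/measurable_EFinP; exact: measurable_cabs.
  - move=> x _; rewrite /= lee_fin (ger0_norm (cabs_ge0 _)) ger0_norm ?addr_ge0//.
    exact: cabs_le_ReIm.
  - by have := integrableD measurableT (integrable_abse ih) (integrable_abse ik); apply: eq_integrable.
move=> A mA; rewrite -(int _ 1 (cmeas_cindic R mA)); last exact: cabs_cindic.
have i0 (s : {charge set T -> \bar R}) : integral_charge s (fun=> 0) = 0.
  rewrite /integral_charge /Rintegral !integral0 subrr//.
rewrite /integral_complex /=.
have -> : integral_charge (chRe mu) (fun x => \1_A x) = complex.Re (fine (mu A)).
  by rewrite integral_charge_indic.
have -> : integral_charge (chIm mu) (fun x => \1_A x) = complex.Im (fine (mu A)).
  by rewrite integral_charge_indic.
by rewrite !i0 subr0 add0r; case: (fine _).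
Qed.

(** Testing on the set where a real part [f] is nonnegative and on its complement gives $\int|f| =
    0$; the modulus is at most the sum over the two parts. *)
Lemma N1_eq0 (u : T -> C) : L1 tau u ->
  (forall B, measurable B -> cI tau (fun x => u x * cindic R B x) = 0) -> N1 tau u = 0.
Proof.
move=> u1 uB; have [[mr mi] _] := u1.
have part (f : T -> R) : measurable_fun setT f ->
    (forall B, measurable B -> Rintegral tau setT (fun x => f x * \1_B x) = 0) ->
    tau.-integrable setT (EFin \o f) -> Rintegral tau setT (fun x => `|f x|) = 0.
  move=> mf fB fi; pose B := f @^-1` `[0, +oo[%classic.
  have mB : measurable B by rewrite /B -[_ @^-1` _]setTI; exact: mf.
  have ib D : measurable D -> tau.-integrable setT (EFin \o (fun x => f x * \1_D x)).
    move=> mD; apply: (@integrable_bounded_mul _ _ 1) => // x.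
    by rewrite ger0_norm// indicE; case: (_ \in _).
  have -> : (fun x => `|f x|) = fun x => f x * \1_B x - f x * \1_(~` B) x.
    apply/funext => x; rewrite !indicE in_setC.
    have -> : (x \in B) = (0 <= f x).
      by apply/idP/idP; rewrite inE /B /= in_itv /= andbT.
    have [h|h] := lerP 0 (f x); first by rewrite mulr1 mulr0 subr0 ger0_norm.
    by rewrite mulr0 mulr1 sub0r ltr0_norm.
  rewrite RintegralB// ?fB ?subr0//; [exact: measurableC|exact: ib|].
  by apply: ib; exact: measurableC.
have hr : Rintegral tau setT (fun x => `|complex.Re (u x)|) = 0.
  apply: part => //; last exact: L1_Re u1.
  move=> B /uB /(congr1 (@complex.Re R)) /=; apply: etrans; apply: eq_Rintegral => x _.
  by rewrite cReM /= mulr0 subr0.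
have hi : Rintegral tau setT (fun x => `|complex.Im (u x)|) = 0.
  apply: part => //; last exact: L1_Im u1.
  move=> B /uB /(congr1 (@complex.Im R)) /=; apply: etrans; apply: eq_Rintegral => x _.
  by rewrite cImM /= mulr0 add0r.
apply/eqP; rewrite eq_le N1_ge0 andbT -[leRHS]addr0 -{1}hr -hi -RintegralD//; last 2 first.
- by have := integrable_abse (L1_Re u1); apply: eq_integrable.
- by have := integrable_abse (L1_Im u1); apply: eq_integrable.
apply: le_Rintegral => //; first by have [_] := u1.
  have := integrableD measurableT (integrable_abse (L1_Re u1)) (integrable_abse (L1_Im u1)).
  exact: eq_integrable.
by move=> x _; exact: cabs_le_ReIm.
Qed.

End density.

Lemma null_total_variation (mu : {charge set T -> \bar C}) A : measurable A ->
  (forall B, measurable B -> B `<=` A -> mu B = 0%E) -> Defs.total_variation mu A = 0%E.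
Proof.
have zero B : mu B = 0%E -> (complex.Re `|fine (mu B)|)%:E = 0%E :> \bar R.
  by move=> ->; rewrite [fine _](_ : _ = 0)// normr0.
move=> mA muA; rewrite /Defs.total_variation (_ : image _ _ = [set 0%E]) ?ereal_sup1//.
apply/seteqP; split => [_ [F [mF tF FA] <-]|_ ->].
  rewrite /= eseries0// => i _ _.
  by rewrite zero//; apply: muA => //; rewrite -FA; exact: bigcup_sup.
(* The trivial partition shows that the value 0 occurs; the supremum of an empty set would be
   [-oo]. *)
exists (fun i => if i is 0%N then A else set0).
  split.
  - by case.
  - by apply/trivIsetP => -[|i] [|j] //= _ _ _; rewrite ?setI0 ?set0I.
  - apply/seteqP; split => [x [[|i] _]//|x Ax]; by exists 0%N.
rewrite eseries0// => -[|i] _ _; apply: zero; first exact: muA.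
exact: charge0.
Qed.

End radon_nikodym_densities.

(** * Weak-* continuous functionals *)

Section weak_star_functionals.
Variables (R : realType) (X : Type) (H : rkhs R X).
Local Notation C := R[i].
Implicit Types (w : predual H) (phi psi : Mult H) (s : seq (predual H)).

Local Notation pe := (fun w phi => predual_eval w (mult_op phi)).
Local Notation init w := (Topological.Pack (Topological.class
    (initial_topology (fun phi : Mult H => predual_eval w (mult_op phi))))).

Lemma predual_eval_continuous w :
  continuous ((fun phi => predual_eval w (mult_op phi)) : weak_star H -> C).
Proof.
move=> x.
have h : nbhs (x : weak_star H) --> (x : init w).
  by move: w; apply/(@cvg_sup (Mult H) (predual H) _ (nbhs (x : weak_star H)) x).
move=> A nA; apply: h.
exact: (@initial_continuous _ _ (pe w) x A nA).
Qed.

Definition weak_ball s (e : R) : set (Mult H) :=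
  [set phi | \sum_(w <- s) cabs (predual_eval w (mult_op phi)) < e].

(** Continuity at 0 in an initial topology: [L] is below 1 on a ball of finitely many seminorms, and
    homogeneity turns this into an inequality. *)
Lemma weak_star_bounded (L : Mult H -> C) :
  (forall a phi psi, L (a *: phi + psi) = a * L phi + L psi) ->
  continuous (L : weak_star H -> C) ->
  exists s (K : R), 0 <= K /\ forall phi,
    cabs (L phi) <= K * \sum_(w <- s) cabs (predual_eval w (mult_op phi)).
Proof.
move=> Llin cL.
have L0 : L 0 = 0.
  by have := Llin (-1) 0 0; rewrite scaler0 addr0 mulN1r addNr.
have LZ a phi : L (a *: phi) = a * L phi.
  by have := Llin a phi 0; rewrite !addr0 L0 addr0.
have p0 w : predual_eval w (mult_op (0 : Mult H)) = 0.
  by have := predual_lin w (-1) (0 : Mult H) 0; rewrite scaler0 addr0 mulN1r addNr.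
have pZ w a phi : predual_eval w (mult_op (a *: phi)) = a * predual_eval w (mult_op phi).
  by have := predual_lin w a phi 0; rewrite !addr0 p0 addr0.
(* This filter converges to 0 in each of the initial topologies, hence in their supremum, so
   neighbourhoods of the supremum topology need no explicit description. *)
pose F : set_system (Mult H) := [set A | exists s (e : R), 0 < e /\ weak_ball s e `<=` A].
have FF : Filter F.
  split.
  - by exists [::], 1; split.
  - move=> A B [s [e [e0 sA]]] [t [k [k0 tB]]]; exists (s ++ t), (Num.min e k).
    split; first by rewrite lt_min e0.
    move=> phi; rewrite /weak_ball /= big_cat /= lt_min => /andP[h1 h2].
    have s0 (r : seq (predual H)) : 0 <= \sum_(w <- r) cabs (predual_eval w (mult_op phi)).
      by apply: sumr_ge0 => w _; exact: cabs_ge0.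
    split; [apply: sA|apply: tB]; rewrite /weak_ball /=.
      by apply: le_lt_trans h1; rewrite lerDl.
    by apply: le_lt_trans h2; rewrite lerDr.
  - move=> A B AB [s [e [e0 sA]]]; exists s, e; split => //.
    exact: subset_trans AB.
have F0 : F --> (0 : weak_star H).
  apply/(@cvg_sup (Mult H) (predual H) _ F 0) => w A.
  rewrite nbhsE => -[B [[U oU UB] B0] BA].
  have U0 : U 0.
    by move: B0; rewrite -UB /= p0.
  have /nbhs_ballP[e /= e0 eU] : nbhs (0 : C) U by exact: open_nbhs_nbhs.
  have eE : e = (complex.Re e)%:C by move: e0; case: (e) => x y; rewrite ltcE /= => /andP[/eqP ->].
  exists [:: w], (complex.Re e); split; first by rewrite -ltcR -eE.
  move=> phi; rewrite /weak_ball /= big_seq1 => h; apply: BA; rewrite -UB /=.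
  by apply: eU; rewrite -ball_normE /= sub0r normrN cabsE eE ltcR.
have n1 : nbhs (L 0 : C) [set z : C | cabs z < 1].
  apply/nbhs_ballP; exists 1 => //= z; rewrite -ball_normE /= L0 sub0r normrN cabsE.
  by rewrite -[1 in X in X -> _]/(1%:C) ltcR.
have [s [e [e0 sL]]] : F [set phi | cabs (L phi) < 1] by exact: (F0 _ (cL 0 _ n1)).
exists s, e^-1; split; first by rewrite invr_ge0 ltW.
move=> phi; set N := \sum_(w <- s) _.
have N0 : 0 <= N by apply: sumr_ge0 => w _; exact: cabs_ge0.
apply/ler_addgt0Pr => d d0; have x0 : 0 < N + d * e by rewrite ltr_wpDl// mulr_gt0.
(* Scales [phi] into the ball even when all its seminorms vanish; $t^{-1} = N/e + d$ returns the
   slack [d]. *)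
pose t := e / (N + d * e); have t0 : 0 < t by rewrite divr_gt0.
have /sL : weak_ball s e (t%:C *: phi).
  rewrite /weak_ball /=; under eq_bigr do rewrite pZ cabsM cabs_real (gtr0_norm t0).
  rewrite -mulr_sumr -/N /t mulrAC ltr_pdivrMr// ltr_pM2l// ltrDl mulr_gt0//.
rewrite /= LZ cabsM cabs_real (gtr0_norm t0) => h.
have : cabs (L phi) < t^-1 by rewrite -[t^-1]mul1r ltr_pdivlMr// mulrC.
rewrite /t invf_div mulrDl mulfK ?gt_eqF// mulrC => /ltW.
by [].
Qed.

End weak_star_functionals.

(** * Boundary values of continuous functions on the closed ball *)

Section boundary_values.
Variables (R : realType) (d : nat).
Local Notation C := R[i].
Local Notation S := (usphere R d).
Local Notation T := (bsphere R d).
Local Notation mp := (mpoly d.+1 C).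
Implicit Types (F : 'rV[C]_d.+1 -> C) (p : mp).

Lemma continuous_pev p : continuous (pev p : 'rV[C]_d.+1 -> C).
Proof.
pose P (f : 'rV[C]_d.+1 -> C) := continuous f.
have Pc c : P (fun=> c) by move=> z; exact: (@cst_continuous _ _ c).
have PM f g : P f -> P g -> P (fun x => f x * g x).
  by move=> hf hg z; exact: (continuousM (hf z) (hg z)).
have PD f g : P f -> P g -> P (fun x => f x + g x).
  by move=> hf hg z; exact: (continuousD (hf z) (hg z)).
have Pe f g : f =1 g -> P g -> P f by move=> /funext ->.
rewrite -/(P _); elim/mpolyind: p => [|c m p _ _ IH].
  by apply: Pe (Pc 0) => x; rewrite pev0.
have mono : P (fun x => \prod_(i < d.+1) x 0 i ^+ m i).
  elim: (index_enum _) => [|i r IHr].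
    by apply: Pe (Pc 1) => x; rewrite big_nil.
  have pow : P (fun x => x 0 i ^+ m i).
    elim: (m i) => [|k IHk]; first exact: (Pc 1).
    have := PM _ _ (@coord_continuous C 1 d.+1 0 i) IHk.
    by apply: Pe => x; rewrite exprS.
  by apply: Pe (PM _ _ pow IHr) => x; rewrite big_cons.
apply: Pe (PD _ _ (PM _ _ (Pc c) mono) IH) => x.
by rewrite pevD pevZ /pev mevalX.
Qed.

Lemma sphere_closed_uball (x : S) : closed_uball (sval x).
Proof. by case: x => x /= /eqP hx; rewrite /closed_uball /= hx. Qed.

Lemma cmeas_boundary F : {within @closed_uball R d.+1, continuous F} ->
  cmeas (fun x : T => F (sval x)).
Proof.
move=> /subspace_continuousP cF.
have c : continuous (fun x : S => F (sval x) : C).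
  move=> x A /= nA.
  have h : nbhs (sval x) [set y | closed_uball y -> A (F y)].
    exact: (cF _ (sphere_closed_uball x) _ nA).
  have ic : continuous (sval : S -> 'rV[C]_d.+1) by exact: initial_continuous.
  have hx : nbhs x [set y : S | closed_uball (sval y) -> A (F (sval y))] := ic x _ h.
  change (nbhs x [set y : S | A (F (sval y))]).
  by apply: filterS hx => y /=; apply; exact: sphere_closed_uball.
split; apply: measurable_continuous => x.
  by apply: (@continuous_comp _ _ _ (fun x : S => F (sval x) : C) (@complex.Re R)); [exact: c|exact: continuous_Re].
by apply: (@continuous_comp _ _ _ (fun x : S => F (sval x) : C) (@complex.Im R)); [exact: c|exact: continuous_Im].
Qed.

Lemma boundary_le F (B : R) : {within @closed_uball R d.+1, continuous F} ->
  (forall z, nsq z < 1 -> cabs (F z) <= B) -> forall x : S, cabs (F (sval x)) <= B.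
Proof.
move=> /subspace_continuousP cF FB x; apply/ler_addgt0Pr => e e0.
have e1 : 0 < e%:C by rewrite ltcR.
have /= := cF _ (sphere_closed_uball x) _ (nbhsx_ballx (F (sval x) : C) e%:C e1).
rewrite nbhs_simpl /within /= => /nbhs_row[k k0 hk].
(* Smaller than both 1 and [k]: the radial point $(1-t)x$ is interior and within [k] of [x] in every
   coordinate. *)
pose t := k / (k + 1); have D0 : 0 < k + 1 by rewrite ltr_wpDl// ltW.
have t0 : 0 < t by rewrite divr_gt0.
have t1 : t < 1 by rewrite ltr_pdivrMr// mul1r ltrDl.
have tk : t < k by rewrite ltr_pdivrMr// ltr_pMr// ltrDr.
pose y := (1 - t)%:C *: sval x.
have t1' : 0 <= 1 - t by rewrite subr_ge0 ltW.
have y1 : nsq y < 1.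
  by rewrite nsqZ sphere_nsq mulr1 cabs_real ger0_norm// exprn_ilt1// gtrBl.
have := hk y; rewrite -ball_normE /= => h.
have {}h : cabs (F (sval x) - F y) < e.
  rewrite -ltcR -cabsE; apply: h.
    move=> j; rewrite (_ : _ - _ = (- t)%:C * sval x 0 j).
      rewrite cabsM cabs_real normrN (ger0_norm (ltW t0)).
      apply: le_lt_trans tk; rewrite ler_piMr ?(ltW t0)//.
      by apply: coord_le1; rewrite sphere_nsq.
    by rewrite mxE rmorphB rmorph1 rmorphN mulrBl mul1r addrAC subrr add0r mulNr.
  by rewrite /closed_uball /= hdot_nsq -[1]/(1%:C) lecR ltW.
rewrite -(subrK (F y) (F (sval x))); apply: (le_trans (cabsD _ _)).
by rewrite addrC lerD ?(ltW h)// FB.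
Qed.

End boundary_values.

(** * Polynomials as vectors of the space: rotations, orthogonality, density *)

Section poly_vectors.
Variables (R : realType) (d : nat) (H : rkhs R (uball R d.+1)).
Local Notation C := R[i].
Local Notation mp := (mpoly d.+1 C).
Hypothesis Hinv : unitarily_invariant H.
Hypothesis Hpoly : forall p : mp, is_multiplier H (poly_fun p).
Local Notation kp := (rkhs_point H).
Local Notation ev := (rkhs_eval H).
Implicit Types (p q : mp) (f g : H).

Definition pm p : Mult H := exist _ (poly_fun p) (asboolT (Hpoly p)).

Lemma nsq_uball (z : uball R d.+1) : nsq (sval z) < 1.
Proof. by case: z => z /=; rewrite hdot_nsq -[1]/(1%:C) ltcR. Qed.

Lemma uball_subproof (z : 'rV[C]_d.+1) : nsq z < 1 -> hdot z z < 1.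
Proof. by move=> z1; rewrite hdot_nsq -[1]/(1%:C) ltcR. Qed.

Definition upoint (z : 'rV[C]_d.+1) (z1 : nsq z < 1) : uball R d.+1 :=
  exist _ z (uball_subproof z1).

Lemma nsq0_lt1 : nsq (0 : 'rV[C]_d.+1) < 1. Proof. by rewrite nsq0. Qed.

(** As $a_0 = 1$ and $\langle z,0\rangle = 0$, the kernel function at the origin is the constant 1;
    multipliers thus embed in the space. *)
Definition one : H := kp (upoint nsq0_lt1).

Lemma kernelE z w : dt (kp w) (kp z) = rkhs_kernel H z w.
Proof. by rewrite -evE. Qed.

Lemma hdot0r n (z : 'rV[C]_n) : hdot z 0 = 0.
Proof. by rewrite /hdot big1// => i _; rewrite mxE conjc0 mulr0. Qed.

Lemma ev_one z : ev one z = 1.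
Proof.
have [a [a0 _ aK]] := Hinv; have := aK z (upoint nsq0_lt1).
rewrite /= hdot0r /rkhs_kernel -/one => cv.
apply: (cvg_complex_unique cv (cvg_cst (1 : C))); exists 1%N => n n0.
rewrite seriesEnat/= (big_ltn n0) expr0 a0 mulr1 big_nat big1 ?addr0// => i /andP[i0 _].
by rewrite expr0n gtn_eqF// mulr0.
Qed.

Definition pv p : H := mult_op (pm p) one.

Lemma ev_pv p z : ev (pv p) z = pev p (sval z).
Proof. by rewrite mult_opE ev_one mulr1. Qed.

Lemma pv_mul p q : mult_op (pm p) (pv q) = pv (p * q).
Proof. by apply: ev_inj => z; rewrite mult_opE !ev_pv pevM. Qed.

Lemma pvD p q : pv (p + q) = pv p + pv q.
Proof. by apply: ev_inj => z; rewrite evD !ev_pv pevD. Qed.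

Lemma pvZ a p : pv (a *: p) = a *: pv p.
Proof. by apply: ev_inj => z; rewrite evZ !ev_pv pevZ. Qed.

Lemma pv0 : pv 0 = 0.
Proof. by have := pvZ 0 0; rewrite !scale0r. Qed.

Lemma pv_sum (I : Type) (r : seq I) (P : pred I) (F : I -> mp) :
  pv (\sum_(i <- r | P i) F i) = \sum_(i <- r | P i) pv (F i).
Proof. by apply: (big_morph pv) => [p q|]; [exact: pvD|exact: pv0]. Qed.

Lemma pm_mul p q f : mult_op (pm (p * q)) f = mult_op (pm p) (mult_op (pm q) f).
Proof. by apply: ev_inj => z; rewrite !mult_opE /= /poly_fun mevalM mulrA. Qed.

Lemma hn_le_kernel g (B : R) : 0 <= B ->
  (forall s, cabs (dt g (kernel_comb H s)) <= B * hn (kernel_comb H s)) -> hn g <= B.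
Proof.
move=> B0 gB; rewrite leNgt; apply/negP => Bg.
have g0 : 0 < hn g by apply: le_lt_trans Bg.
pose e := (hn g - B) / 4; have e0 : 0 < e by rewrite divr_gt0// subr_gt0.
have [s gs] := kernel_dense g e0; set y := kernel_comb H s in gs.
have y1 : hn y <= hn g + e.
  by have := hn_dist y g 0; rewrite !subr0 (hnC y g); move: gs; move: (hn _) (hn _) (hn _) (e) => *; lra.
have : hn g ^+ 2 <= hn g * e + B * (hn g + e).
  have -> : hn g ^+ 2 = cabs (dt g g) by rewrite dt_sqr cabs_real ger0_norm ?sqr_ge0.
  rewrite -[X in cabs (dt _ X)](subrK y) dtDr; apply: (le_trans (cabsD _ _)).
  apply: lerD; first by apply: (le_trans (dt_le _ _)); rewrite ler_wpM2l ?hn_ge0// ltW.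
  by apply: (le_trans (gB s)); rewrite ler_wpM2l.
have eE : 4 * e = hn g - B by rewrite /e; lra.
move: e e0 eE {gs y1 y} => e e0 eE; move: (hn g) Bg g0 eE => G BG G0 eE; nra.
Qed.

Lemma kernel_rotate (l : C) z w z' w' : cabs l = 1 ->
  sval z' = l *: sval z -> sval w' = l *: sval w ->
  rkhs_kernel H z' w' = rkhs_kernel H z w.
Proof.
move=> l1 zE wE; have [a [_ _ aK]] := Hinv.
have := aK z' w'; rewrite zE wE hdotZl hdotC hdotZl rmorphM/= -hdotC mulrA -cabs_mulJ l1.
rewrite expr1n mul1r => h; apply: (cvg_complex_unique h (aK z w)).
by exists 0%N.
Qed.

Lemma rotate_lt1 (l : C) (z : uball R d.+1) : cabs l = 1 -> nsq (l *: sval z) < 1.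
Proof. by move=> l1; rewrite nsqZ l1 expr1n mul1r nsq_uball. Qed.

(** The kernel is invariant under rotations, so a kernel combination and its rotated copy have equal
    norms; duality with such combinations carries this to all vectors. *)
Lemma hn_rotate (l : C) (l1 : cabs l = 1) f g :
  (forall z, ev g z = ev f (upoint (rotate_lt1 z l1))) -> hn g <= hn f.
Proof.
move=> gf; apply: hn_le_kernel; first exact: hn_ge0.
move=> s; pose t := [seq (c.1, upoint (rotate_lt1 c.2 l1)) | c <- s].
have -> : dt g (kernel_comb H s) = dt f (kernel_comb H t).
  by rewrite !dt_kernel_comb /t big_map; apply: eq_bigr => c _; rewrite gf.
have -> : hn (kernel_comb H s) = hn (kernel_comb H t).
  apply/eqP; rewrite -(@eqrXn2 _ 2) ?hn_ge0//; apply/eqP/complexI.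
  rewrite -!dt_sqr !dt_kernel_comb /t big_map; apply: eq_bigr => c _ /=.
  congr (_ * _); rewrite !evE /kernel_comb !dt_suml big_map; apply: eq_bigr => e _ /=.
  by rewrite !dtZl !kernelE; congr (_ * _); rewrite (kernel_rotate l1 (z' := upoint _) (w' := upoint _) erefl erefl).
exact: dt_le.
Qed.

Definition homog n p := forall (l : C) z, pev p (l *: z) = l ^+ n * pev p z.

Lemma homog_orth n m p q : homog n p -> homog m q -> n != m -> dt (pv p) (pv q) = 0.
Proof.
(* Both degrees lie below [N], so a primitive [N]-th root of unity has different powers [n] and
   [m]. *)
move=> hp hq nm; pose N := (n + m).+1.
have [l pl] := prim_root_exists R (ltn0Sn (n + m)).
have l1 := cabs_prim_root pl.
have l0 : l != 0 by rewrite -cabs_eq0 l1 oner_eq0.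
have mu1 : l ^+ n != l ^+ m.
  rewrite (eq_prim_root_expr pl) /N !modn_small//; rewrite ltnS ?leq_addr ?leq_addl//.
have iso c : hn (pv p + c *: pv q) = hn (l ^+ n *: pv p + c *: (l ^+ m *: pv q)).
  have lJ1 : cabs l^-1 = 1 by rewrite cabsV l1 invr1.
  apply/le_anti/andP; split.
    apply: (hn_rotate (l1 := lJ1)) => z; rewrite !(evD, evZ) !ev_pv /= hp hq.
    by rewrite !mulrA -[c * _ * _]mulrA -!exprMn divff// !expr1n !mul1r mulr1.
  by apply: (hn_rotate (l1 := l1)) => z; rewrite !(evD, evZ) !ev_pv /= hp hq.
have re c : complex.Re (dt (pv p) (c *: pv q)) =
    complex.Re (dt (l ^+ n *: pv p) (c *: (l ^+ m *: pv q))).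
  have := congr1 (fun x => x ^+ 2) (iso c); rewrite !hn_sqrD !hnZ !cabsX l1 !expr1n !mul1r.
  by move=> /addrI; lra.
(* With $c = x$ the equality of real parts [re] reads $|x|^2 = 0$. *)
pose x := dt (pv p) (pv q) * (1 - l ^+ n * (l ^+ m)^*%C).
have x0 : x = 0.
  apply/eqP; rewrite -cabs_eq0 -sqrf_eq0.
  have -> : cabs x ^+ 2 = complex.Re (x * x^*%C) by rewrite -cabs_mulJ.
  have := re x; rewrite !dtZr dtZl => /eqP; rewrite -subr_eq0 -cReN -cReD => /eqP h.
  by apply/eqP; rewrite -h; congr complex.Re; rewrite {1}/x; ring.
move: x0 => /eqP; rewrite mulf_eq0 => /orP[/eqP//|].
rewrite subr_eq0 => /eqP h; case/eqP: mu1.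
by rewrite -[RHS]mul1r h -mulrA [_^*%C * _]mulrC -cabs_mulJ cabsX l1 !expr1n mulr1.
Qed.

Lemma tensor_expr n (z w : 'rV[C]_d.+1) : hdot z w ^+ n =
  \sum_(t : {ffun 'I_n -> 'I_d.+1}) (\prod_i z 0 (t i)) * (\prod_i w 0 (t i))^*%C.
Proof.
rewrite -[n in LHS]card_ord -prodr_const /hdot bigA_distr_bigA/=.
by apply: eq_bigr => t _; rewrite big_split rmorph_prod.
Qed.

(** The homogeneous term $a_n\langle z,w\rangle^n$ of the kernel function at [w], as a polynomial in
    [z]. *)
Definition kterm (a : nat -> R) n (w : 'rV[C]_d.+1) : mp :=
  (a n)%:C *: (\sum_i (w 0 i)^*%C *: mpolyX C (mnm1 i)) ^+ n.

Lemma pev_kterm a n w z : pev (kterm a n w) z = (a n)%:C * hdot z w ^+ n.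
Proof.
rewrite /kterm pevZ; congr (_ * _).
have -> : hdot z w = pev (\sum_i (w 0 i)^*%C *: mpolyX C (mnm1 i)) z.
  by rewrite pev_sum; apply: eq_bigr => i _; rewrite pevZ pevX mulrC.
elim: n => [|n IH]; first by rewrite !expr0 pev1.
by rewrite !exprS pevM IH.
Qed.

Lemma homog_kterm a n w : homog n (kterm a n w).
Proof. by move=> l z; rewrite !pev_kterm hdotZl exprMn; ring. Qed.

(* The tensor powers of the points turn the kernel into a sum of Gram matrices. *)
Lemma kterm_bound a n (w : uball R d.+1) : a 0%N = 1 -> (forall n, 0 < a n) ->
  (forall z w : uball R d.+1,
    series (fun n => (a n)%:C * hdot (sval z) (sval w) ^+ n) @ \oo --> rkhs_kernel H z w) ->
  hn (pv (kterm a n (sval w))) ^+ 2 <= a n * nsq (sval w) ^+ n.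
Proof.
move=> a0 apos aK; have an0 := ltW (apos n).
have B0 : 0 <= a n * nsq (sval w) ^+ n by rewrite mulr_ge0// exprn_ge0// nsq_ge0.
rewrite -(sqr_sqrtr B0) ler_pXn2r ?nnegrE ?hn_ge0 ?sqrtr_ge0//.
apply: hn_le_kernel; first exact: sqrtr_ge0.
(* The coordinates of a combination of tensor powers of the points. The squared norm of the kernel
   combination is $\sum_k a_k G_k$ with nonnegative terms, so $a_n G_n$ alone is at most that norm,
   and Cauchy-Schwarz for tensors finishes. *)
move=> s; pose E k (t : {ffun 'I_k -> 'I_d.+1}) : C :=
  \sum_(c <- s) c.1^*%C * \prod_i (sval c.2) 0 (t i).
pose G k : R := \sum_(t : {ffun 'I_k -> 'I_d.+1}) cabs (E k t) ^+ 2.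
have G0 k : 0 <= G k by apply: sumr_ge0 => t _; exact: sqr_ge0.
have GE k : (G k)%:C = \sum_(c <- s) \sum_(e <- s)
    c.1 * e.1^*%C * hdot (sval e.2) (sval c.2) ^+ k.
  rewrite /G rmorph_sum.
  under eq_bigr => t _ do rewrite /= cabs_mulJ {2}/E rmorph_sum mulr_sumr.
  rewrite exchange_big/=; apply: eq_bigr => c _.
  under eq_bigr => t _ do rewrite /E mulr_suml.
  rewrite exchange_big/=; apply: eq_bigr => e _.
  rewrite tensor_expr mulr_sumr; apply: eq_bigr => t _.
  by rewrite rmorphM/= conjcK; ring.
have hnG : a n * G n <= hn (kernel_comb H s) ^+ 2.
  have cv : (fun N => \sum_(0 <= k < N) a k * G k) @ \oo --> hn (kernel_comb H s) ^+ 2.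
    have -> : hn (kernel_comb H s) ^+ 2 = complex.Re (\sum_(c <- s) \sum_(e <- s)
        c.1 * e.1^*%C * rkhs_kernel H e.2 c.2).
      have -> : hn (kernel_comb H s) ^+ 2 = complex.Re (dt (kernel_comb H s) (kernel_comb H s)).
        by rewrite dt_sqr.
      congr complex.Re; rewrite {1}/kernel_comb dt_suml; apply: eq_bigr => c _.
      rewrite dtZl /kernel_comb dt_sumr mulr_sumr; apply: eq_bigr => e _.
      by rewrite dtZr kernelE mulrA.
    have -> : (fun N => \sum_(0 <= k < N) a k * G k) = (fun N => complex.Re
        (\sum_(c <- s) \sum_(e <- s) c.1 * e.1^*%C *
          series (fun n => (a n)%:C * hdot (sval e.2) (sval c.2) ^+ n) N)).
      apply/funext => N.
      have -> : \sum_(0 <= k < N) a k * G k = complex.Re (\sum_(0 <= k < N) (a k)%:C * (G k)%:C).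
        by rewrite cRe_sum; apply: eq_bigr => k _; rewrite -rmorphM.
      congr complex.Re; under eq_bigr => k _ do rewrite GE mulr_sumr.
      rewrite exchange_big; apply: eq_bigr => c _.
      under eq_bigr => k _ do rewrite mulr_sumr.
      rewrite exchange_big; apply: eq_bigr => e _.
      by rewrite seriesEnat/= mulr_sumr; apply: eq_bigr => k _; rewrite mulrCA.
    apply: (@continuous_cvg _ _ _ _ _ _ (@complex.Re R)); first exact: continuous_Re.
    apply: cvg_sum_seq => c; apply: cvg_sum_seq => e.
    by apply: cvgM; [exact: cvg_cst|exact: aK].
  have gt0 k : 0 <= a k * G k by rewrite mulr_ge0// ltW.
  rewrite -(cvg_lim (@Rhausdorff R) cv); apply: limr_ge; first by apply/cvg_ex; eexists; exact: cv.
  exists n.+1 => // N /= nN; rewrite (big_cat_nat (n := n.+1))//= big_nat_recr//=.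
  rewrite addrAC lerDr addr_ge0//.
    by apply: sumr_ge0 => k _.
  by apply: sumr_ge0 => k _.
have dE : dt (pv (kterm a n (sval w))) (kernel_comb H s) =
    (a n)%:C * \sum_t E n t * (\prod_i (sval w) 0 (t i))^*%C.
  rewrite dt_kernel_comb mulr_sumr.
  under [RHS]eq_bigr => t _ do rewrite /E mulr_suml mulr_sumr.
  rewrite exchange_big/=; apply: eq_bigr => c _.
  rewrite ev_pv pev_kterm tensor_expr !mulr_sumr; apply: eq_bigr => t _.
  by rewrite !mulrA; congr (_ * _); rewrite -!mulrA mulrCA.
have wE : \sum_(t : {ffun 'I_n -> 'I_d.+1}) cabs (\prod_i (sval w) 0 (t i)) ^+ 2 =
    nsq (sval w) ^+ n.
  apply: complexI; rewrite rmorph_sum rmorphXn /= -hdot_nsq tensor_expr.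
  by apply: eq_bigr => t _; rewrite /= -cabs_mulJ.
rewrite -(@ler_pXn2r _ 2) ?nnegrE ?cabs_ge0 ?mulr_ge0 ?sqrtr_ge0 ?hn_ge0//.
rewrite dE cabsM cabs_real (ger0_norm an0) !exprMn sqr_sqrtr//.
have := sum_cauchy_schwarz (E n) (fun t : {ffun 'I_n -> 'I_d.+1} => \prod_i (sval w) 0 (t i)).
rewrite wE -/(G n) => h.
apply: (le_trans (ler_wpM2l (sqr_ge0 (a n)) h)).
rewrite expr2 -!mulrA ler_wpM2l// [_ * (_ * _)]mulrA mulrC ler_wpM2l//.
by rewrite exprn_ge0// nsq_ge0.
Qed.

(** Let $p_N$ be the partial sum of the kernel series at [w] and $A_N$ its value at [w].
    Reproduction gives $\langle k_w,p_N\rangle = A_N$, orthogonality of degrees gives $\|p_N\|^2 \le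
    A_N$, and $A_N$ tends to $\|k_w\|^2$. *)
Lemma kernel_poly (w : uball R d.+1) (e : R) : 0 < e -> exists p, hn (kp w - pv p) < e.
Proof.
move=> e0; have [a [a0 apos aK]] := Hinv.
pose A N : R := \sum_(0 <= k < N) a k * nsq (sval w) ^+ k.
have cA : A @ \oo --> hn (kp w) ^+ 2.
  have -> : hn (kp w) ^+ 2 = complex.Re (rkhs_kernel H w w) by rewrite -kernelE dt_sqr.
  have -> : A = @complex.Re R \o series (fun n => (a n)%:C * hdot (sval w) (sval w) ^+ n).
    apply/funext => N; rewrite /A /= seriesEnat /= cRe_sum; apply: eq_bigr => k _.
    by rewrite hdot_nsq -rmorphXn -rmorphM.
  by apply: (@continuous_cvg _ _ _ _ _ _ (@complex.Re R)); [exact: continuous_Re|exact: aK].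
have e20 : 0 < e ^+ 2 by rewrite exprn_gt0.
have /cvgrPdist_lt/(_ _ e20)[N _ /(_ N (leqnn N)) /= AN] := cA.
exists (\sum_(0 <= k < N) kterm a k (sval w)).
set p := \sum_(_ <= _ < _) _.
have sE : hn (pv p) ^+ 2 <= A N.
  have orth m n : m != n -> dt (pv (kterm a m (sval w))) (pv (kterm a n (sval w))) = 0.
    by move=> mn; exact: (homog_orth (homog_kterm _ _ _) (homog_kterm _ _ _) mn).
  rewrite /A /p; elim: (N) => [|m IH]; first by rewrite !big_geq// pv0 hn0 expr0n.
  rewrite !big_nat_recr//= pvD hn_sqrD.
  rewrite [dt _ _](_ : _ = 0) ?mulr0 ?addr0 ?lerD ?kterm_bound//.
  rewrite pv_sum dt_suml big_nat big1// => k /andP[_ km].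
  by rewrite orth// ltn_eqF.
have pE : complex.Re (dt (kp w) (pv p)) = A N.
  rewrite dtC cReJ -evE ev_pv /p pev_sum cRe_sum; apply: eq_bigr => k _.
  by rewrite pev_kterm hdot_nsq -rmorphXn -rmorphM.
rewrite -(@ltr_pXn2r _ 2) ?nnegrE ?hn_ge0 ?(ltW e0)// hn_sqrB pE.
apply: le_lt_trans AN; apply: le_trans (ler_norm _).
by move: (_ ^+ 2) (hn (kp w) ^+ 2) (A N) sE => *; lra.
Qed.

Lemma poly_dense f (e : R) : 0 < e -> exists p, hn (f - pv p) < e.
Proof.
move=> e0; have [||h hP|_ [p ->] hp] :=
  @total_dense R _ H (fun y => exists p, y = pv p) _ _ _ f e e0.
- by exists 0; rewrite pv0.
- by move=> b _ _ [p ->] [q ->]; exists (b *: p + q); rewrite pvD pvZ.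
- apply/eqP; rewrite -hn_eq0 eq_le hn_ge0 andbT.
  have hk w : dt h (kp w) = 0.
    apply/eqP; rewrite -cabs_eq0 eq_le cabs_ge0 andbT.
    apply/ler_addgt0Pr => t t0; rewrite add0r.
    have h1 : 0 < hn h + 1 by rewrite ltr_wpDl ?hn_ge0.
    have [p hp] := kernel_poly w (divr_gt0 t0 h1).
    rewrite -[kp w](subrK (pv p)) dtDr (hP (pv p)); last by exists p.
    rewrite addr0; apply: (le_trans (dt_le _ _)).
    move: hp; rewrite ltr_pdivlMr// => /ltW; apply: le_trans.
    by rewrite mulrC ler_wpM2l ?hn_ge0// lerDl.
  have -> : h = 0 by apply: ev_inj => z; rewrite evE hk evE dt0l.
  by rewrite hn0.
- by exists p.
Qed.

(** An upper bound rather than the value [mult_norm], which lives in the extended reals; it is the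
    instance of the abstract [Nb] of the band section. *)
Definition Nb p (M : R) := forall f, hn (mult_op (pm p) f) <= M * hn f.

Lemma hn_one_gt0 : 0 < hn one.
Proof.
rewrite lt_neqAle hn_ge0 eq_sym andbT hn_eq0; apply/eqP => o0.
have := ev_one (upoint nsq0_lt1); rewrite o0 evE dt0l => /eqP.
by rewrite eq_sym oner_eq0.
Qed.

Lemma Nb_ge0 p M : Nb p M -> 0 <= M.
Proof.
move=> pM; have := le_trans (hn_ge0 _) (pM one).
by rewrite pmulr_lge0// hn_one_gt0.
Qed.

Lemma Nb_exists p : exists2 M, 0 <= M & Nb p M.
Proof. exact: mult_op_bounded. Qed.

Lemma Nb_mul q : exists2 K, 0 <= K & forall p M, Nb p M -> Nb (q * p) (K * M).
Proof.
have [K K0 hK] := Nb_exists q; exists K => // p M pM f.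
rewrite pm_mul; apply: (le_trans (hK _)); rewrite -mulrA ler_wpM2l//.
Qed.

Lemma NbD p q M N : Nb p M -> Nb q N -> Nb (p + q) (M + N).
Proof.
move=> pM qN f; have -> : mult_op (pm (p + q)) f = mult_op (pm p) f + mult_op (pm q) f.
  by apply: ev_inj => z; rewrite evD !mult_opE /= /poly_fun mevalD mulrDl.
by rewrite mulrDl (le_trans (hnD _ _))// lerD.
Qed.

Lemma NbN p M : Nb p M -> Nb (- p) M.
Proof.
move=> pM f; have -> : mult_op (pm (- p)) f = - mult_op (pm p) f.
  by apply: ev_inj => z; rewrite -[- mult_op _ _]scaleN1r evZ !mult_opE /= /poly_fun mevalN mulNr mulN1r.
by rewrite hnN.
Qed.

(** Inside the ball, $p(z)\|k_z\|^2 = \langle p k_z, k_z\rangle$. A sphere point is approached along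
    its radius, with the derivative bounded by the coefficients on the segment. *)
Lemma Nb_bnd p M : Nb p M -> bnd p 1 M.
Proof.
move=> pM; have M0 := Nb_ge0 pM.
have inner z : nsq z < 1 -> cabs (pev p z) <= M.
  move=> z1; pose k := kp (upoint z1).
  have k0 : 0 < hn k.
    rewrite lt_neqAle hn_ge0 eq_sym andbT hn_eq0; apply/eqP => o0.
    have := ev_one (upoint z1); rewrite evE -/k o0 dt0r => /eqP.
    by rewrite eq_sym oner_eq0.
  have := le_trans (dt_le (mult_op (pm p) k) k) (ler_wpM2r (hn_ge0 k) (pM k)).
  rewrite -evE mult_opE evE dt_sqr cabsM cabs_real ger0_norm ?exprn_ge0 ?hn_ge0//.
  by rewrite -mulrA -expr2 ler_pM2r// exprn_gt0.
move=> z z1; have [/inner//|z1'] := ltP (nsq z) 1.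
have zE : nsq z = 1 by apply/le_anti/andP.
apply/ler_addgt0Pr => e e0.
pose q := lin 0 z p.
have qE (t : R) : q.[t%:C] = pev p (t%:C *: z) by rewrite horner_lin add0r.
pose B := \sum_(i < size q^`()) cabs q^`()`_i.
have B0 : 0 <= B by apply: sumr_ge0 => i _; exact: cabs_ge0.
have qB (t : R) : 0 <= t <= 1 -> cabs q^`().[t%:C] <= B.
  move=> /andP[t0 t1]; rewrite horner_coef; apply: (le_trans (cabs_sum _ _ _)).
  apply: ler_sum => i _; rewrite cabsM ler_piMr ?cabs_ge0// cabsX cabs_real.
  by rewrite ger0_norm// exprn_ile1.
pose t := e / (e + 2 * B + 1).
have D0 : 0 < e + 2 * B + 1 by move: (B) B0 => *; lra.
have t0 : 0 < t by rewrite divr_gt0.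
have t1 : t < 1 by rewrite ltr_pdivrMr// mul1r; move: (B) B0 => *; lra.
have tB : 2 * B * t <= e.
  rewrite /t mulrA ler_pdivrMr// [2 * B * e]mulrC ler_pM2l//; move: (B) B0 => *; lra.
have h1 : cabs (pev p z - pev p ((1 - t)%:C *: z)) <= 2 * B * t.
  have := @poly_mean_value R q (1 - t) 1 B.
  rewrite !qE scale1r opprB addrCA subrr addr0; apply; first by rewrite gtrBl.
  move=> s /andP[ts s1]; apply: qB; rewrite (ltW s1) andbT.
  by apply: le_trans (ltW ts); rewrite subr_ge0 ltW.
have h2 : cabs (pev p ((1 - t)%:C *: z)) <= M.
  apply: inner; rewrite nsqZ zE mulr1 cabs_real ger0_norm ?subr_ge0 ?(ltW t1)//.
  by rewrite exprn_ilt1 ?subr_ge0 ?(ltW t1)// gtrBl.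
rewrite -(subrK (pev p ((1 - t)%:C *: z)) (pev p z)).
apply: (le_trans (cabsD _ _)); rewrite addrC lerD//.
exact: (le_trans h1).
Qed.

(* A sesquilinear bound can be tested on the quadratic form
   [|a|^2 + |b|^2], scaling the two vectors against each other. *)
Lemma Nb_quadratic p M : 0 <= M ->
  (forall a b, complex.Re (dt (pv (p * a)) (pv b)) <=
     M * (hn (pv a) ^+ 2 + hn (pv b) ^+ 2) / 2) -> Nb p M.
Proof.
move=> M0 h.
have on_poly a : hn (pv (p * a)) <= M * hn (pv a).
  have sq x : 0 < x -> x * hn (pv (p * a)) ^+ 2 *+ 2 <= M * (hn (pv a) ^+ 2 + x ^+ 2 * hn (pv (p * a)) ^+ 2).
    move=> x0; have := h a (x%:C *: (p * a)).
    rewrite pvZ hnZ cabs_real (ger0_norm (ltW x0)) exprMn dtZr conjc_real dt_sqr -rmorphM /=.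
    by rewrite ler_pdivlMr// mulr_natr.
  have [->|A0] := eqVneq (hn (pv (p * a))) 0; first by rewrite mulr_ge0// hn_ge0.
  have {}A0 : 0 < hn (pv (p * a)) by rewrite lt_neqAle eq_sym A0 hn_ge0.
  have [a0|a0] := eqVneq (hn (pv a)) 0.
    have : pv (p * a) = 0.
      by rewrite -pv_mul; move/eqP: a0; rewrite hn_eq0 => /eqP ->; rewrite mult_op0.
    by move=> A00; move: A0; rewrite A00 hn0 ltxx.
  have {}a0 : 0 < hn (pv a) by rewrite lt_neqAle eq_sym a0 hn_ge0.
  (* The scaling at which both squared norms of the quadratic form are equal. *)
  have x0 : 0 < hn (pv a) / hn (pv (p * a)) by rewrite divr_gt0.
  have := sq _ x0; move: A0 a0; move: (hn (pv (p * a))) (hn (pv a)) => u v u0 v0.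
  have -> : v / u * u ^+ 2 *+ 2 = 2 * v * u by field; rewrite gt_eqF.
  have -> : M * (v ^+ 2 + (v / u) ^+ 2 * u ^+ 2) = 2 * v * (M * v) by field; rewrite gt_eqF.
  by rewrite ler_pM2l// mulr_gt0.
move=> f; apply/ler_addgt0Pr => e e0.
have [K K0 hK] := Nb_exists p.
have D0 : 0 < K + M + 1 by rewrite ltr_wpDl// addr_ge0.
have [a fa] := poly_dense f (divr_gt0 e0 D0).
have -> : mult_op (pm p) f = mult_op (pm p) (f - pv a) + pv (p * a).
  by rewrite mult_opB pv_mul subrK.
apply: (le_trans (hnD _ _)).
have h1 := hK (f - pv a); have h2 := on_poly a.
have h3 : hn (pv a) <= hn (f - pv a) + hn f.
  by rewrite (hnC f) -[X in hn X <= _](subrK f) hnD.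
move: fa; rewrite ltr_pdivlMr// => fa.
have h4 := ler_wpM2l M0 h3; have h5 := hn_ge0 (f - pv a).
move: h1 h2 h4 h5 fa; move: (hn (mult_op (pm p) (f - pv a))) (hn (pv (p * a))) (hn (f - pv a)) (hn (pv a)) (hn f).
move=> x1 x2 x5 x3 x4; clear -M0; move=> *; lra.
Qed.

(** * Fejer means are contractive for the multiplier norm *)

Section fejer.
Implicit Types (a b : mp) (F : seq (mp * mp)).

Lemma homogX (m : multinom d.+1) : homog (mdeg m) (mpolyX C m).
Proof.
move=> l z; have := homog_hompart (mdeg m) (mpolyX C m) l z.
by rewrite /hompart wtX eqxx scale1r.
Qed.

(* The compressions to the windows of [N] consecutive degrees average to the
   Fejer mean. *)
Lemma fejer_identity (N : nat) p a b : (0 < N)%N -> exists S0, forall S, (S0 <= S)%N ->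
  N%:R * dt (pv (fejer N p * a)) (pv b) =
  \sum_(0 <= s < S) dt (pv (p * window N s a)) (pv (window N s b)).
Proof.
move=> N0; have NN0 : N%:R != 0 :> R by rewrite pnatr_eq0 -lt0n.
pose P p a b := exists S0, forall S, (S0 <= S)%N ->
  N%:R * dt (pv (fejer N p * a)) (pv b) =
  \sum_(0 <= s < S) dt (pv (p * window N s a)) (pv (window N s b)).
have comb (c : C) (X Y : C) (x y : nat -> C) :
  (exists S0, forall S, (S0 <= S)%N -> X = \sum_(0 <= s < S) x s) ->
  (exists S0, forall S, (S0 <= S)%N -> Y = \sum_(0 <= s < S) y s) ->
  exists S0, forall S, (S0 <= S)%N -> c * X + Y = \sum_(0 <= s < S) (c * x s + y s).
  move=> [S0 h0] [S1 h1]; exists (maxn S0 S1) => S; rewrite geq_max => /andP[/h0 -> /h1 ->].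
  by rewrite mulr_sumr -big_split.
have zero (X : C) (x : nat -> C) : X = 0 -> (forall s, x s = 0) ->
  exists S0, forall S, (S0 <= S)%N -> X = \sum_(0 <= s < S) x s.
  by move=> -> x0; exists 0%N => S _; rewrite big1.
have cong (X Y : C) (x y : nat -> C) : X = Y -> (forall s, x s = y s) ->
  (exists S0, forall S, (S0 <= S)%N -> Y = \sum_(0 <= s < S) y s) ->
  exists S0, forall S, (S0 <= S)%N -> X = \sum_(0 <= s < S) x s.
  move=> -> xy [S0 h]; exists S0 => S /h ->; exact/eq_bigr.
change (P p a b).
(* Both sides are linear in [p] and [a] and conjugate-linear in [b], so monomials suffice;
   orthogonality of degrees leaves the case counted by [sum_windows]. *)
elim/mpoly_lin_ind: p => [m||c p q IHp IHq]; last 2 first.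
- by apply: zero => [|s]; rewrite /fejer ?wt0 mul0r pv0 dt0l ?mulr0.
- apply: cong (comb c _ _ _ _ IHp IHq) => [|s].
    by rewrite /fejer wt_lin mulrDl -scalerAl pvD pvZ dtDl dtZl mulrDr mulrCA.
  by rewrite mulrDl -scalerAl pvD pvZ dtDl dtZl.
elim/mpoly_lin_ind: a => [j||c p q IHp IHq]; last 2 first.
- by apply: zero => [|s]; rewrite /window ?wt0 mulr0 pv0 dt0l ?mulr0.
- apply: cong (comb c _ _ _ _ IHp IHq) => [|s].
    by rewrite mulrDr -scalerAr pvD pvZ dtDl dtZl mulrDr mulrCA.
  by rewrite /window wt_lin mulrDr -scalerAr pvD pvZ dtDl dtZl.
elim/mpoly_lin_ind: b => [l||c p q IHp IHq]; last 2 first.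
- by apply: zero => [|s]; rewrite /window ?wt0 pv0 dt0r ?mulr0.
- apply: cong (comb (c^*)%C _ _ _ _ IHp IHq) => [|s].
    by rewrite pvD pvZ dtDr dtZr mulrDr mulrCA.
  by rewrite /window wt_lin pvD pvZ dtDr dtZr.
rewrite /P /fejer wtX -scalerAl pvZ dtZl mulrA.
have -> : N%:R * ((N - mdeg m)%:R / N%:R : R)%:C = (N - mdeg m)%:R.
  by rewrite -(rmorph_nat (real_complex R)) -rmorphM mulrCA divff// mulr1 rmorph_nat.
exists (mdeg m + mdeg j + N)%N => S hS.
under eq_bigr => s _ do rewrite /window !wtX -scalerAr !pvZ dtZr dtZl conjc_nat mulrA -natrM.
rewrite -mulr_suml -natr_sum.
have [lE|lN] := eqVneq (mdeg l) (mdeg m + mdeg j)%N; last first.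
  suff -> : dt (pv (mpolyX C m * mpolyX C j)) (pv (mpolyX C l)) = 0 by rewrite !mulr0.
  rewrite -mpolyXD; apply: (homog_orth (homogX _) (homogX _)).
  by rewrite mdegD eq_sym.
congr (_%:R * _); rewrite -(sum_windows hS).
apply: eq_bigr => s _; rewrite lE.
by case: (_ <= s < _)%N; case: (_ <= s < _)%N.
Qed.

Lemma fejer1 N : (0 < N)%N -> fejer N (1 : mp) = 1.
Proof.
move=> N0; rewrite -mpolyX0 /fejer wtX mdeg0 subn0 divff ?scale1r//.
by rewrite pnatr_eq0 -lt0n.
Qed.

Lemma window_sqr (N : nat) a : (0 < N)%N -> exists S0, forall S, (S0 <= S)%N ->
  \sum_(0 <= s < S) hn (pv (window N s a)) ^+ 2 = N%:R * hn (pv a) ^+ 2.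
Proof.
move=> N0; have [S0 h] := fejer_identity 1 a a N0; exists S0 => S /h.
rewrite fejer1// mul1r dt_sqr => hS; apply: complexI; rewrite rmorphM rmorph_nat hS.
by rewrite rmorph_sum; apply: eq_bigr => s _; rewrite mul1r dt_sqr.
Qed.

(** The form of the Fejer mean is the average of the form of [p] over windows, and by [window_sqr]
    the squared norms of the windows of a vector add up to [N] times its squared norm. *)
Lemma Nb_fejer (N : nat) p M : (0 < N)%N -> Nb p M -> Nb (fejer N p) M.
Proof.
move=> N0 pM; have M0 := Nb_ge0 pM.
have NN0 : 0 < N%:R :> R by rewrite ltr0n.
apply: Nb_quadratic => // a b.
have [S0 h0] := fejer_identity p a b N0; have [S1 h1] := window_sqr a N0.
have [S2 h2] := window_sqr b N0; pose S := maxn S0 (maxn S1 S2).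
have {}h0 := h0 S (leq_maxl _ _).
have {}h1 : _ := h1 S (leq_trans (leq_maxl _ _) (leq_maxr _ _)).
have {}h2 : _ := h2 S (leq_trans (leq_maxr _ _) (leq_maxr _ _)).
rewrite -(ler_pM2l NN0).
have -> : N%:R * complex.Re (dt (pv (fejer N p * a)) (pv b)) =
    complex.Re (N%:R * dt (pv (fejer N p * a)) (pv b)).
  by rewrite -(rmorph_nat (real_complex R)) cReM mul0r subr0.
rewrite h0 cRe_sum.
have -> : N%:R * (M * (hn (pv a) ^+ 2 + hn (pv b) ^+ 2) / 2) =
    \sum_(0 <= s < S) (M * (hn (pv (window N s a)) ^+ 2 + hn (pv (window N s b)) ^+ 2) / 2).
  rewrite -mulr_suml -mulr_sumr big_split/=.
  rewrite [X in _ = M * (X + _) / _]h1 [X in _ = M * (_ + X) / _]h2.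
  move: (N%:R) (hn (pv a) ^+ 2) (hn (pv b) ^+ 2) => x y z.
  by ring.
apply: ler_sum => s _; rewrite -pv_mul.
apply: (le_trans (ler_norm _)); apply: (le_trans (Re_le_cabs _)).
apply: (le_trans (dt_le _ _)); apply: le_trans (ler_wpM2r (hn_ge0 _) (pM _)) _.
exact: mul_le_sqr.
Qed.

End fejer.

(** * Approximation of functionals by finite sums of vector functionals *)

Section functionals.
Implicit Types (a b : mp) (F : seq (mp * mp)) (L : mp -> C).

Definition lin_fun L := forall c p q, L (c *: p + q) = c * L p + L q.
Definition pair_sum F p : C := \sum_(ab <- F) dt (pv (p * ab.1)) (pv ab.2).
Definition pair_mass F : R := \sum_(ab <- F) (hn (pv ab.1) ^+ 2 + hn (pv ab.2) ^+ 2).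
(** It multiplies both [pair_sum] and [pair_mass] by $t^2$, and concatenation adds them; lists of
    bounded mass thus represent a convex set of functionals. Half of the mass bounds the norm,
    whence the masses $2c$ below. *)
Definition pair_scale (t : R) F := [seq (t%:C *: ab.1, t%:C *: ab.2) | ab : mp * mp <- F].

Lemma lin_fun0 L : lin_fun L -> L 0 = 0.
Proof. by move=> LL; have := LL (-1) 0 0; rewrite scaler0 addr0 mulN1r addNr. Qed.

Lemma lin_funD L p q : lin_fun L -> L (p + q) = L p + L q.
Proof. by move=> LL; have := LL 1 p q; rewrite scale1r mul1r. Qed.

Lemma lin_fun_sum L (I : Type) (r : seq I) (c : I -> C) (G : I -> mp) : lin_fun L ->
  L (\sum_(i <- r) c i *: G i) = \sum_(i <- r) c i * L (G i).
Proof.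
move=> LL; elim: r => [|i r IH]; first by rewrite !big_nil lin_fun0.
by rewrite !big_cons LL IH.
Qed.

Lemma pair_sum_lin F : lin_fun (pair_sum F).
Proof.
move=> c p q; rewrite /pair_sum mulr_sumr -big_split/=; apply: eq_bigr => ab _.
by rewrite mulrDl -scalerAl pvD pvZ dtDl dtZl.
Qed.

Lemma lin_funB L F : lin_fun L -> lin_fun (fun p => L p - pair_sum F p).
Proof. by move=> LL c p q; rewrite LL pair_sum_lin mulrBr opprD addrACA. Qed.

Lemma pair_sum_nil p : pair_sum [::] p = 0.
Proof. exact: big_nil. Qed.

Lemma pair_sum_cat F F' p : pair_sum (F ++ F') p = pair_sum F p + pair_sum F' p.
Proof. by rewrite /pair_sum big_cat. Qed.

Lemma pair_mass_cat F F' : pair_mass (F ++ F') = pair_mass F + pair_mass F'.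
Proof. by rewrite /pair_mass big_cat. Qed.

Lemma pair_sum_scale t F p : pair_sum (pair_scale t F) p = (t ^+ 2)%:C * pair_sum F p.
Proof.
rewrite /pair_sum big_map mulr_sumr; apply: eq_bigr => ab _ /=.
by rewrite -scalerAr !pvZ dtZl dtZr conjc_real mulrA -rmorphM.
Qed.

Lemma pair_mass_scale t F : pair_mass (pair_scale t F) = t ^+ 2 * pair_mass F.
Proof.
rewrite /pair_mass big_map mulr_sumr; apply: eq_bigr => ab _ /=.
by rewrite !pvZ !hn_sqrZ mulrDr.
Qed.

Lemma pair_sum_bound F p M : Nb p M -> cabs (pair_sum F p) <= M * pair_mass F / 2.
Proof.
move=> pM; have M0 := Nb_ge0 pM; rewrite /pair_sum /pair_mass mulr_sumr mulr_suml.
apply: (le_trans (cabs_sum _ _ _)); apply: ler_sum => ab _; rewrite -pv_mul.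
apply: (le_trans (dt_le _ _)); apply: le_trans (ler_wpM2r (hn_ge0 _) (pM _)) _.
exact: mul_le_sqr.
Qed.

Section nearest.
Variables (L : mp -> C) (c : R) (N : nat).
Hypotheses (c0 : 0 < c) (LL : lin_fun L).
Hypothesis Lc : forall p M, Nb p M -> cabs (L p) <= c * M.

Local Notation I := (bmultinom d.+1 N).
Let X (i : I) : mp := mpolyX C i.
Let defect F : R := \sum_(i : I) cabs (L (X i) - pair_sum F (X i)) ^+ 2.

(* Finite-dimensional Hahn-Banach by first variation: at a near-minimizer [F0]
   of the squared distance, the conjugate of the defect is a polynomial [T] whose
   operator norm is at most [1 / c] times the near-maximum of [Re (pair_sum F T)]. *)
Lemma nearest_functional (eta : R) : 0 < eta ->
  exists2 F, pair_mass F <= 2 * c & \sum_(i : I) cabs (L (X i) - pair_sum F (X i)) ^+ 2 <= eta.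
Proof.
move=> eta0.
pose A := [set defect F | F in [set F | pair_mass F <= 2 * c]].
have infA : has_inf A.
  split; last by exists 0 => _ [F _ <-]; apply: sumr_ge0 => i _; exact: sqr_ge0.
  by exists (defect [::]), [::] => //=; rewrite /pair_mass big_nil mulr_ge0// ltW.
have /choice[K KP] : forall i : I, exists K, 0 <= K /\ Nb (X i) K.
  by move=> i; have [K K0 KN] := Nb_exists (X i); exists K.
have fK F i : pair_mass F <= 2 * c -> cabs (pair_sum F (X i)) <= c * K i.
  move=> Fc; have [K0 KN] := KP i; apply: (le_trans (pair_sum_bound F KN)).
  rewrite ler_pdivrMr// mulrC (mulrAC c) ler_wpM2r//.
  by rewrite mulrC.
pose B := \sum_(i : I) (2 * c * K i) ^+ 2.
have B0 : 0 <= B by apply: sumr_ge0 => i _; exact: sqr_ge0.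
have FB F F' : pair_mass F <= 2 * c -> pair_mass F' <= 2 * c ->
    \sum_(i : I) cabs (pair_sum F (X i) - pair_sum F' (X i)) ^+ 2 <= B.
  move=> Fc F'c; apply: ler_sum => i _; have [K0 _] := KP i.
  rewrite ler_pXn2r ?nnegrE ?cabs_ge0 ?mulr_ge0 ?(ltW c0)//.
  apply: (le_trans (cabsB _ _)); have := fK _ i Fc; have := fK _ i F'c; lra.
(* A step so short that the quadratic term of the variation, at most $t^2 B$, does not exceed
   $t\,eta$. *)
pose t := eta / (B + eta); have D0 : 0 < B + eta by rewrite ltr_wpDl.
have t0 : 0 < t by rewrite divr_gt0.
have t1 : t <= 1 by rewrite ler_pdivrMr// mul1r lerDr.
have tB : t * B <= eta.
  by rewrite /t mulrAC ler_pdivrMr// ler_wpM2l ?(ltW eta0)// lerDl ltW.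
have te0 : 0 < t * eta by rewrite mulr_gt0.
have [_ [F0 F0c <-] F0d] := inf_adherent te0 infA.
pose g i := L (X i) - pair_sum F0 (X i).
pose T : mp := \sum_i (g i)^*%C *: X i.
have S_le F : pair_mass F <= 2 * c -> complex.Re (pair_sum F T) <= complex.Re (pair_sum F0 T) + eta.
  (* The list form of the convex combination $(1-t)F_0 + tF$. *)
  move=> Fc; pose Ft := pair_scale (Num.sqrt (1 - t)) F0 ++ pair_scale (Num.sqrt t) F.
  have t1' : 0 <= 1 - t by rewrite subr_ge0.
  have Ftc : pair_mass Ft <= 2 * c.
    rewrite /Ft pair_mass_cat !pair_mass_scale !sqr_sqrtr ?(ltW t0)//.
    have := ler_wpM2l t1' F0c; have := ler_wpM2l (ltW t0) Fc.
    by move: (pair_mass F) (pair_mass F0) (t) => *; lra.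
  have : inf A <= defect Ft by apply: ge_inf; [have [] := infA|exists Ft].
  have -> : defect Ft = defect F0
      - 2 * t * (complex.Re (pair_sum F T) - complex.Re (pair_sum F0 T))
      + t ^+ 2 * \sum_(i : I) cabs (pair_sum F (X i) - pair_sum F0 (X i)) ^+ 2.
    rewrite /T !lin_fun_sum; try exact: pair_sum_lin.
    rewrite !cRe_sum -sumrB !mulr_sumr -sumrB -big_split/=; apply: eq_bigr => i _.
    rewrite pair_sum_cat !pair_sum_scale !sqr_sqrtr ?(ltW t0)//.
    rewrite {1}rmorphB rmorph1 /g; move: (L _) (pair_sum F _) (pair_sum F0 _) => [l1 l2] [x1 x2] [y1 y2].
    by rewrite !cabs_sqr /=; ring.
  have := FB F F0 Fc F0c; move: F0d.
  have h (e i b D x y : R) : 0 <= b -> e < i + t * eta -> D <= b -> t * b <= eta ->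
      i <= e - 2 * t * (x - y) + t ^+ 2 * D -> x <= y + eta.
    move=> b0 h1 h2 h3 h4; have h5 : t ^+ 2 * D <= t * eta.
      by rewrite expr2 -mulrA ler_wpM2l ?(ltW t0)// (le_trans _ h3)// ler_wpM2l ?(ltW t0).
    have : t * (2 * (x - y)) <= t * (2 * eta).
      by move: h4 h5 h1; rewrite expr2; lra.
    by rewrite ler_pM2l//; lra.
  by move=> h1 h2 h3; exact: h B0 h1 h2 tB h3.
pose k := complex.Re (pair_sum F0 T) + eta.
have k0 : 0 <= k.
  have := S_le [::]; rewrite /pair_mass /pair_sum !big_nil; apply.
  by rewrite mulr_ge0// ltW.
have NT : Nb T (k / c).
  apply: Nb_quadratic; first by rewrite divr_ge0// ltW.
  move=> a b; set x := hn _ ^+ 2 + hn _ ^+ 2.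
  have x0 : 0 <= x by rewrite addr_ge0 ?sqr_ge0.
  have [x00|xn0] := eqVneq x 0.
    have : pv b = 0.
      apply/eqP; rewrite -hn_eq0 -sqrf_eq0.
      by move/eqP: x00; rewrite paddr_eq0 ?sqr_ge0// => /andP[].
    by move=> ->; rewrite dt0r x00 mulr0 mul0r.
  have x1 : 0 < x by rewrite lt_neqAle eq_sym xn0.
  have s0 : 0 <= 2 * c / x by rewrite divr_ge0 ?mulr_ge0// ltW.
  (* A single pair rescaled to mass exactly $2c$ competes with [F0], which bounds the quadratic form
     of [T]. *)
  have := S_le (pair_scale (Num.sqrt (2 * c / x)) [:: (a, b)]).
  rewrite pair_mass_scale pair_sum_scale sqr_sqrtr// /pair_mass /pair_sum !big_seq1 -/x divfK// -/(pair_sum F0 T) -/k.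
  move=> /(_ (lexx _)).
  have -> : complex.Re ((2 * c / x)%:C * dt (pv (T * a)) (pv b)) =
      2 * c / x * complex.Re (dt (pv (T * a)) (pv b)).
    by rewrite cReM mul0r subr0.
  move: (complex.Re _) => y hy.
  have -> : y = x / (2 * c) * (2 * c / x * y).
    by field; rewrite xn0 gt_eqF.
  have -> : k / c * x / 2 = x / (2 * c) * k by field; rewrite gt_eqF.
  by rewrite ler_wpM2l// divr_ge0// mulr_ge0// ltW.
exists F0 => //.
(* The squared defect equals the real part of $L(T) - F_0(T)$, while $L(T)$ is at most $c \cdot k/c
   = k$, which exceeds the real part of $F_0(T)$ by [eta]. *)
have := Lc NT; rewrite mulrC divfK ?gt_eqF// => /(le_trans (Re_le_cabs _)) /(le_trans (ler_norm _)).
rewrite /k => hT.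
suff -> : \sum_(i : I) cabs (L (X i) - pair_sum F0 (X i)) ^+ 2 = complex.Re (L T) - complex.Re (pair_sum F0 T).
  by move: hT; move: (complex.Re _) (complex.Re _) => *; lra.
rewrite /T !lin_fun_sum//; last exact: pair_sum_lin.
rewrite !cRe_sum -sumrB; apply: eq_bigr => i _; rewrite -/(g i) cabs_sqr.
rewrite /g; move: (L _) (pair_sum F0 _) => [l1 l2] [x1 x2] /=; ring.
Qed.

End nearest.
End functionals.

Section steps.
Implicit Types (a b : mp) (F : seq (mp * mp)) (L : mp -> C).

Lemma window_eq0 N a : exists S0, forall s, (S0 <= s)%N -> window N s a = 0.
Proof.
elim/mpoly_lin_ind: a => [m||c p q [S hS] [S' hS']].
- exists (mdeg m + N)%N => s ms; rewrite /window wtX ltnNge ms andbF scale0r//.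
- by exists 0%N => s _; exact: wt0.
- exists (maxn S S') => s; rewrite geq_max => /andP[/hS Sp /hS' Sq].
  by rewrite /window wt_lin -/(window N s p) -/(window N s q) Sp Sq scaler0 addr0.
Qed.

(** Each pair is replaced by its pairs of windows scaled by $N^{-1/2}$: [fejer_identity] gives the
    functional, [window_sqr] the mass. *)
Lemma fejer_pullback N F : (0 < N)%N -> exists2 F',
  pair_mass F' = pair_mass F & forall p, pair_sum F' p = pair_sum F (fejer N p).
Proof.
move=> N0; have NN0 : 0 < N%:R :> R by rewrite ltr0n.
elim: F => [|[a b] F [F' F'1 F'2]].
  exists [::]; first exact: erefl.
  move=> p; exact: (etrans (pair_sum_nil p) (esym (pair_sum_nil _))).
have [Sa ha] := window_eq0 N a.
have [S1 h1] := window_sqr a N0; have [S2 h2] := window_sqr b N0.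
pose S := maxn Sa (maxn S1 S2).
have {}h1 : _ := h1 S (leq_trans (leq_maxl _ _) (leq_maxr _ _)).
have {}h2 : _ := h2 S (leq_trans (leq_maxr _ _) (leq_maxr _ _)).
have h0 p : N%:R * dt (pv (fejer N p * a)) (pv b) =
    \sum_(0 <= s < S) dt (pv (p * window N s a)) (pv (window N s b)).
  (* The threshold of the identity depends on [p], but windows of [a] from [S] on vanish, so one
     list serves all [p]. *)
  have [T hT] := fejer_identity p a b N0; pose T' := maxn T S.
  rewrite (hT T' (leq_maxl _ _)) (big_cat_nat (n := S)) ?leq_maxr//=.
  rewrite [X in _ + X]big_nat [X in _ + X]big1 ?addr0// => s /andP[Ss _].
  by rewrite ha ?mulr0 ?pv0 ?dt0l// (leq_trans _ Ss)// leq_maxl.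
pose G := pair_scale (Num.sqrt N%:R^-1) [seq (window N s a, window N s b) | s <- index_iota 0 S].
have sN : Num.sqrt N%:R^-1 ^+ 2 = N%:R^-1 :> R by rewrite sqr_sqrtr// invr_ge0 ltW.
exists (G ++ F') => [|p].
  rewrite pair_mass_cat F'1 pair_mass_scale sN /pair_mass big_cons big_map big_split/=.
  rewrite [X in _ * (X + _)]h1 [X in _ * (_ + X)]h2 -mulrDr mulKf//.
  by rewrite gt_eqF.
rewrite pair_sum_cat F'2 pair_sum_scale sN /pair_sum big_cons big_map/= -h0.
congr (_ + _); rewrite -(rmorph_nat (real_complex R)) mulrA -rmorphM mulVf ?gt_eqF//.
by rewrite mul1r.
Qed.

(** Tameness for functionals on polynomials; here [s] is a positive radius, whereas in
    [henkin_density] it is the square of one. *)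
Definition dens L := forall e : R, 0 < e -> exists s K : R, [/\ 0 < s, s < 1, 0 <= K &
  forall p M m, Nb p M -> bnd p (s ^+ 2) m -> cabs (L p) <= e * M + K * m].

Lemma densD L L' : dens L -> dens L' -> dens (fun p => L p + L' p).
Proof.
move=> hL hL' e e0; have e20 : 0 < e / 2 by rewrite divr_gt0.
have [s [K [s0 s1 K0 h]]] := hL _ e20; have [s' [K' [s'0 s'1 K'0 h']]] := hL' _ e20.
exists (Num.max s s'), (K + K'); split.
- by rewrite lt_max s0.
- by rewrite gt_max s1.
- by rewrite addr_ge0.
move=> p M m pM pbm; apply: (le_trans (cabsD _ _)).
have sm : s ^+ 2 <= Num.max s s' ^+ 2.
  by rewrite ler_pXn2r ?nnegrE ?le_max ?lexx ?(ltW s0).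
have sm' : s' ^+ 2 <= Num.max s s' ^+ 2.
  by rewrite ler_pXn2r ?nnegrE ?le_max ?lexx ?(ltW s'0) ?orbT.
have := h p M m pM (bnd_le sm (lexx m) pbm).
have := h' p M m pM (bnd_le sm' (lexx m) pbm).
by move: (cabs _) (cabs _) => *; lra.
Qed.

Lemma densN L : dens L -> dens (fun p => - L p).
Proof.
move=> hL e /hL[s [K [s0 s1 K0 h]]]; exists s, K; split => // p M m pM pbm.
by rewrite cabsN h.
Qed.

Lemma points_in_ball (s : seq (C * uball R d.+1)) : exists2 r : R, 0 < r < 1 &
  forall c, c \in s -> nsq (sval c.2) <= r ^+ 2.
Proof.
elim: s => [|c s [r /andP[r0 r1] h]]; first by exists (1 / 2); [lra|].
pose t := (1 + nsq (sval c.2)) / 2.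
have n0 := nsq_ge0 (sval c.2); have n1 := nsq_uball c.2.
have ct : nsq (sval c.2) <= t ^+ 2.
  have := sqr_ge0 (1 - nsq (sval c.2)); rewrite /t; move: (nsq _) => x; nra.
have t0 : 0 <= t by rewrite /t; lra.
have t1 : t < 1 by rewrite /t; lra.
exists (Num.max r t); first by rewrite lt_max r0 gt_max r1 t1.
move=> c'; rewrite inE => /orP[/eqP ->|/h hr].
  apply: (le_trans ct); rewrite ler_pXn2r ?nnegrE ?le_max ?lexx ?t0 ?orbT//.
apply: (le_trans hr); rewrite ler_pXn2r ?nnegrE ?le_max ?lexx ?(ltW r0)//.
Qed.

Lemma dens_pair f y : dens (fun p => dt (mult_op (pm p) f) y).
Proof.
move=> e e0; have D0 : 0 < hn f + 1 by rewrite ltr_wpDl ?hn_ge0.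
have [s hs] := kernel_dense y (divr_gt0 e0 D0).
have [r /andP[r0 r1] hr] := points_in_ball s.
exists r, (\sum_(c <- s) cabs c.1 * cabs (ev f c.2)); split => //.
  by apply: sumr_ge0 => c _; rewrite mulr_ge0 ?cabs_ge0.
move=> p M m pM pbm; have M0 := Nb_ge0 pM.
rewrite -[y](subrK (kernel_comb H s)) dtDr; apply: (le_trans (cabsD _ _)); apply: lerD.
  apply: (le_trans (dt_le _ _)).
  apply: le_trans (ler_wpM2r (hn_ge0 _) (pM f)) _.
  rewrite -mulrA mulrC ler_wpM2r//.
  move: hs; rewrite ltr_pdivlMr// => /ltW; apply: le_trans.
  by rewrite mulrC ler_wpM2l ?hn_ge0// lerDl.
rewrite dt_kernel_comb mulr_suml; apply: (le_trans (cabs_sum _ _ _)).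
rewrite big_seq [leRHS]big_seq; apply: ler_sum => c cs.
rewrite mult_opE !cabsM cabsJ -mulrA ler_wpM2l ?cabs_ge0// mulrC ler_wpM2l ?cabs_ge0//.
by apply: pbm; exact: hr.
Qed.

Lemma dens_pair_sum F : dens (pair_sum F).
Proof.
elim: F => [|ab F IH].
  move=> e e0; exists (1 / 2), 0; split; [lra|lra|by []|] => p M m pM pbm.
  by rewrite pair_sum_nil cabs0 mul0r addr0 mulr_ge0 ?(ltW e0)// (Nb_ge0 pM).
have -> : pair_sum (ab :: F) = fun p => dt (mult_op (pm p) (pv ab.1)) (pv ab.2) + pair_sum F p.
  by apply/funext => p; rewrite /pair_sum big_cons pv_mul.
by apply: densD => //; exact: dens_pair.
Qed.

Lemma msize_fejer N p : (msize (fejer N p) <= N)%N.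
Proof.
rewrite msizeE; apply/bigmax_leqP_seq => m; rewrite mcoeff_msupp mcoeff_wt.
move=> h _; rewrite ltnNge; apply/negP => Nm; move/eqP: h; apply.
by move: Nm; rewrite -subn_eq0 => /eqP ->; rewrite !mul0r.
Qed.

(** Apply [L] to [p] minus its Fejer mean and to the mean. The difference has norm at most $2M$ and
    small values inside, so tameness with $eta/8$ and [N] large give $(eta/2)M$. The mean has
    finitely many coefficients, each at most $G_i M$, and [nearest_functional] handles them. *)
Lemma approximate_functional L (c eta : R) : 0 < c -> lin_fun L ->
  (forall p M, Nb p M -> cabs (L p) <= c * M) -> dens L -> 0 < eta ->
  exists2 F, pair_mass F <= 2 * c &
    forall p M, Nb p M -> cabs (L p - pair_sum F p) <= eta * M.
Proof.
move=> c0 LL Lc hL eta0; have e80 : 0 < eta / 8 by rewrite divr_gt0.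
have [s [K [s0 s1 K0 hK]]] := hL _ e80.
have := truncnS_gt (K * (1 - s) ^- 2 / (eta / 4)); set N := (Num.truncn _).+1.
have e40 : 0 < eta / 4 by rewrite divr_gt0.
have NN0 : 0 < N%:R :> R by rewrite ltr0n.
rewrite ltr_pdivrMr// [_ * (eta / 4)]mulrC -ltr_pdivrMr// => hN.
have /choice[G GP] : forall i : bmultinom d.+1 N, exists G : R, 0 <= G /\
    forall p M, bnd p 1 M -> cabs (mcoeff i p) <= G * M.
  move=> i; have [G G0 hG] := mcoeff_bound i (ltr01 : 0 < 1 :> R).
  by exists G; split => // p M pM; apply: hG; rewrite expr1n.
pose B := \sum_i G i; have B0 : 0 <= B by apply: sumr_ge0 => i _; case: (GP i).
have B1 : 0 < B + 1 by rewrite ltr_wpDl.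
have h0 : 0 < eta / 2 / (B + 1) by rewrite !divr_gt0.
have h20 : 0 < (eta / 2 / (B + 1)) ^+ 2 by rewrite exprn_gt0.
have [F Fc FL] := nearest_functional N c0 LL Lc h20.
have N0 : (0 < N)%N by [].
have [F' F'1 F'2] := fejer_pullback F N0.
exists F'; first by rewrite F'1.
move=> p M pM; have M0 := Nb_ge0 pM.
have sM := Nb_fejer N0 pM.
rewrite F'2 -[p in L p](subrK (fejer N p)) lin_funD//.
rewrite -addrA; apply: (le_trans (cabsD _ _)).
have part1 : cabs (L (p - fejer N p)) <= eta / 2 * M.
  have h1 := NbD pM (NbN sM); have h2 := fejer_bound N0 s0 s1 (Nb_bnd pM).
  apply: (le_trans (hK _ _ _ h1 h2)).
  have : M * (K * (1 - s) ^- 2 / N%:R) <= M * (eta / 4) by rewrite ler_wpM2l// ltW.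
  have -> : K * (M * (1 - s) ^- 2 / N%:R) = M * (K * (1 - s) ^- 2 / N%:R) by ring.
  move: (_ * (_ / _)) => *; lra.
have part2 : cabs (L (fejer N p) - pair_sum F (fejer N p)) <= eta / 2 * M.
  rewrite (mpolywE (msize_fejer N p)) !lin_fun_sum//; last exact: pair_sum_lin.
  rewrite -sumrB; apply: (le_trans (cabs_sum _ _ _)).
  apply: (@le_trans _ _ (\sum_(i : bmultinom d.+1 N) G i * M * (eta / 2 / (B + 1)))).
    apply: ler_sum => i _; rewrite -mulrBr cabsM; have [G0 hG] := GP i.
    apply: ler_pM; rewrite ?cabs_ge0//; first by apply: hG; exact: Nb_bnd.
    rewrite -(@ler_pXn2r _ 2) ?nnegrE ?cabs_ge0 ?(ltW h0)//.
    apply: le_trans FL; rewrite (bigD1 i)//= lerDl.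
    by apply: sumr_ge0 => j _; exact: sqr_ge0.
  rewrite -!mulr_suml -/B mulrAC ler_wpM2r//.
  rewrite mulrA ler_pdivrMr// mulrC ler_wpM2l ?lerDl//.
  by rewrite divr_ge0// ltW.
by move: part1 part2; move: (cabs _) (cabs _) => *; lra.
Qed.

End steps.

(** * Tame functionals are normal *)

Section predual_functionals.
Implicit Types (a b : mp) (F G : seq (mp * mp)) (L : mp -> C) (w : predual H).

Lemma dens_sum (s : seq nat) w : dens (fun p => \sum_(n <- s) pterm w (pm p) n).
Proof.
elim: s => [|n s IH].
  move=> e e0; exists (1 / 2), 0; split; [lra|lra|by []|] => p M m pM pm.
  by rewrite big_nil cabs0 mul0r addr0 mulr_ge0 ?(ltW e0)// (Nb_ge0 pM).
under eq_fun do rewrite big_cons.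
by apply: densD => //; exact: dens_pair.
Qed.

Lemma dens_predual w : dens (fun p => predual_eval w (mult_op (pm p))).
Proof.
move=> e e0; pose V := limn (series (pmass w)).
have cV : series (pmass w) @ \oo --> V := pmass_cvg w.
have e20 : 0 < e / 2 by rewrite divr_gt0.
have /cvgrPdist_lt/(_ _ e20)[N _ /(_ N (leqnn N)) /= hN] := cV.
have [s [K [s0 s1 K0 h]]] := dens_sum (index_iota 0 N) w e20.
exists s, K; split => // p M m pM pbm; have M0 := Nb_ge0 pM.
have h1 := predual_tail w N M0 pM; have := h p M m pM pbm.
rewrite -[X in cabs X <= _ -> _](_ : series (pterm w (pm p)) N = _); last by rewrite seriesEnat.
move=> h2; rewrite -[predual_eval _ _](subrK (series (pterm w (pm p)) N)).
apply: (le_trans (cabsD _ _)).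
have h3 : M / 2 * (V - series (pmass w) N) <= M / 2 * (e / 2).
  by rewrite ler_wpM2l ?divr_ge0// (le_trans (ler_norm _))// ltW.
have := le_trans h1 h3; have : 0 <= e * M by rewrite mulr_ge0// ltW.
move: h2; move: (cabs _) (cabs _) => *; lra.
Qed.

Section construction.
Variables (L : mp -> C) (c : R).
Hypotheses (c0 : 0 < c) (LL : lin_fun L) (dL : dens L).
Hypothesis Lc : forall p M, Nb p M -> cabs (L p) <= c * M.

Let good k G := forall p M, Nb p M -> cabs (L p - pair_sum G p) <= c * 4 ^- k * M.

(** One stage of a geometric iteration: the error drops by 4 while the added mass is proportional to
    the current error, hence summable. [good] is a premise under the existential so that choice
    yields a total function. *)
Lemma refine (kG : nat * seq (mp * mp)) : exists F, good kG.1 kG.2 ->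
  [/\ pair_mass F <= 2 * c * 4 ^- kG.1, (0 < size F)%N & good kG.1.+1 (kG.2 ++ F)].
Proof.
case: kG => k G /=; have [gG|nG] := pselect (good k G); last by exists [::].
have ck0 j : 0 < c * 4 ^- j by rewrite mulr_gt0// invr_gt0 exprn_gt0.
have dLG : dens (fun p => L p - pair_sum G p).
  by apply: densD => //; apply: densN; exact: dens_pair_sum.
have [F F1 F2] := approximate_functional (ck0 k) (lin_funB G LL) gG dLG (ck0 k.+1).
(* The null pair changes nothing but makes every stage nonempty, so the lists grow into an infinite
   sequence. *)
exists (rcons F (0, 0)) => _; split.
- rewrite -cats1 pair_mass_cat -mulrA [X in _ + X](_ : _ = 0) ?addr0//.
  by rewrite /pair_mass big_seq1/= pv0 hn0 expr0n addr0.
- by rewrite size_rcons.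
- move=> p M pM; rewrite -cats1 !pair_sum_cat [pair_sum [:: (0, 0)] p](_ : _ = 0).
    by rewrite addr0 opprD addrA; exact: F2.
  by rewrite /pair_sum big_seq1/= pv0 dt0r.
Qed.

Lemma predual_of_functional : exists w, forall p, predual_eval w (mult_op (pm p)) = L p.
Proof.
have /choice[ch chP] := refine.
pose G := fix G k := if k is k'.+1 then G k' ++ ch (k', G k') else [::].
have gG k : good k (G k).
  elim: k => [|k IH]; last by have [] := chP (k, G k) IH.
  by move=> p M pM; rewrite pair_sum_nil subr0 expr0 invr1 mulr1; exact: Lc.
(* Stage [k] adds at most $2c4^{-k}$, below the increment $\frac94 c4^{-k}$ of this bound. *)
have sG k : pair_mass (G k) <= 3 * c * (1 - 4 ^- k).
  elim: k => [|k IH]; first by rewrite /pair_mass big_nil expr0 invr1 subrr mulr0.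
  have [h _ _] := chP (k, G k) (gG k).
  rewrite [G k.+1]/= pair_mass_cat.
  have -> : 4 ^- k.+1 = 4 ^- k / 4 :> R by rewrite exprS invfM mulrC.
  have : 0 <= c * 4 ^- k by rewrite mulr_ge0 ?(ltW c0)// invr_ge0 exprn_ge0.
  move: h IH; rewrite /=; move: (4 ^- k) (pair_mass _) (pair_mass _) => *; lra.
have zG k : (k <= size (G k))%N.
  elim: k => // k IH; have [_ h _] := chP (k, G k) (gG k).
  by rewrite /= size_cat -addn1 leq_add.
(* The lists are prefixes of one another and the list of index $n+1$ has more than [n] entries, so
   the default is never read. *)
pose x n := nth (0, 0) (G n.+1) n.
have pre k j : exists T, G (k + j)%N = G k ++ T.
  elim: j => [|j [T IH]]; first by exists [::]; rewrite addn0 cats0.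
  by exists (T ++ ch ((k + j)%N, G (k + j)%N)); rewrite addnS /= {1}IH catA.
have xE k n : (n < size (G k))%N -> nth (0, 0) (G k) n = x n.
  move=> nk; rewrite /x; have nn := zG n.+1.
  have [kn|/ltnW nk'] := leqP k n.+1.
    have [T TE] := pre k (n.+1 - k)%N; rewrite subnKC// in TE.
    by rewrite TE nth_cat nk.
  have [T TE] := pre n.+1 (k - n.+1)%N; rewrite subnKC// in TE.
  by rewrite TE nth_cat nn.
have sumE (V : nmodType) (h : mp * mp -> V) k :
    \sum_(0 <= n < size (G k)) h (x n) = \sum_(ab <- G k) h ab.
  rewrite [RHS](big_nth (0, 0)) [LHS]big_nat [RHS]big_nat; apply: eq_bigr => n /andP[_ nk].
  by rewrite xE.
have mass (h : mp * mp -> R) : (forall ab, 0 <= h ab) ->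
    (forall ab, h ab <= hn (pv ab.1) ^+ 2 + hn (pv ab.2) ^+ 2) ->
    cvgn (series (fun n => h (x n))).
  move=> h0 hle; apply: nondecreasing_is_cvgn.
    by apply: nondecreasing_series => i _ _.
  exists (3 * c) => _ [n _ <-]; rewrite seriesEnat /=.
  apply: (@le_trans _ _ (\sum_(0 <= i < size (G n)) h (x i))).
    by rewrite [leRHS](big_cat_nat (n := n))//= lerDl sumr_ge0.
  rewrite sumE; apply: (@le_trans _ _ (pair_mass (G n))).
    by apply: ler_sum => ab _.
  apply: (le_trans (sG n)); apply: ler_piMr; first by rewrite mulr_ge0// ltW.
  by rewrite gerBl invr_ge0 exprn_ge0.
have l_sum : cvgn (series (fun n => `|pv (x n).1| ^+ 2)).
  apply: summable_normr; apply: (mass (fun ab => hn (pv ab.1) ^+ 2)) => ab; first exact: sqr_ge0.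
  by rewrite lerDl sqr_ge0.
have r_sum : cvgn (series (fun n => `|pv (x n).2| ^+ 2)).
  apply: summable_normr; apply: (mass (fun ab => hn (pv ab.2) ^+ 2)) => ab; first exact: sqr_ge0.
  by rewrite lerDr sqr_ge0.
pose w := Predual l_sum r_sum; exists w => p.
have [M M0 pM] := Nb_exists p.
apply/eqP; rewrite -subr_eq0 -cabs_eq0 eq_le cabs_ge0 andbT.
apply/ler_addgt0Pr => e e0; rewrite add0r.
have e20 : 0 < e / 2 by rewrite divr_gt0.
have [N hN] := cvg_cabs (predual_cvg w (pm p)) e20.
have [k Nk hk] : exists2 k, (N <= k)%N & c * 4 ^- k * M <= e / 2.
  have cM : 0 <= c * M by rewrite mulr_ge0// ltW.
  have cM1 : 0 < c * M + 1 by rewrite ltr_wpDl.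
  have : (fun k => (1 / 4) ^+ k) @ \oo --> (0 : R) by apply: cvg_expr; rewrite ger0_norm; lra.
  move=> /cvgrPdist_lt/(_ _ (divr_gt0 e20 cM1))[k0 _ h].
  exists (maxn N k0); first exact: leq_maxl.
  have /= := h (maxn N k0) (leq_maxr _ _); set k := maxn N k0.
  have q0 : 0 <= (1 / 4 : R) ^+ k by rewrite exprn_ge0//; lra.
  rewrite sub0r normrN ger0_norm// ltr_pdivlMr// => hq.
  have -> : c * 4 ^- k * M = (1 / 4) ^+ k * (c * M) by rewrite div1r exprVn; ring.
  by apply: le_trans (ltW hq); rewrite ler_wpM2l// lerDl.
have h1 := hN _ (leq_trans Nk (zG k)).
have h2 := le_trans (gG k p M pM) hk.
have sE : series (pterm w (pm p)) (size (G k)) = pair_sum (G k) p.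
  rewrite seriesEnat /= /pterm /=.
  rewrite (sumE _ (fun ab => dt (mult_op (pm p) (pv ab.1)) (pv ab.2))).
  by apply: eq_bigr => ab _; rewrite pv_mul.
rewrite sE in h1.
rewrite -[predual_eval _ _](subrK (pair_sum (G k) p)) -addrA.
apply: (le_trans (cabsD _ _)); rewrite [X in _ + X]cabsC.
by move: h1 h2; move: (cabs _) (cabs _) => *; lra.
Qed.

End construction.
End predual_functionals.

(** * Henkin measures and tame densities *)

Section henkin_functionals.
Local Notation T := (bsphere R d).
Implicit Types (phi psi : Mult H) (w : predual H).

Lemma mult_op_le phi (e : R) : (mult_norm phi < e%:E)%E ->
  forall f, hn (mult_op phi f) <= e * hn f.
Proof.
move=> pe f; have [/eqP|f0] := eqVneq (hn f) 0.
  by rewrite hn_eq0 => /eqP ->; rewrite mult_op0 !hn0 mulr0.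
have f1 : 0 < hn f by rewrite lt_neqAle eq_sym f0 hn_ge0.
pose h := (hn f)^-1%:C *: f.
have h1 : hn h = 1.
  by rewrite hnZ cabs_real ger0_norm ?invr_ge0 ?hn_ge0// mulVf.
have : ((hn (mult_op phi h))%:E <= mult_norm phi)%E.
  by apply: ereal_sup_ubound; exists h => //=; rewrite hnE h1.
move=> /le_lt_trans /(_ pe); rewrite lte_fin /h mult_opZ hnZ.
rewrite cabs_real ger0_norm ?invr_ge0 ?hn_ge0// mulrC.
by rewrite ltr_pdivrMr// => /ltW.
Qed.

Lemma val_le phi (e : R) : 0 <= e -> (forall f, hn (mult_op phi f) <= e * hn f) ->
  forall z, cabs (val phi z) <= e.
Proof.
move=> e0 pe z; have k0 : 0 < hn (kp z).
  rewrite lt_neqAle hn_ge0 eq_sym andbT hn_eq0; apply/eqP => o0.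
  by have := ev_one z; rewrite evE o0 dt0r => /eqP; rewrite eq_sym oner_eq0.
have := le_trans (dt_le (mult_op phi (kp z)) (kp z)) (ler_wpM2r (hn_ge0 _) (pe (kp z))).
rewrite -evE mult_opE evE dt_sqr cabsM cabs_real ger0_norm ?exprn_ge0 ?hn_ge0//.
by rewrite -mulrA -expr2 ler_pM2r// exprn_gt0.
Qed.

Lemma mult_op_0 f : mult_op (0 : Mult H) f = 0.
Proof.
by have := mult_op_linl (0 : Mult H) 0 (-1) f; rewrite scaler0 addr0 scaleN1r addNr.
Qed.

Lemma pm_A_alg p : A_alg H (pm p).
Proof.
move=> e e0; exists (pm p); split; first by exists p.
apply: le_lt_trans (_ : (0%:E < e%:E)%E); last by rewrite lte_fin.
rewrite subrr; apply: ge_ereal_sup => _ [f _ <-].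
by rewrite mult_op_0 normr0.
Qed.

Lemma boundary_pm p : boundary_extension (poly_fun p) (pev p).
Proof. by split => //; apply: continuous_subspaceT; exact: continuous_pev. Qed.

Lemma dens_dominated (L : mp -> C) (s : seq (predual H)) (K : R) : 0 <= K ->
  (forall p, cabs (L p) <= K * \sum_(w <- s) cabs (predual_eval w (mult_op (pm p)))) ->
  dens L.
Proof.
move=> K0 LK.
have sum e : 0 < e -> exists r B : R, [/\ 0 < r, r < 1, 0 <= B & forall p M m,
    Nb p M -> bnd p (r ^+ 2) m ->
    \sum_(w <- s) cabs (predual_eval w (mult_op (pm p))) <= e * M + B * m].
  elim: s {LK} e => [|w s IH] e e0.
    exists (1 / 2), 0; split; [lra|lra|by []|] => p M m pM _.
    by rewrite big_nil mul0r addr0 mulr_ge0 ?(ltW e0)// (Nb_ge0 pM).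
  have e20 : 0 < e / 2 by rewrite divr_gt0.
  have [r [B [r0 r1 B0 hB]]] := IH _ e20.
  have [r' [B' [r'0 r'1 B'0 hB']]] := dens_predual w e20.
  exists (Num.max r r'), (B' + B); split.
  - by rewrite lt_max r0.
  - by rewrite gt_max r1.
  - by rewrite addr_ge0.
  move=> p M m pM pbm; rewrite big_cons.
  have rm : r ^+ 2 <= Num.max r r' ^+ 2.
    by rewrite ler_pXn2r ?nnegrE ?le_max ?lexx ?(ltW r0).
  have rm' : r' ^+ 2 <= Num.max r r' ^+ 2.
    by rewrite ler_pXn2r ?nnegrE ?le_max ?lexx ?(ltW r'0) ?orbT.
  have := hB p M m pM (bnd_le rm (lexx m) pbm).
  have := hB' p M m pM (bnd_le rm' (lexx m) pbm).
  by move: (cabs _) (\sum_(w <- s) _) => *; lra.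
move=> e e0; have K1 : 0 < K + 1 by rewrite ltr_wpDl.
have [r [B [r0 r1 B0 hB]]] := sum _ (divr_gt0 e0 K1).
exists r, (K * B); split => //; first by rewrite mulr_ge0.
move=> p M m pM pbm; apply: (le_trans (LK p)).
apply: le_trans (ler_wpM2l K0 (hB p M m pM pbm)) _.
rewrite mulrDr [K * (B * m)]mulrA lerD2r mulrA ler_wpM2r ?(Nb_ge0 pM)//.
by rewrite mulrA ler_pdivrMr// mulrC ler_wpM2l ?(ltW e0)// lerDl.
Qed.

(** Only the meaning of [s] changes: a squared radius [s] is replaced by the radius $(1+s)/2$,
    positive and with square at least [s]. *)
Lemma henkin_density_dens (tau : {finite_measure set T -> \bar R}) u :
  dens (fun p => cI tau (fun x => u x * ps p x)) <-> henkin_density tau Nb u.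
Proof.
split=> h e /h[s [K []]].
  move=> s0 s1 K0 hK; exists (s ^+ 2), K; split => //.
    by rewrite exprn_ge0// ltW.
  by rewrite exprn_ilt1// ltW.
move=> s0 s1 K0 hK; exists ((1 + s) / 2), K; split => //; [lra|lra|].
move=> p M m pM pbm; apply: hK => //; apply: bnd_le (lexx m) pbm.
by have := sqr_ge0 (1 - s); nra.
Qed.

Section functional_of_density.
Variables (tau : {finite_measure set T -> \bar R}) (nu : {charge set T -> \bar C}).
Variable g : T -> C.
Hypotheses (g1 : L1 tau g) (gH : henkin_density tau Nb g).
Hypothesis gE : forall (F : T -> C) (B : R), cmeas F -> (forall x, cabs (F x) <= B) ->
  integral_complex nu F = cI tau (fun x => g x * F x).

(** The normal functional agrees with the integral on polynomials by construction; both sides are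
    continuous under multiplier-norm approximation, which extends the equality to the closure. *)
Lemma henkin_of_density : henkin H nu.
Proof.
pose Lam p := cI tau (fun x => g x * ps p x).
have LL : lin_fun Lam.
  move=> c p q; rewrite /Lam -cIZ; last exact: L1_ps.
  rewrite -cID; [|exact: L1Z (L1_ps _ g1)|exact: L1_ps].
  by congr cI; apply/funext => x; rewrite /ps pevD pevZ; ring.
have N0 := N1_ge0 tau g.
have c0 : 0 < 2 * N1 tau g + 1 by rewrite ltr_wpDl// mulr_ge0.
have Lc p M : Nb p M -> cabs (Lam p) <= (2 * N1 tau g + 1) * M.
  move=> pM; apply: (le_trans (cI_ps_le g1 (Nb_bnd pM))).
  have := Nb_ge0 pM; move: (N1 tau g) N0 => n n0 M0; lra.
have [w wE] := predual_of_functional c0 LL ((henkin_density_dens tau g).2 gH) Lc.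
pose L phi := predual_eval w (mult_op phi).
have Llin : linear_for *%R L by move=> a phi psi; exact: predual_lin.
pose Ls : {scalar Mult H} := HB.pack L (GRing.isLinear.Build C (Mult H) C *%R L Llin).
exists Ls; split; first exact: predual_eval_continuous.
move=> f fA F [cF Ff]; rewrite -[Ls f]/(L f).
pose G (x : T) := F (sval x); have mG : cmeas G := cmeas_boundary cF.
(* One polynomial serves twice: closeness in multiplier norm bounds the difference in the open ball,
   and [boundary_le] carries the bound to the sphere. *)
have approx e : 0 < e -> exists p, (forall h, hn (mult_op (f - pm p) h) <= e * hn h) /\
    forall x, cabs (G x - ps p x) <= e.
  move=> e0; have [psi [[p pE] hp]] := fA e e0.
  have psiE : psi = pm p by apply: val_inj; rewrite pE.
  rewrite psiE in hp; have h1 := mult_op_le hp; exists p; split => //.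
  have cD : {within @closed_uball R d.+1, continuous (fun z => F z - pev p z)}.
    move=> z; apply: continuousB; first exact: cF.
    by apply: continuous_subspaceT; exact: continuous_pev.
  apply: (boundary_le cD) => z z1.
  have := val_le (ltW e0) h1 (upoint z1).
  have -> : val (f - pm p) (upoint z1) = val f (upoint z1) - pev p z.
    have := mult_opE (f - pm p) one (upoint z1); rewrite ev_one mulr1 => <-.
    rewrite -[f - pm p]addrC -scaleN1r mult_op_linl evD evZ !mult_opE ev_one !mulr1.
    by rewrite mulN1r addrC.
  by rewrite -Ff.
have [B GB] : exists B, forall x, cabs (G x) <= B.
  have [p [_ hp]] := approx 1 ltr01; have [K K0 hK] := bnd_exists p.
  exists (1 + K) => x; rewrite -(subrK (ps p x) (G x)).
  by apply: (le_trans (cabsD _ _)); rewrite lerD// ps_bound.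
rewrite (gE mG GB).
apply/eqP; rewrite -subr_eq0 -cabs_eq0 eq_le cabs_ge0 andbT.
pose V := limn (series (pmass w)).
have V0 : 0 <= V.
  apply: limr_ge; first exact: pmass_cvg.
  by apply: nearW => n; rewrite seriesEnat /=; apply: sumr_ge0 => i _; exact: pmass_ge0.
apply/ler_addgt0Pr => e e0; rewrite add0r.
have D0 : 0 < V / 2 + 2 * N1 tau g + 1.
  by rewrite ltr_wpDl// addr_ge0 ?divr_ge0 ?mulr_ge0.
(* The functional contributes $kV/2$ and the integral $2k$ times the norm of [g]; the 1 keeps the
   denominator positive. *)
pose k := e / (V / 2 + 2 * N1 tau g + 1); have k0 : 0 < k by rewrite divr_gt0.
have [p [h1 h2]] := approx k k0.
have -> : L f - cI tau (fun x => g x * G x) =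
    L (f - pm p) - cI tau (fun x => g x * (G x - ps p x)).
  have -> : L (f - pm p) = L f - Lam p.
    by rewrite -wE addrC -scaleN1r /L predual_lin mulN1r addrC.
  have -> : (fun x => g x * (G x - ps p x)) = fun x => g x * G x - g x * ps p x.
    by apply/funext => x; rewrite mulrBr.
  rewrite cIB; [by rewrite opprB addrA subrK| |exact: L1_ps].
  by under eq_fun do rewrite mulrC; exact: (L1M mG GB).
apply: (le_trans (cabsB _ _)).
have h3 : cabs (L (f - pm p)) <= k / 2 * V.
  have := predual_tail w 0 (ltW k0) h1.
  by rewrite !seriesEnat /= !big_geq// !subr0.
have h4 : cabs (cI tau (fun x => g x * (G x - ps p x))) <= 2 * (k * N1 tau g).
  have i1 : L1 tau (fun x => g x * (G x - ps p x)).
    under eq_fun do rewrite mulrC.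
    by apply: (@L1M _ _ _ _ _ _ k) => //; apply: cmeasB => //; exact: cmeas_ps.
  apply: (le_trans (cI_le i1)); rewrite ler_pM2l//.
  by apply: N1_le => // x; rewrite cabsM mulrC ler_wpM2r ?cabs_ge0.
have kE : k * (V / 2 + 2 * N1 tau g + 1) = e by rewrite divfK// gt_eqF.
move: h3 h4 kE k0; move: (k) (V) (N1 tau g) (cabs _) (cabs _) => *; nra.
Qed.

End functional_of_density.

Lemma density_of_henkin (tau : {finite_measure set T -> \bar R})
    (mu : {charge set T -> \bar C}) (theta : T -> C) :
  (forall (F : T -> C) (B : R), cmeas F -> (forall x, cabs (F x) <= B) ->
    integral_complex mu F = cI tau (fun x => theta x * F x)) ->
  henkin H mu -> henkin_density tau Nb theta.
Proof.
move=> thetaE [L [cL LE]]; apply/henkin_density_dens.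
have [s [K [K0 LK]]] := @weak_star_bounded _ _ H L (fun a phi psi => linearP L a phi psi) cL.
apply: (dens_dominated (s := s) K0) => p.
have -> : cI tau (fun x => theta x * ps p x) = L (pm p).
  have [B B0 pB] := bnd_exists p.
  rewrite -(thetaE _ B (cmeas_ps p)); last by move=> x; exact: ps_bound.
  by rewrite (LE _ (pm_A_alg p) _ (boundary_pm p)).
exact: LK.
Qed.

End henkin_functionals.

End poly_vectors.

Theorem lemma3p3 (R : realType) (d : nat) (H : rkhs R (uball R d.+1))
  (Hinv : unitarily_invariant H)
  (Hpoly : forall p : mpoly.mpoly d.+1 R[i], is_multiplier H (poly_fun p))
  (mu nu : {charge set bsphere R d -> \bar R[i]})
  (mu_regular : regular_measure mu) (nu_regular : regular_measure nu)
  (mu_henkin : henkin H mu) (nu_mu : abs_continuous nu mu) :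
  henkin H nu.
Proof.
have [t1 [mr mi]] := dominating_measure (chRe mu) (chIm mu).
have [t2 [nr ni]] := dominating_measure (chRe nu) (chIm nu).
pose tau : {finite_measure set bsphere R d -> \bar R} := fsum t1 t2.
have [d1 d2] := fsum_dominates t1 t2.
have [theta [theta1 thetaE thetaA]] :=
  density_complex (dominated_trans (tau' := tau) d1 mr) (dominated_trans (tau' := tau) d1 mi).
have [g [g1 gE gA]] :=
  density_complex (dominated_trans (tau' := tau) d2 nr) (dominated_trans (tau' := tau) d2 ni).
pose Z := [set x | theta x = 0].
have mZ : measurable Z.
  have -> : Z = (fun x => cabs (theta x)) @^-1` [set 0].
    by apply/seteqP; split => x /=; [move=> ->; rewrite cabs0|move/eqP; rewrite cabs_eq0 => /eqP].
  rewrite -[_ @^-1` _]setTI; apply: measurable_cabs => //; exact: theta1.1.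
have u1 : L1 tau (fun x => cindic R Z x * g x).
  by apply: L1M g1; [exact: cmeas_cindic|exact: cabs_cindic].
have thetaH := @density_of_henkin R d H Hinv Hpoly tau mu theta thetaE mu_henkin.
(* Absolute continuity enters here: [theta] vanishes on [Z], so every measurable subset of [Z] is
   null for [mu], hence for its total variation and then for [nu]; the density [g] of [nu] therefore
   vanishes almost everywhere on [Z]. *)
suff gZ : N1 tau (fun x => cindic R Z x * g x) = 0.
  apply: (@henkin_of_density R d H Hinv Hpoly tau nu g g1 _ gE).
  exact: (henkin_density_band (@Nb_bnd R d H Hinv Hpoly) (Nb_mul Hpoly) theta1 thetaH g1 gZ).
apply: N1_eq0 => // B mB.
have -> : (fun x => cindic R Z x * g x * cindic R B x) =
    (fun x => g x * cindic R (Z `&` B) x).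
  apply/funext => x; rewrite [_ * g x]mulrC -mulrA; congr (_ * _).
  by rewrite /cindic indicI -rmorphM.
have mZB : measurable (Z `&` B) by exact: measurableI.
rewrite -gA// nu_mu//; apply: null_total_variation => // A mA AZ.
rewrite -[LHS]fineK ?fin_num_measure// thetaA//.
have -> : (fun x => theta x * cindic R A x) = fun=> 0.
  apply/funext => x; rewrite /cindic indicE.
  have [xA|_] := boolP (x \in A); last by rewrite mulr0.
  by have [-> _] := AZ x (set_mem xA); rewrite mul0r.
by rewrite /cI /Rintegral !integral0.
Qed.
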